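(* Let $\Bbbk$ be an algebraically closed field of odd characteristic $p>0$, $V$ a finite-dimensional symplectic vector space over $\Bbbk$, $\Gamma\subset Sp(V)$ a finite subgroup of order prime to $p$, and $c$ a $\Gamma$-invariant function on the set $S$ of symplectic reflections of $\Gamma$. Let $\mathsf{Z}_{1,c}$ be the center of the symplectic reflection algebra $\mathsf{H}_{1,c}(V,\Gamma)$, with the filtration induced from $\mathsf{H}_{1,c}(V,\Gamma)$. Then there is a graded algebra isomorphism $$\mathrm{gr}(\mathsf{Z}_{1,c})=\big((SV)^p\big)^\Gamma .$$
   Context: $S\subset\Gamma$ is the set of symplectic reflections: elements $s\in\Gamma$ with $\mathrm{rk}(1-s)=2$. Let $\omega$ be the symplectic form on $V$ and, for $s\in S$, let $\omega_s$ be the skew form on $V$ which equals $\omega$ on $\mathrm{Im}(1-s)$ and has $\mathrm{Ker}(1-s)$ in its radical. For $t\in\Bbbk$ and a conjugation-invariant function $c:S\to\Bbbk$, $s\mapsto c_s$, the symplectic reflection algebra $\mathsf{H}_{t,c}(V,\Gamma)$ is the quotient of the smash product $TV\#\Gamma$ of the tensor algebra of $V$ with $\Gamma$ by the relations $xy-yx=t\,\omega(x,y)\cdot1+\sum_{s\in S}c_s\,\omega_s(x,y)\,s$ for $x,y\in V$. It is filtered by placing $\Gamma$ in degree $0$ and $V$ in degree $1$, and $\mathrm{gr}\,\mathsf{H}_{t,c}\cong SV\#\Gamma$, where $SV$ is the symmetric algebra. $(SV)^p=\{f^p: f\in SV\}$, a graded subalgebra of $SV$. *)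

(* Defs.v *)
From HB Require Import structures.
From mathcomp Require Import all_boot all_order all_fingroup all_algebra finmap.
From mathcomp Require Import generic_quotient boolp.
From mathcomp Require Import monalg.
From mathcomp Require Import mpoly.

Set Implicit Arguments.
Unset Strict Implicit.
Unset Printing Implicit Defensive.

Import GRing.Theory.

Local Open Scope ring_scope.
Local Open Scope quotient_scope.

(* A k-algebra, as a ring A with a ring morphism from k to the center of A.   *)
(* The library's algType requires 1 != 0, which for an algebra given by       *)
(* generators and relations is not known when it is defined.                  *)
HB.mixin Record isPzAlg (k : comNzRingType) A of GRing.PzRing A := {
  pzscal : k -> A;
  pzscal_zmod : zmod_morphism pzscal;
  pzscal_monoid : monoid_morphism pzscal;
  pzscalC : forall (a : k) (x : A), pzscal a * x = x * pzscal a
}.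

#[short(type="pzAlgType")]
HB.structure Definition PzAlg (k : comNzRingType) :=
  {A of GRing.PzRing A & isPzAlg k A}.

HB.mixin Record isTwoSidedIdeal (A : pzRingType) (I : A -> bool) := {
  idealMl : forall a x, x \in (I : {pred A}) -> a * x \in (I : {pred A});
  idealMr : forall a x, x \in (I : {pred A}) -> x * a \in (I : {pred A})
}.

#[short(type="twoSidedIdeal")]
HB.structure Definition TwoSidedIdeal (A : pzRingType) :=
  {I of GRing.ZmodClosed A I & isTwoSidedIdeal A I}.

Section QuotientAlgebra.
Variables (k : comNzRingType) (A : pzAlgType k) (I : twoSidedIdeal A).

Definition quotAlg : Type := Quotient.quot I.
HB.instance Definition _ := GRing.Zmodule.on quotAlg.

Definition quot_pi (x : A) : quotAlg := \pi_(Quotient.quot I) x.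

Lemma quot_piP x y : (quot_pi x = quot_pi y) <-> (x - y \in I).
Proof. by rewrite Quotient.idealrBE; split=> [h|/eqP//]; apply/eqP. Qed.

Lemma quot_pi_surj (u : quotAlg) : exists x, u = quot_pi x.
Proof. by exists (repr (u : Quotient.quot I)); rewrite /quot_pi reprK. Qed.

Lemma quot_pi_zmod : zmod_morphism quot_pi.
Proof. by move=> x y; rewrite /quot_pi !piE. Qed.

Lemma quot_piD : {morph quot_pi : x y / x + y}.
Proof. by move=> x y; rewrite /quot_pi !piE. Qed.

Definition quot_one : quotAlg := quot_pi 1.
Definition quot_mul (u v : quotAlg) : quotAlg :=
  quot_pi (repr (u : Quotient.quot I) * repr (v : Quotient.quot I)).

Lemma repr_quot x : repr (quot_pi x : Quotient.quot I) - x \in I.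
Proof. by apply/quot_piP; rewrite /quot_pi reprK. Qed.

Lemma quot_mulE x y : quot_mul (quot_pi x) (quot_pi y) = quot_pi (x * y).
Proof.
apply/quot_piP; set x' := repr _; set y' := repr _.
have -> : x' * y' - x * y = (x' - x) * y' + x * (y' - y).
  by rewrite mulrBl mulrBr addrA addrNK.
by apply: rpredD; [apply: idealMr|apply: idealMl]; apply: repr_quot.
Qed.

Fact quot_mulA : associative quot_mul.
Proof.
move=> u v w; have [x ->] := quot_pi_surj u; have [y ->] := quot_pi_surj v.
by have [z ->] := quot_pi_surj w; rewrite !quot_mulE mulrA.
Qed.

Fact quot_mul1 : left_id quot_one quot_mul.
Proof. by move=> u; have [x ->] := quot_pi_surj u; rewrite quot_mulE mul1r. Qed.

Fact quot_mulr1 : right_id quot_one quot_mul.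
Proof. by move=> u; have [x ->] := quot_pi_surj u; rewrite quot_mulE mulr1. Qed.

Fact quot_mulDl : left_distributive quot_mul +%R.
Proof.
move=> u v w; have [x ->] := quot_pi_surj u; have [y ->] := quot_pi_surj v.
have [z ->] := quot_pi_surj w.
by rewrite -quot_piD !quot_mulE -quot_piD mulrDl.
Qed.

Fact quot_mulDr : right_distributive quot_mul +%R.
Proof.
move=> u v w; have [x ->] := quot_pi_surj u; have [y ->] := quot_pi_surj v.
have [z ->] := quot_pi_surj w.
by rewrite -quot_piD !quot_mulE -quot_piD mulrDr.
Qed.

HB.instance Definition _ := GRing.Zmodule_isPzRing.Build quotAlg
  quot_mulA quot_mul1 quot_mulr1 quot_mulDl quot_mulDr.

Lemma quot_piM : {morph quot_pi : x y / x * y}.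
Proof. by move=> x y; rewrite -quot_mulE. Qed.

Lemma quot_pi_monoid : monoid_morphism quot_pi.
Proof. by split=> //; apply: quot_piM. Qed.

Definition quot_scal (a : k) : quotAlg := quot_pi (pzscal a).

Fact quot_scal_zmod : zmod_morphism quot_scal.
Proof. by move=> a b; rewrite /quot_scal pzscal_zmod quot_pi_zmod. Qed.

Fact quot_scal_monoid : monoid_morphism quot_scal.
Proof.
have [h1 hM] := pzscal_monoid (s := A); split; first by rewrite /quot_scal h1.
by move=> a b; rewrite /quot_scal hM quot_piM.
Qed.

Fact quot_scalC (a : k) (u : quotAlg) : quot_scal a * u = u * quot_scal a.
Proof.
by have [x ->] := quot_pi_surj u; rewrite -!quot_piM pzscalC.
Qed.

HB.instance Definition _ :=
  isPzAlg.Build k quotAlg quot_scal_zmod quot_scal_monoid quot_scalC.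

End QuotientAlgebra.

Section GeneratedIdeal.
Variables (A : pzRingType) (rel : A -> Prop).

Definition ideal_gen (x : A) : bool :=
  `[< exists s : seq (A * A * A), (forall u, u \in s -> rel u.1.2) /\
        x = \sum_(u <- s) u.1.1 * u.1.2 * u.2 >].

Fact ideal_gen_zmod : zmod_closed (ideal_gen : {pred A}).
Proof.
split; first by apply/asboolP; exists [::]; rewrite big_nil.
move=> x y /asboolP[s [hs ->]] /asboolP[s' [hs' ->]]; apply/asboolP.
exists (s ++ [seq (- u.1.1, u.1.2, u.2) | u <- s']); split.
  by move=> u; rewrite mem_cat => /orP[/hs//|/mapP[v /hs' ? ->]].
rewrite big_cat big_map /=; congr (_ + _); rewrite -sumrN.
by apply: eq_bigr => u _; rewrite !mulNr.
Qed.

HB.instance Definition _ := GRing.isZmodClosed.Build A ideal_gen ideal_gen_zmod.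

Fact ideal_gen_Ml (a x : A) :
  x \in (ideal_gen : {pred A}) -> a * x \in (ideal_gen : {pred A}).
Proof.
move=> /asboolP[s [hs ->]]; apply/asboolP.
exists [seq (a * u.1.1, u.1.2, u.2) | u <- s]; split.
  by move=> u /mapP[v /hs ? ->].
by rewrite big_map mulr_sumr; apply: eq_bigr => u _ /=; rewrite !mulrA.
Qed.

Fact ideal_gen_Mr (a x : A) :
  x \in (ideal_gen : {pred A}) -> x * a \in (ideal_gen : {pred A}).
Proof.
move=> /asboolP[s [hs ->]]; apply/asboolP.
exists [seq (u.1.1, u.1.2, u.2 * a) | u <- s]; split.
  by move=> u /mapP[v /hs ? ->].
by rewrite big_map mulr_suml; apply: eq_bigr => u _ /=; rewrite !mulrA.
Qed.

HB.instance Definition _ :=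
  isTwoSidedIdeal.Build A ideal_gen ideal_gen_Ml ideal_gen_Mr.

End GeneratedIdeal.

Section Center.
Variables (k : comNzRingType) (A : pzAlgType k).

Definition central (z : A) : bool := `[< forall x, z * x = x * z >].

Fact central_subring : GRing.subring_closed (central : {pred A}).
Proof.
split; first by apply/asboolP=> x; rewrite mul1r mulr1.
  move=> y z /asboolP hy /asboolP hz; apply/asboolP=> x.
  by rewrite mulrBl mulrBr hy hz.
move=> y z /asboolP hy /asboolP hz; apply/asboolP=> x.
by rewrite -mulrA hz mulrA hy mulrA.
Qed.

HB.instance Definition _ := GRing.isSubringClosed.Build A central central_subring.

Record center := Center { center_val : A; _ : center_val \in (central : {pred A}) }.

HB.instance Definition _ := [isSub for center_val].
HB.instance Definition _ := [Choice of center by <:].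
HB.instance Definition _ :=
  GRing.SubChoice_isSubPzRing.Build _ _ center central_subring.

Fact pzscal_central (a : k) : (pzscal a : A) \in (central : {pred A}).
Proof. by apply/asboolP=> x; apply: pzscalC. Qed.

Definition center_scal (a : k) : center := Center (pzscal_central a).

Fact center_scal_zmod : zmod_morphism center_scal.
Proof. by move=> a b; apply: val_inj; rewrite /= pzscal_zmod. Qed.

Fact center_scal_monoid : monoid_morphism center_scal.
Proof.
by split=> [|a b]; apply: val_inj; rewrite /= (pzscal_monoid (s := A)).
Qed.

Fact center_scalC (a : k) (x : center) : center_scal a * x = x * center_scal a.
Proof. by apply: val_inj; rewrite /= pzscalC. Qed.

HB.instance Definition _ :=
  isPzAlg.Build k center center_scal_zmod center_scal_monoid center_scalC.

End Center.

Record filtration (k : comNzRingType) (A : pzAlgType k) := Filtration {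
  fil :> nat -> A -> Prop;
  fil_0 : forall i, fil i 0;
  fil_B : forall i x y, fil i x -> fil i y -> fil i (x - y);
  fil_le : forall i j x, (i <= j)%N -> fil i x -> fil j x;
  fil_scal : forall a : k, fil 0%N (pzscal a);
  fil_M : forall i j x y, fil i x -> fil j y -> fil (i + j)%N (x * y)
}.

Section CenterFiltration.
Variables (k : comNzRingType) (A : pzAlgType k) (F : filtration A).

Definition center_fil (i : nat) (z : center A) : Prop := F i (val z).

Fact center_fil_0 i : center_fil i 0.
Proof. exact: fil_0. Qed.
Fact center_fil_B i x y :
  center_fil i x -> center_fil i y -> center_fil i (x - y).
Proof. exact: fil_B. Qed.
Fact center_fil_le i j x : (i <= j)%N -> center_fil i x -> center_fil j x.
Proof. exact: fil_le. Qed.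
Fact center_fil_scal (a : k) : center_fil 0 (pzscal a).
Proof. exact: (fil_scal F). Qed.
Fact center_fil_M i j x y :
  center_fil i x -> center_fil j y -> center_fil (i + j)%N (x * y).
Proof. exact: fil_M. Qed.

Definition center_filtration : filtration (center A) :=
  Filtration center_fil_0 center_fil_B center_fil_le center_fil_scal
             center_fil_M.

End CenterFiltration.

(* Formal power series over a not necessarily commutative algebra A, with the *)
(* Cauchy product. They only serve as the ambient algebra of Rees algebras.   *)
Section PowerSeries.
Variables (k : comNzRingType) (A : pzAlgType k).

Definition pseries : Type := nat -> A.
HB.instance Definition _ := Choice.on pseries.
Implicit Types f g h : pseries.

Definition ps_zero : pseries := fun=> 0.
Definition ps_opp f : pseries := fun n => - f n.
Definition ps_add f g : pseries := fun n => f n + g n.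
Definition ps_const (x : A) : pseries := fun n => if n is 0%N then x else 0.
Definition ps_mul f g : pseries := fun n => \sum_(j < n.+1) f j * g (n - j)%N.

Fact ps_addA : associative ps_add.
Proof. by move=> f g h; apply: funext => n; rewrite /ps_add addrA. Qed.
Fact ps_addC : commutative ps_add.
Proof. by move=> f g; apply: funext => n; rewrite /ps_add addrC. Qed.
Fact ps_add0 : left_id ps_zero ps_add.
Proof. by move=> f; apply: funext => n; rewrite /ps_add add0r. Qed.
Fact ps_addN : left_inverse ps_zero ps_opp ps_add.
Proof. by move=> f; apply: funext => n; rewrite /ps_add addNr. Qed.
HB.instance Definition _ :=
  GRing.isZmodule.Build pseries ps_addA ps_addC ps_add0 ps_addN.

Lemma ps_mul_rev f g n : ps_mul f g n = \sum_(j < n.+1) f (n - j)%N * g j.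
Proof.
rewrite /ps_mul (reindex_inj rev_ord_inj) /=.
by apply: eq_bigr => j _; rewrite subSS (sub_ordK j).
Qed.

Lemma ps_constMl x f n : ps_mul (ps_const x) f n = x * f n.
Proof.
rewrite /ps_mul big_ord_recl /= subn0 big1 ?addr0 // => j _.
by rewrite mul0r.
Qed.

Lemma ps_constMr x f n : ps_mul f (ps_const x) n = f n * x.
Proof.
rewrite ps_mul_rev big_ord_recl /= subn0 big1 ?addr0 // => j _.
by rewrite mulr0.
Qed.

Fact ps_mulA : associative ps_mul.
Proof.
move=> f g h; apply: funext => i; rewrite [RHS]ps_mul_rev.
pose term (j l : nat) := f j * (g (i - j - l)%N * h l).
transitivity (\sum_(j < i.+1) f j * ps_mul g h (i - j)%N) => //.
transitivity (\sum_(j < i.+1) \sum_(l < i.+1 | (l <= i - j)%N) term j l).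
  apply: eq_bigr => /= j _; rewrite ps_mul_rev big_distrr /=.
  by rewrite (big_ord_narrow_leq (leq_subr _ _)).
rewrite (exchange_big_dep predT) //=; apply: eq_bigr => l _.
transitivity (\sum_(j < i.+1 | (j <= i - l)%N) term j l).
  apply: eq_bigl => j; rewrite -ltnS -(ltnS j) -!subSn ?leq_ord //.
  by rewrite -subn_gt0 -(subn_gt0 j) -!subnDA addnC.
rewrite (big_ord_narrow_leq (leq_subr _ _)) /ps_mul big_distrl /=.
by apply: eq_bigr => j _; rewrite /term -!subnDA addnC mulrA.
Qed.

Fact ps_mul1 : left_id (ps_const 1) ps_mul.
Proof. by move=> f; apply: funext => n; rewrite ps_constMl mul1r. Qed.

Fact ps_mulr1 : right_id (ps_const 1) ps_mul.
Proof. by move=> f; apply: funext => n; rewrite ps_constMr mulr1. Qed.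

Fact ps_mulDl : left_distributive ps_mul +%R.
Proof.
move=> f g h; apply: funext => n.
rewrite [RHS](_ : _ = ps_mul f h n + ps_mul g h n) // /ps_mul -big_split /=.
by apply: eq_bigr => j _; rewrite -mulrDl.
Qed.

Fact ps_mulDr : right_distributive ps_mul +%R.
Proof.
move=> f g h; apply: funext => n.
rewrite [RHS](_ : _ = ps_mul f g n + ps_mul f h n) // /ps_mul -big_split /=.
by apply: eq_bigr => j _; rewrite -mulrDr.
Qed.

HB.instance Definition _ := GRing.Zmodule_isPzRing.Build pseries
  ps_mulA ps_mul1 ps_mulr1 ps_mulDl ps_mulDr.

Definition ps_scal (a : k) : pseries := ps_const (pzscal a).

Fact ps_scal_zmod : zmod_morphism ps_scal.
Proof.
move=> a b; apply: funext => -[|n]; rewrite /ps_scal /=.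
  by rewrite pzscal_zmod.
by symmetry; apply: subr0.
Qed.

Fact ps_scal_monoid : monoid_morphism ps_scal.
Proof.
have [h1 hM] := pzscal_monoid (s := A).
split; first by rewrite /ps_scal h1.
move=> a b; apply: funext => n; rewrite [RHS]ps_constMl /ps_scal.
by case: n => [|n] /=; rewrite ?hM ?mulr0.
Qed.

Fact ps_scalC (a : k) f : ps_scal a * f = f * ps_scal a.
Proof. by apply: funext => n; rewrite [LHS]ps_constMl [RHS]ps_constMr pzscalC. Qed.

HB.instance Definition _ :=
  isPzAlg.Build k pseries ps_scal_zmod ps_scal_monoid ps_scalC.

End PowerSeries.

(* gr F is the direct sum of the F_i / F_(i-1): elements of the direct sum of *)
(* the F_i are encoded as finitely supported sequences a with a i in F_i      *)
(* (the Rees algebra), modulo those with a i in F_(i-1) for all i.            *)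
Section AssociatedGraded.
Variables (k : comNzRingType) (A : pzAlgType k) (F : filtration A).

Definition rees_pred (a : pseries A) : bool :=
  `[< (exists N, forall i, (N <= i)%N -> a i = 0) /\ (forall i, F i (a i)) >].

Lemma fil_D i x y : F i x -> F i y -> F i (x + y).
Proof.
move=> hx hy; rewrite -[y]opprK; apply: fil_B => //.
by rewrite -sub0r; apply: fil_B => //; apply: fil_0.
Qed.

Lemma fil_sum i I (r : seq I) (P : pred I) (f : I -> A) :
  (forall j, P j -> F i (f j)) -> F i (\sum_(j <- r | P j) f j).
Proof.
move=> h; elim/big_rec: _ => [|j x Pj hx]; first exact: fil_0.
by apply: fil_D => //; apply: h.
Qed.

Fact rees_scal_subproof (a : k) : (pzscal a : pseries A) \in (rees_pred : {pred _}).
Proof.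
apply/asboolP; split; first by exists 1%N => -[].
by case=> [|i]; [apply: (fil_scal F)|apply: fil_0].
Qed.

Fact rees_subring : GRing.subring_closed (rees_pred : {pred pseries A}).
Proof.
split.
- by rewrite -(pzscal_monoid (s := pseries A)).1; apply: rees_scal_subproof.
- move=> a b /asboolP[[N hN] ha] /asboolP[[M hM] hb]; apply/asboolP; split.
    exists (maxn N M) => i; rewrite geq_max => /andP[/hN Ni /hM Mi].
    by rewrite [LHS](_ : _ = a i - b i) // Ni Mi subr0.
  by move=> i; apply: fil_B.
move=> a b /asboolP[[N hN] ha] /asboolP[[M hM] hb]; apply/asboolP; split.
  exists (N + M)%N => i le_i; apply: big1 => j _.
  have [/hN->|lt_jN] := leqP N j; first by rewrite mul0r.
  rewrite (hM (i - j)%N) ?mulr0 // -(leq_add2r j) subnK ?leq_ord //.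
  by rewrite (leq_trans _ le_i) // addnC leq_add2r ltnW.
move=> i; apply: fil_sum => j _.
by rewrite -{1}(subnKC (leq_ord j)); apply: fil_M.
Qed.

HB.instance Definition _ :=
  GRing.isSubringClosed.Build (pseries A) rees_pred rees_subring.

Record rees := Rees { rees_val : pseries A;
                      _ : rees_val \in (rees_pred : {pred pseries A}) }.

HB.instance Definition _ := [isSub for rees_val].
HB.instance Definition _ := [Choice of rees by <:].
HB.instance Definition _ :=
  GRing.SubChoice_isSubPzRing.Build _ _ rees rees_subring.

Definition rees_scal (a : k) : rees := Rees (rees_scal_subproof a).

Fact rees_scal_zmod : zmod_morphism rees_scal.
Proof. by move=> a b; apply: val_inj; rewrite /= pzscal_zmod. Qed.

Fact rees_scal_monoid : monoid_morphism rees_scal.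
Proof.
by split=> [|a b]; apply: val_inj; rewrite /= (pzscal_monoid (s := pseries A)).
Qed.

Fact rees_scalC (a : k) (x : rees) : rees_scal a * x = x * rees_scal a.
Proof. by apply: val_inj; rewrite /= pzscalC. Qed.

HB.instance Definition _ :=
  isPzAlg.Build k rees rees_scal_zmod rees_scal_monoid rees_scalC.

Definition fil_lt (i : nat) (x : A) : Prop :=
  if i is j.+1 then F j x else x = 0.

Definition gr_ideal (a : rees) : bool :=
  `[< forall i, fil_lt i (rees_val a i) >].

Lemma reesP (a : rees) i : F i (rees_val a i).
Proof. by case: a => a /= /asboolP[]. Qed.

Lemma fil_lt_sum i I (r : seq I) (P : pred I) (f : I -> A) :
  (forall j, P j -> fil_lt i (f j)) -> fil_lt i (\sum_(j <- r | P j) f j).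
Proof. by case: i => [|i] /= h; [apply: big1|apply: fil_sum]. Qed.

Lemma fil_lt_Ml i j x y : F i x -> fil_lt j y -> fil_lt (i + j)%N (x * y).
Proof.
move=> hx; case: j => [|j] /= hy; last by rewrite addnS; apply: fil_M.
by rewrite hy mulr0; case: (i + 0)%N => //= l; apply: fil_0.
Qed.

Lemma fil_lt_Mr i j x y : fil_lt i x -> F j y -> fil_lt (i + j)%N (x * y).
Proof.
case: i => [|i] /= hx hy; last exact: fil_M.
by rewrite hx mul0r; case: (0 + j)%N => //= l; apply: fil_0.
Qed.

Fact gr_ideal_zmod : zmod_closed (gr_ideal : {pred rees}).
Proof.
split; first by apply/asboolP=> -[|i] //=; apply: fil_0.
move=> a b /asboolP ha /asboolP hb; apply/asboolP=> i.
have -> : rees_val (a - b) i = rees_val a i - rees_val b i by [].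
case: i (ha i) (hb i) => [|i] /=; first by move=> -> ->; rewrite subrr.
exact: fil_B.
Qed.

HB.instance Definition _ := GRing.isZmodClosed.Build rees gr_ideal gr_ideal_zmod.

Fact gr_ideal_Ml (a x : rees) :
  x \in (gr_ideal : {pred rees}) -> a * x \in (gr_ideal : {pred rees}).
Proof.
move=> /asboolP hx; apply/asboolP=> i.
apply: fil_lt_sum => j _; rewrite -{1}(subnKC (leq_ord j)).
by apply: fil_lt_Ml => //; apply: reesP.
Qed.

Fact gr_ideal_Mr (a x : rees) :
  x \in (gr_ideal : {pred rees}) -> x * a \in (gr_ideal : {pred rees}).
Proof.
move=> /asboolP hx; apply/asboolP=> i.
apply: fil_lt_sum => j _; rewrite -{1}(subnKC (leq_ord j)).
by apply: fil_lt_Mr => //; apply: reesP.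
Qed.

HB.instance Definition _ :=
  isTwoSidedIdeal.Build rees gr_ideal gr_ideal_Ml gr_ideal_Mr.

Definition gr : Type := @quotAlg k rees (TwoSidedIdeal.clone _ gr_ideal _).
HB.instance Definition _ := PzAlg.on gr.

Definition gr_pi (a : rees) : gr := quot_pi _ a.

(* u lies in the summand F_d / F_(d-1).                                       *)
Definition gr_degree (d : nat) (u : gr) : Prop :=
  exists a : rees, (forall i, i != d -> rees_val a i = 0) /\
                   u = gr_pi a.

End AssociatedGraded.

Record algAction (gT : finGroupType) (k : comNzRingType) (A : pzAlgType k) :=
  AlgAction {
    alg_act :> gT -> A -> A;
    alg_act_zmod : forall g, zmod_morphism (alg_act g);
    alg_act_monoid : forall g, monoid_morphism (alg_act g);
    alg_act_scal : forall g (a : k), alg_act g (pzscal a) = pzscal a;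
    alg_act1 : forall x, alg_act 1%g x = x;
    alg_actM : forall g h x, alg_act (g * h)%g x = alg_act g (alg_act h x)
  }.

(* x stands for \sum_g x g # g, and (a # g) * (b # h) = a * (g b) # (g h).    *)
Definition smash (gT : finGroupType) (k : comNzRingType) (A : pzAlgType k)
  (act : algAction gT A) : Type := {ffun gT -> A}.

Section SmashProduct.
Variables (gT : finGroupType) (k : comNzRingType) (A : pzAlgType k).
Variable act : algAction gT A.

Local Notation smash := (smash act).
HB.instance Definition _ := GRing.Zmodule.on smash.
Implicit Types x y z : smash.

Definition smash_elt (a : A) (g : gT) : smash :=
  [ffun h => if h == g then a else 0].

Definition smash_one : smash := smash_elt 1 1%g.
Definition smash_mul x y : smash :=
  [ffun n => \sum_h x h * act h (y (h^-1 * n)%g)].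

HB.instance Definition _ g := GRing.isZmodMorphism.Build A A (act g)
  (alg_act_zmod act g).
HB.instance Definition _ g := GRing.isMonoidMorphism.Build A A (act g)
  (alg_act_monoid act g).

Fact smash_mulA : associative smash_mul.
Proof.
move=> x y z; apply/ffunP=> n; rewrite !ffunE.
transitivity (\sum_l \sum_h x l * (act l (y (l^-1 * h)%g) * act h (z (h^-1 * n)%g))).
  apply: eq_bigr => l _; rewrite ffunE raddf_sum mulr_sumr.
  rewrite (reindex_inj (mulgI l^-1%g)) /=; apply: eq_bigr => h _.
  by rewrite rmorphM /= -alg_actM mulKVg invMg invgK -mulgA mulKVg.
rewrite exchange_big /=; apply: eq_bigr => h _; rewrite ffunE mulr_suml.
by apply: eq_bigr => l _; rewrite mulrA.
Qed.

Lemma smash_eltMl a x n : smash_mul (smash_elt a 1%g) x n = a * x n.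
Proof.
rewrite ffunE (bigD1 1%g) //= big1 => [|h /negPf nh].
  by rewrite ffunE eqxx invg1 mul1g alg_act1 addr0.
by rewrite ffunE nh mul0r.
Qed.

Lemma smash_eltMr a x n : smash_mul x (smash_elt a 1%g) n = x n * act n a.
Proof.
rewrite ffunE (bigD1 n) //= big1 => [|h /negPf nh].
  by rewrite ffunE mulVg eqxx addr0.
by rewrite ffunE -eq_mulVg1 nh raddf0 mulr0.
Qed.

Fact smash_mul1 : left_id smash_one smash_mul.
Proof. by move=> x; apply/ffunP=> n; rewrite smash_eltMl mul1r. Qed.

Fact smash_mulr1 : right_id smash_one smash_mul.
Proof. by move=> x; apply/ffunP=> n; rewrite smash_eltMr rmorph1 mulr1. Qed.

Fact smash_mulDl : left_distributive smash_mul +%R.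
Proof.
move=> x y z; apply/ffunP=> n; rewrite !ffunE -big_split /=.
by apply: eq_bigr => h _; rewrite ffunE mulrDl.
Qed.

Fact smash_mulDr : right_distributive smash_mul +%R.
Proof.
move=> x y z; apply/ffunP=> n; rewrite !ffunE -big_split /=.
by apply: eq_bigr => h _; rewrite ffunE raddfD mulrDr.
Qed.

HB.instance Definition _ := GRing.Zmodule_isPzRing.Build smash
  smash_mulA smash_mul1 smash_mulr1 smash_mulDl smash_mulDr.

Lemma smash_eltM a b g h :
  smash_elt a g * smash_elt b h = smash_elt (a * act g b) (g * h)%g.
Proof.
apply/ffunP=> n; rewrite [LHS]ffunE (bigD1 g) //= big1 => [|l /negPf nl].
  rewrite !ffunE eqxx addr0 -(inj_eq (mulgI g)) mulKVg.
  by case: eqP => // _; rewrite raddf0 mulr0.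
by rewrite ffunE nl mul0r.
Qed.

Definition smash_scal (a : k) : smash := smash_elt (pzscal a) 1%g.

Fact smash_scal_zmod : zmod_morphism smash_scal.
Proof.
move=> a b; apply/ffunP=> n; rewrite !ffunE.
by case: eqP; rewrite ?pzscal_zmod ?subr0.
Qed.

Fact smash_scal_monoid : monoid_morphism smash_scal.
Proof.
have [h1 hM] := pzscal_monoid (s := A).
split; first by rewrite /smash_scal h1.
move=> a b; apply/ffunP=> n; rewrite [RHS]smash_eltMl !ffunE hM.
by case: eqP; rewrite ?mulr0.
Qed.

Fact smash_scalC (a : k) x : smash_scal a * x = x * smash_scal a.
Proof.
apply/ffunP=> n.
by rewrite [LHS]smash_eltMl [RHS]smash_eltMr alg_act_scal pzscalC.
Qed.

HB.instance Definition _ :=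
  isPzAlg.Build k smash smash_scal_zmod smash_scal_monoid smash_scalC.

End SmashProduct.

Section QuotientFiltration.
Variables (k : comNzRingType) (A : pzAlgType k) (I : twoSidedIdeal A).
Variable F : filtration A.

Definition quot_fil (i : nat) (u : quotAlg I) : Prop :=
  exists2 x, F i x & u = quot_pi I x.

Fact quot_fil_0 i : quot_fil i 0.
Proof.
exists 0; first exact: fil_0.
by rewrite -[0 in RHS](subrr 0) quot_pi_zmod subrr.
Qed.
Fact quot_fil_B i u v : quot_fil i u -> quot_fil i v -> quot_fil i (u - v).
Proof.
move=> [x hx ->] [y hy ->]; exists (x - y); first exact: fil_B.
by rewrite quot_pi_zmod.
Qed.
Fact quot_fil_le i j u : (i <= j)%N -> quot_fil i u -> quot_fil j u.
Proof. by move=> ij [x hx ->]; exists x => //; apply: fil_le hx. Qed.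
Fact quot_fil_scal (a : k) : quot_fil 0 (pzscal a).
Proof. by exists (pzscal a) => //; apply: fil_scal. Qed.
Fact quot_fil_M i j u v :
  quot_fil i u -> quot_fil j v -> quot_fil (i + j)%N (u * v).
Proof.
move=> [x hx ->] [y hy ->]; exists (x * y); first exact: fil_M.
by rewrite quot_piM.
Qed.

Definition quot_filtration : filtration (quotAlg I) :=
  Filtration quot_fil_0 quot_fil_B quot_fil_le quot_fil_scal quot_fil_M.

End QuotientFiltration.

Lemma malgC_central (k : comNzRingType) (K : monomType) (a : k) (x : {malg k[K]}) :
  malgC a * x = x * malgC a.
Proof.
rewrite mul_malgC; apply/malgP => w.
rewrite monalg.mcoeffZ (@mcoeffMrw _ _ (monalg.msupp x) [fset (mone : K)]%fset) ?monalg.msuppC_le //.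
rewrite big_seq_fset1.
transitivity (\sum_(k1 <- monalg.msupp x) (monalg.mcoeff k1 x * a) *+ (k1 == w)); last first.
  by apply: eq_bigr => k1 _; rewrite mulm1 monalg.mcoeffC eqxx mulr1n.
have [wx|wx] := boolP (w \in monalg.msupp x).
  rewrite (big_fsetD1 w) //= eqxx big_seq big1 ?addr0 1?mulrC // => v.
  by rewrite in_fsetD1 => /andP[/negPf->].
rewrite big_seq big1 => [|v vx]; first by rewrite monalg.mcoeff_outdom // mulr0.
by case: eqP wx vx => // -> /negPf->.
Qed.

(* T(V), as the free algebra on the basis [vbasis fullv] of V.                *)
Section TensorAlgebra.
Variables (k : fieldType) (V : vectType k).
Notation n := (\dim {:V}).
Notation e := (vbasis {:V}).

Definition tensor : Type := {malg k[{fmonom 'I_n}]}.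
HB.instance Definition _ := GRing.Lalgebra.on tensor.
Implicit Types x y : tensor.

Definition tensor_scal (a : k) : tensor := malgC a.

Fact tensor_scalC a x : tensor_scal a * x = x * tensor_scal a.
Proof. exact: malgC_central. Qed.

Lemma tensor_scalZ a x : tensor_scal a * x = a *: x.
Proof. exact: mul_malgC. Qed.

Fact tensor_scal_zmod : zmod_morphism tensor_scal.
Proof. by move=> a b; apply: (raddfB (malgC : k -> {malg k[{fmonom 'I_n}]})). Qed.

Fact tensor_scal_monoid : monoid_morphism tensor_scal.
Proof.
by split=> [|a b]; [apply: (rmorph1 (malgC : k -> {malg k[{fmonom 'I_n}]}))
                   |apply: (rmorphM (malgC : k -> {malg k[{fmonom 'I_n}]}))].
Qed.

HB.instance Definition _ :=
  isPzAlg.Build k tensor tensor_scal_zmod tensor_scal_monoid tensor_scalC.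

Definition tensor_vec (v : V) : tensor := \sum_(i < n) coord e i v *: << fmu i >>.

Lemma tensor_vec_linear : linear tensor_vec.
Proof.
move=> a u v; rewrite /tensor_vec scaler_sumr -big_split /=.
by apply: eq_bigr => i _; rewrite linearP scalerDl scalerA.
Qed.
HB.instance Definition _ := GRing.isLinear.Build k V tensor *:%R tensor_vec
  tensor_vec_linear.

Lemma tensor_vec_basis (i : 'I_n) : tensor_vec e`_i = << fmu i >>.
Proof.
have fe : free e := basis_free (vbasisP _).
rewrite /tensor_vec (bigD1 i) //= big1 => [|j /negPf ji].
  by rewrite coord_free // eqxx scale1r addr0.
by rewrite coord_free // eq_sym ji scale0r.
Qed.

Section Functoriality.
Variable L : 'End(V).

Definition tensor_word (w : {fmonom 'I_n}) : tensor :=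
  \prod_(i <- (w : seq 'I_n)) tensor_vec (L e`_i).

Definition tensor_map : tensor -> tensor := monalg.mmap tensor_scal tensor_word.

Fact tensor_word_mmorph : mmorphism tensor_word.
Proof.
split=> [v w|]; rewrite /tensor_word.
  by rewrite fmM big_cat.
by rewrite fm1 big_nil.
Qed.
HB.instance Definition _ :=
  monalg.isMultiplicative.Build _ _ tensor_word tensor_word_mmorph.
HB.instance Definition _ :=
  GRing.isZmodMorphism.Build k tensor tensor_scal tensor_scal_zmod.
HB.instance Definition _ :=
  GRing.isMonoidMorphism.Build k tensor tensor_scal tensor_scal_monoid.

Fact tensor_map_zmod : zmod_morphism tensor_map.
Proof. exact: monalg.mmap_is_additive. Qed.

Fact tensor_map_monoid : monoid_morphism tensor_map.
Proof.
have C : forall (g : {malg k[{fmonom 'I_n}]}) m m',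
    GRing.comm (tensor_scal (monalg.mcoeff m g)) (tensor_word m').
  by move=> g m m'; apply: tensor_scalC.
have [hM h1] := monalg.commr_mmap_is_multiplicative C.
by split; [apply: h1|apply: hM].
Qed.

Lemma tensor_map_scal (a : k) : tensor_map (pzscal a) = pzscal a.
Proof.
have -> : tensor_map (pzscal a) = tensor_scal a * tensor_word mone.
  exact: monalg.mmapU.
by rewrite (tensor_word_mmorph).2 mulr1.
Qed.

Lemma tensor_map_gen i : tensor_map << fmu i >> = tensor_vec (L e`_i).
Proof.
have -> : tensor_map << fmu i >> = tensor_scal 1 * tensor_word (fmu i).
  exact: monalg.mmapU.
by rewrite tensor_scal_monoid.1 mul1r /tensor_word fmU big_seq1.
Qed.

HB.instance Definition _ :=
  GRing.isZmodMorphism.Build tensor tensor tensor_map tensor_map_zmod.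
HB.instance Definition _ :=
  GRing.isMonoidMorphism.Build tensor tensor tensor_map tensor_map_monoid.

Lemma tensor_map_vec v : tensor_map (tensor_vec v) = tensor_vec (L v).
Proof.
rewrite {1}/tensor_vec raddf_sum /=.
rewrite [in RHS](coord_vbasis (memvf v)) linear_sum raddf_sum /=.
apply: eq_bigr => i _; rewrite linearZ /= linearZ /=.
rewrite -tensor_scalZ rmorphM /= [tensor_map (tensor_scal _)]tensor_map_scal.
by rewrite tensor_map_gen -tensor_scalZ.
Qed.

End Functoriality.

Lemma tensor_ext (f g : tensor -> tensor) :
  zmod_morphism f -> zmod_morphism g -> monoid_morphism f -> monoid_morphism g ->
  (forall a : k, f (pzscal a) = pzscal a) ->
  (forall a : k, g (pzscal a) = pzscal a) ->
  (forall i, f << fmu i >> = g << fmu i >>) -> f =1 g.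
Proof.
move=> fB gB fM gM fs gs fg.
pose f1 : {rmorphism tensor -> tensor} := HB.pack f
  (GRing.isZmodMorphism.Build tensor tensor f fB)
  (GRing.isMonoidMorphism.Build tensor tensor f fM).
pose g1 : {rmorphism tensor -> tensor} := HB.pack g
  (GRing.isZmodMorphism.Build tensor tensor g gB)
  (GRing.isMonoidMorphism.Build tensor tensor g gM).
have word (w : {fmonom 'I_n}) :
    << w >> = \prod_(i <- (w : seq 'I_n)) (<< fmu i >> : tensor) :> tensor.
  case: w => s; elim: s => [|i s IHs] /=.
    by rewrite big_nil -fmoneE.
  rewrite big_cons -IHs.
  have -> : FMonom (i :: s) = (mmul (fmu i) (FMonom s)).
    by apply/val_inj; rewrite /= fmM fmU.
  by rewrite [RHS]fgmulUU mulr1.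
move=> x; change (f1 x = g1 x).
have -> : x = \sum_(w <- monalg.msupp x) pzscal (monalg.mcoeff w x) *
    \prod_(i <- (w : seq 'I_n)) (<< fmu i >> : tensor).
  rewrite [LHS]monalgE; apply: eq_bigr => w _; rewrite -word.
  by rewrite [RHS]fgmulUU mul1m mulr1.
rewrite !rmorph_sum; apply: eq_bigr => w _; rewrite !rmorphM !rmorph_prod /=.
by rewrite fs gs; congr (_ * _); apply: eq_bigr => i _; apply: fg.
Qed.

Lemma tensor_map1 x : tensor_map \1%VF x = x.
Proof.
apply: (@tensor_ext (tensor_map \1%VF) id) => //.
- exact: tensor_map_zmod.
- exact: tensor_map_monoid.
- exact: tensor_map_scal.
by move=> i; rewrite tensor_map_gen lfunE tensor_vec_basis.
Qed.

Lemma tensor_map_comp (L M : 'End(V)) x :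
  tensor_map (L \o M)%VF x = tensor_map L (tensor_map M x).
Proof.
apply: (@tensor_ext _ (tensor_map L \o tensor_map M)).
- exact: tensor_map_zmod.
- by move=> y z; rewrite /= !tensor_map_zmod.
- exact: tensor_map_monoid.
- split=> [|y z]; first by rewrite /= !(tensor_map_monoid _).1.
  by rewrite /= !(tensor_map_monoid _).2.
- exact: tensor_map_scal.
- by move=> a; rewrite /= !tensor_map_scal.
by move=> i; rewrite /= !tensor_map_gen tensor_map_vec lfunE.
Qed.

(* T(V) filtered by the degree of tensors, V being in degree 1.               *)
Definition tensor_fil (i : nat) (x : tensor) : Prop :=
  forall w, w \in monalg.msupp x -> (fdeg w <= i)%N.

Fact tensor_fil_0 i : tensor_fil i 0.
Proof. by move=> w; rewrite monalg.msupp0 in_fset0. Qed.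

Fact tensor_fil_B i x y : tensor_fil i x -> tensor_fil i y -> tensor_fil i (x - y).
Proof.
move=> hx hy w /(fsubsetP (monalg.msuppB_le _ _)); rewrite in_fsetU.
by case/orP; [apply: hx|apply: hy].
Qed.

Fact tensor_fil_le i j x : (i <= j)%N -> tensor_fil i x -> tensor_fil j x.
Proof. by move=> ij hx w /hx /leq_trans; apply. Qed.

Fact tensor_fil_scal (a : k) : tensor_fil 0 (pzscal a).
Proof.
move=> w /(fsubsetP (monalg.msuppC_le _)); rewrite in_fset1 => /eqP->.
by rewrite fdeg1.
Qed.

Fact tensor_fil_M i j x y :
  tensor_fil i x -> tensor_fil j y -> tensor_fil (i + j)%N (x * y).
Proof.
move=> hx hy w /monalg.msuppM_le[u [v [/hx hu /hy hv ->]]].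
by rewrite fdegM leq_add.
Qed.

Definition tensor_filtration : filtration tensor :=
  Filtration tensor_fil_0 tensor_fil_B tensor_fil_le tensor_fil_scal
             tensor_fil_M.

Lemma tensor_fil_vec v : tensor_fil 1 (tensor_vec v).
Proof.
apply: (fil_sum (F := tensor_filtration)) => i _.
rewrite -tensor_scalZ; apply: (fil_M (i := 0%N) (j := 1%N) (f := tensor_filtration)).
  exact: tensor_fil_scal.
by move=> w; rewrite monalg.msuppU1 in_fset1 => /eqP->; rewrite fdegU.
Qed.

Lemma tensor_fil_map (L : 'End(V)) i x :
  tensor_fil i x -> tensor_fil i (tensor_map L x).
Proof.
move=> hx; rewrite /tensor_map /monalg.mmap big_seq.
apply: (fil_sum (F := tensor_filtration)) => w /hx hw.
apply: (tensor_fil_le hw).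
apply: (fil_M (i := 0%N) (f := tensor_filtration)); first exact: tensor_fil_scal.
rewrite /tensor_word /fdeg; elim: (w : seq _) => [|l s IHs] /=.
  by rewrite big_nil; have := fil_scal tensor_filtration 1; rewrite pzscal_monoid.1.
rewrite big_cons -add1n.
by apply: (fil_M (f := tensor_filtration)) => //; apply: tensor_fil_vec.
Qed.

End TensorAlgebra.

Section SmashFiltration.
Variables (gT : finGroupType) (k : comNzRingType) (A : pzAlgType k).
Variables (act : algAction gT A) (F : filtration A).
Hypothesis act_fil : forall g i x, F i x -> F i (act g x).

Definition smash_fil (i : nat) (x : smash act) : Prop := forall g, F i (x g).

Fact smash_fil_0 i : smash_fil i 0.
Proof. by move=> g; rewrite ffunE; apply: fil_0. Qed.
Fact smash_fil_B i x y : smash_fil i x -> smash_fil i y -> smash_fil i (x - y).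
Proof. by move=> hx hy g; rewrite !ffunE; apply: fil_B. Qed.
Fact smash_fil_le i j x : (i <= j)%N -> smash_fil i x -> smash_fil j x.
Proof. by move=> ij hx g; apply: fil_le (hx g). Qed.
Fact smash_fil_scal (a : k) : smash_fil 0 (pzscal a).
Proof. by move=> g; rewrite ffunE; case: eqP => _; [apply: fil_scal|apply: fil_0]. Qed.
Fact smash_fil_M i j x y :
  smash_fil i x -> smash_fil j y -> smash_fil (i + j)%N (x * y).
Proof.
move=> hx hy g; rewrite ffunE; apply: fil_sum => h _.
by apply: fil_M => //; apply: act_fil.
Qed.

Definition smash_filtration : filtration (smash act) :=
  Filtration smash_fil_0 smash_fil_B smash_fil_le smash_fil_scal smash_fil_M.

End SmashFiltration.

(* A group acting linearly on V from the left.                                *)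
Record linRep (gT : finGroupType) (k : fieldType) (V : vectType k) := LinRep {
  rep :> gT -> 'End(V);
  rep1 : rep 1%g = \1%VF;
  repM : forall g h, rep (g * h)%g = (rep g \o rep h)%VF
}.

Section SymplecticReflectionAlgebra.
Variables (gT : finGroupType) (k : fieldType) (V : vectType k).
Variables (rho : linRep gT V) (omega : V -> V -> k).

Definition im_1sub (s : gT) : {vspace V} := limg (\1 - rho s)%VF.
Definition ker_1sub (s : gT) : {vspace V} := lker (\1 - rho s)%VF.

Definition symp_refl : pred gT := [pred s | \dim (im_1sub s) == 2%N].

(* The form equal to omega on Im(1-s) with Ker(1-s) in its radical, defined   *)
(* through the projection of V = Im(1-s) (+) Ker(1-s) onto Im(1-s); the sum   *)
(* is direct when the order of s is invertible in k, see [im_ker_1sub].       *)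
Definition omega_s (s : gT) (x y : V) : k :=
  let pr := daddv_pi (im_1sub s) (ker_1sub s) in omega (pr x) (pr y).

Lemma im_ker_1sub s : #[s]%g%:R != 0 :> k -> (im_1sub s :&: ker_1sub s = 0)%VS.
Proof.
move=> os; apply/eqP; rewrite -subv0; apply/subvP=> w.
rewrite memv_cap memv0 => /andP[/memv_imgP[u _ ->]].
rewrite memv_ker !(add_lfunE, opp_lfunE, id_lfunE) subr_eq0 => /eqP fix_v.
set v := u - rho s u in fix_v *.
have pow j : rho (s ^+ j)%g u = u - v *+ j.
  elim: j => [|j IHj]; first by rewrite expg0 rep1 id_lfunE mulr0n subr0.
  rewrite expgS repM comp_lfunE IHj linearB linearMn /= -fix_v /v mulrS.
  by rewrite opprD addrA subKr.
have := pow #[s]%g; rewrite expg_order rep1 id_lfunE => /eqP.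
rewrite eq_sym -subr_eq0 addrAC subrr sub0r oppr_eq0 -scaler_nat scaler_eq0.
by rewrite (negPf os).
Qed.

Lemma omega_s_im s x y : (im_1sub s :&: ker_1sub s = 0)%VS ->
  x \in im_1sub s -> y \in im_1sub s -> omega_s s x y = omega x y.
Proof. by move=> d xi yi; rewrite /omega_s !daddv_pi_id. Qed.

Lemma omega_s_ker s x y : (forall v, omega 0 v = 0) ->
  (im_1sub s :&: ker_1sub s = 0)%VS -> x \in ker_1sub s -> omega_s s x y = 0.
Proof.
move=> om0 d xk; rewrite /omega_s.
have := daddv_pi_add d (subvP (addvSr (im_1sub s) _) _ xk).
rewrite [daddv_pi (ker_1sub s) _ x]daddv_pi_id //; last by rewrite capvC.
by rewrite -[RHS]add0r => /addIr ->.
Qed.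

Fact tensor_rep1 x : tensor_map (rho 1%g) x = x.
Proof. by rewrite rep1 tensor_map1. Qed.

Fact tensor_repM g h x :
  tensor_map (rho (g * h)%g) x = tensor_map (rho g) (tensor_map (rho h) x).
Proof. by rewrite repM tensor_map_comp. Qed.

Definition tensor_action : algAction gT (tensor V) :=
  AlgAction (fun g => tensor_map_zmod (rho g)) (fun g => tensor_map_monoid (rho g))
            (fun g => tensor_map_scal (rho g)) tensor_rep1 tensor_repM.

Local Notation TG := (smash tensor_action).

Definition smash_vec (x : V) : TG := smash_elt tensor_action (tensor_vec x) 1%g.
Definition smash_grp (g : gT) : TG := smash_elt tensor_action 1 g.

Variables (t : k) (c : gT -> k).

Definition sra_rel (u : TG) : Prop :=
  exists x y : V, u = smash_vec x * smash_vec y - smash_vec y * smash_vec x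
    - (pzscal (t * omega x y)
       + \sum_(s | symp_refl s) pzscal (c s * omega_s s x y) * smash_grp s).

Definition sra_ideal : twoSidedIdeal TG := TwoSidedIdeal.clone _ (ideal_gen sra_rel) _.

Definition sra : Type := quotAlg sra_ideal.
HB.instance Definition _ := PzAlg.on sra.

Definition sra_filtration : filtration sra :=
  quot_filtration sra_ideal
    (@smash_filtration gT k (tensor V) tensor_action (tensor_filtration V)
       (fun g => @tensor_fil_map k V (rho g))).

End SymplecticReflectionAlgebra.

(* S(V), as the polynomial algebra on the basis [vbasis fullv] of V.          *)
Section SymmetricAlgebra.
Variables (k : fieldType) (V : vectType k).
Notation n := (\dim {:V}).

Definition sym_vec (v : V) : mpoly n k :=
  \sum_(i < n) coord (vbasis {:V}) i v *: 'X_i.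

Definition sym_map (L : 'End(V)) (f : mpoly n k) : mpoly n k :=
  f \mPo [tuple sym_vec (L (vbasis {:V})`_i) | i < n].

(* The subset ((SV)^p)^Gamma of SV.                                           *)
Definition frobenius_invariants (gT : finGroupType) (rho : linRep gT V) (p : nat)
    (f : mpoly n k) : Prop :=
  (exists h, f = h ^+ p) /\ (forall g, sym_map (rho g) f = f).

End SymmetricAlgebra.

(* phi is an isomorphism of graded algebras from gr F onto the graded         *)
(* subalgebra B of the polynomial algebra.                                    *)
Definition graded_alg_iso (k : fieldType) (A : pzAlgType k) (F : filtration A)
    (n : nat) (B : mpoly n k -> Prop) (phi : gr F -> mpoly n k) : Prop :=
  [/\ zmod_morphism phi, monoid_morphism phi &
      forall a : k, phi (pzscal a) = a%:A] /\
  [/\ injective phi,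
      forall f, B f <-> exists u, phi u = f &
      forall d u, gr_degree d u <-> phi u \is d.-homog].

(* Main.v *)
(* Write S = SV. The Poincare-Birkhoff-Witt representation of H_{t,c} on       *)
(* k Gamma (x) S yields symbols in S # Gamma, compatible with products and    *)
(* Poisson brackets. A central element has a symbol in S^Gamma whose Poisson  *)
(* bracket with V vanishes, that is, a p-th power; this is one inclusion.     *)
(*   Conversely, f in S^Gamma homogeneous of degree d is lifted to a central  *)
(* element with symbol f^p. For a symmetrized lift g of f, [g^p, -] =         *)
(* ad(g)^p has degree -2p relative to the degree p d of f^p. Suppose that z   *)
(* lifts f^p and commutes with Gamma, and consider the symbols of the [z, v]. *)
(* Their components outside 1 in Gamma can be removed since rk(1 - g) > 1 for *)
(* g <> 1; the component at 1 is a closed 1-form on V^*, and it can be        *)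
(* removed if it is exact, that is, if its image under the Cartier operator   *)
(* vanishes. This image depends only on f, and is a derivation from S^Gamma   *)
(* to S of negative degree. Such a derivation vanishes: as Gamma contains no  *)
(* pseudo-reflections, it extends to S without losing its negative degree,    *)
(* hence kills V. So z can be improved until it is central.                   *)
Require Import Defs.
From HB Require Import structures.
From mathcomp Require Import all_boot all_order all_fingroup all_algebra finmap.
From mathcomp Require Import generic_quotient boolp.
From mathcomp Require Import monalg.
From mathcomp Require Import mpoly.
From mathcomp Require Import ring zify.

Set Implicit Arguments.
Unset Strict Implicit.
Unset Printing Implicit Defensive.

Import GRing.Theory.

Local Open Scope ring_scope.

(** * Homogeneous components *)

(** Write S for SV and H for the symplectic reflection algebra. The Poincare-Birkhoff-Witt operators
    satisfy the defining relations ([pbw_comm_all]), so k Gamma (x) S is an H-module. The part of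
    degree d of a (1 (x) 1) is the symbol of a in degree d ([sra_symbol]). Symbols multiply as in S
    # Gamma ([sigma_mul]), and the symbol in degree d of an element of F_d vanishes exactly on
    F_(d-1) ([symbol_eq0], [sigma_lt]). By [graded_iso_exists] it remains to see that the symbols of
    central elements are the homogeneous invariant p-th powers.

    Let z be central. The leading term of [z, v] = 0 forces the symbol of z to be supported at 1 in
    Gamma ([supp1_E_lie]). The next term is the Poisson bracket of the symbol with v
    ([sigma_lie_pred]). As omega is nondegenerate, all partial derivatives of the symbol vanish, so
    it is a p-th power: this is [central_symbol].

    Conversely, let f be invariant and homogeneous of degree d. If a is a Gamma-commuting lift of f,
    then a^p has symbol f^p, and [a^p, -] = ad(a)^p lowers degrees by 2p relative to p d
    ([liftable_p]). Such a lift is improved repeatedly. The leading symbols at 1 of the [z, v] form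
    a closed 1-form. If it is exact, z can be corrected so that the degrees of all [z, v] drop by 2
    ([step]); by [closed_form_exact] the obstruction is the image of the form under the Cartier
    operator. This image depends only on f ([lift_uniq]). It is a derivation in f, because the
    Cartier operator is inverse-Frobenius linear ([obstrM]), and it lowers degrees ([msize_obstr]).

    A derivation of S^Gamma into S that lowers degrees in this way is zero
    ([invariant_derivation_eq0]). A vector u with trivial stabilizer yields an extension to the
    fraction field of S whose denominator divides the square of the product of the u - g u, g <> 1.
    Since no 1 - g with g <> 1 has rank at most 1, a second vector gives a coprime denominator. The
    extension thus maps S to S, and it kills V for degree reasons. Hence every lift can be improved
    ([liftableS]), and finitely many improvements make it central ([central_lift]). *)

Section HomogeneousComponents.
Variables (k : fieldType) (n : nat).
Notation S := (mpoly n k).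
Implicit Types f q : S.

Lemma pihomog_ext f q : (forall d, pihomog mdeg d f = pihomog mdeg d q) -> f = q.
Proof.
move=> h; pose D := maxn (msize f) (msize q).
rewrite (pihomog_partitionE (leq_maxl _ _ : (msize f <= D)%N)).
rewrite [RHS](pihomog_partitionE (leq_maxr _ _ : (msize q <= D)%N)).
by apply: eq_bigr => d _; apply: h.
Qed.

Lemma pihomog_msize d f : (msize f <= d)%N -> pihomog mdeg d f = 0.
Proof.
move=> md; rewrite pihomogE big_seq_cond big1 // => m /andP[/msize_mdeg_lt lm /eqP dm].
by move: (leq_trans lm md); rewrite dm ltnn.
Qed.

Lemma pihomog_homogM i d f q : f \is i.-homog ->
  pihomog mdeg d (f * q) = if (i <= d)%N then f * pihomog mdeg (d - i) q else 0.
Proof.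
move=> hf; rewrite {1}(pihomog_partitionE (leqnn (msize q))) mulr_sumr linear_sum /=.
have h (j : 'I_(msize q)) : pihomog mdeg d (f * pihomog mdeg j q) =
    if (i + j == d)%N then f * pihomog mdeg j q else 0.
  have hj := dhomogM hf (pihomogP _ j q).
  case: eqVneq => [<-|ne]; first by rewrite pihomog_dE.
  exact: pihomog_ne0 ne hj.
rewrite (eq_bigr _ (fun j _ => h j)) -big_mkcond /=; case: leqP => [id|di].
  have [dm|md] := ltnP (d - i) (msize q).
    rewrite (big_pred1 (Ordinal dm)) // => j /=.
    by rewrite -[d in LHS](subnKC id) eqn_add2l; apply/eqP/eqP => [e|->] //; apply: val_inj.
  rewrite big_pred0 => [|j]; last first.
    by apply/negbTE; apply: contraL (leq_trans (ltn_ord j) md) => /eqP <-; rewrite addKn ltnn.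
  by rewrite pihomog_msize ?mulr0.
by apply: big_pred0 => j; apply/negbTE; rewrite neq_ltn (leq_trans di (leq_addr _ _)) orbT.
Qed.

Lemma pihomogM d f q : pihomog mdeg d (f * q) =
  \sum_(j < d.+1) pihomog mdeg j f * pihomog mdeg (d - j) q.
Proof.
pose D := maxn d.+1 (msize f).
rewrite {1}(pihomog_partitionE (leq_maxr _ _ : (msize f <= D)%N)) mulr_suml linear_sum /=.
rewrite (big_ord_widen D (fun j => pihomog mdeg j f * pihomog mdeg (d - j) q)) ?leq_maxl //.
rewrite [RHS]big_mkcond /=; apply: eq_bigr => j _; apply: pihomog_homogM; exact: pihomogP.
Qed.

Lemma homog_pihomog d f : (forall i, i != d -> pihomog mdeg i f = 0) -> f \is d.-homog.
Proof.
move=> h; suff -> : f = pihomog mdeg d f by apply: pihomogP.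
apply: pihomog_ext => i; have [->|id] := eqVneq i d; first by rewrite pihomog_id.
by rewrite h // (pihomog_ne0 _ (pihomogP _ d f)) // eq_sym.
Qed.

End HomogeneousComponents.

(** * Linear changes of variables in S(V) *)

Section SymmetricAlgebra.
Variables (k : fieldType) (V : vectType k).
Notation n := (\dim {:V}).
Notation e := (vbasis {:V}).
Notation S := (mpoly n k).
Implicit Types (u v : V) (f q : S) (L : 'End(V)).

Lemma coord_vbasis_eq (i j : 'I_n) : coord e i e`_j = (i == j)%:R.
Proof. by rewrite coord_free ?(basis_free (vbasisP _)) // eq_sym. Qed.

Lemma vbasis_sum v : v = \sum_(i < n) coord e i v *: e`_i.
Proof. exact: coord_vbasis (memvf v). Qed.

Fact sym_vec_linear : linear (@sym_vec k V).
Proof.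
move=> a u v; rewrite /sym_vec scaler_sumr -big_split /=.
by apply: eq_bigr => i _; rewrite linearP scalerDl scalerA.
Qed.
HB.instance Definition _ := GRing.isLinear.Build k V S *:%R (@sym_vec k V)
  sym_vec_linear.

Lemma sym_vecE v i : (sym_vec v)@_U_(i) = coord e i v.
Proof.
rewrite /sym_vec raddf_sum /= (bigD1 i) //= mcoeffZ mcoeffXU eqxx mulr1.
rewrite big1 ?addr0 // => j ji.
by rewrite mcoeffZ mcoeffXU (negPf ji) mulr0.
Qed.

Lemma sym_vec_basis (i : 'I_n) : sym_vec e`_i = 'X_i.
Proof.
rewrite /sym_vec (bigD1 i) //= coord_vbasis_eq eqxx scale1r big1 ?addr0 // => j ji.
by rewrite coord_vbasis_eq (negPf ji) scale0r.
Qed.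

Lemma sym_vec_eq0 v : (sym_vec v == 0) = (v == 0).
Proof.
apply/eqP/eqP => [h|->]; last by rewrite linear0.
rewrite (vbasis_sum v) big1 // => i _.
by rewrite -sym_vecE h mcoeff0 scale0r.
Qed.

Lemma sym_vec_homog v : sym_vec v \is 1.-homog.
Proof. by apply: rpred_sum => i _; rewrite rpredZ // dhomogX /= mdeg1. Qed.

(** The index set on the right does not depend on f, so sums attached to different polynomials
    become comparable; linearity of [mext] is proved in this way. *)
Lemma msupp_sumE (U : zmodType) (F : 'X_{1..n} -> k -> U) f d :
  (forall m, F m 0 = 0) -> (msize f <= d)%N ->
  \sum_(m <- msupp f) F m f@_m = \sum_(m : 'X_{1..n < d}) F m f@_m.
Proof.
move=> F0 le_fd; rewrite (bigID (fun m : 'X_{1..n < d} => (m : 'X_{1..n}) \in msupp f)) /=.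
rewrite [X in _ + X]big1 ?addr0 => [|m /memN_msupp_eq0 ->]; last exact: F0.
rewrite -(big_filter (index_enum _)) -[RHS](big_map val predT (fun m => F m f@_m)).
apply: perm_big; apply: uniq_perm; first exact: msupp_uniq.
  by rewrite (map_inj_uniq val_inj) filter_uniq // index_enum_uniq.
move=> m; apply/idP/mapP => [hm|[m' + ->]]; last by rewrite mem_filter => /andP[].
have lt := leq_trans (msize_mdeg_lt hm) le_fd.
by exists (BMultinom lt) => //; rewrite mem_filter mem_index_enum andbT.
Qed.

Lemma mpoly_closed_ind (P : S -> Prop) :
  (forall a, P a%:MP) -> (forall i, P 'X_i) ->
  (forall f q, P f -> P q -> P (f + q)) ->
  (forall f q, P f -> P q -> P (f * q)) -> forall f, P f.
Proof.
move=> hC hX hD hM f; have P0 : P 0 by rewrite -mpolyC0.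
have P1 : P 1 by rewrite -mpolyC1.
rewrite (mpolyE f); apply: (big_ind P P0 hD) => m _.
rewrite -mul_mpolyC mpolyXE_id; apply: (hM) => //.
apply: (big_ind P P1 hM) => i _.
by elim: (m i) => [|j IHj]; rewrite ?expr0 // exprS; apply: hM.
Qed.

Lemma sym_map_is_zmod (L : 'End(V)) : zmod_morphism (sym_map L).
Proof. by move=> f q; rewrite /sym_map raddfB. Qed.
Lemma sym_map_is_monoid (L : 'End(V)) : monoid_morphism (sym_map L).
Proof. by split=> [|f q]; rewrite /sym_map ?rmorph1 ?rmorphM. Qed.
HB.instance Definition _ (L : 'End(V)) :=
  GRing.isZmodMorphism.Build S S (sym_map L) (sym_map_is_zmod L).
HB.instance Definition _ (L : 'End(V)) :=
  GRing.isMonoidMorphism.Build S S (sym_map L) (sym_map_is_monoid L).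

Lemma sym_mapC L a : sym_map L a%:MP = a%:MP.
Proof. exact: comp_mpolyC. Qed.

Lemma sym_mapZ L a f : sym_map L (a *: f) = a *: sym_map L f.
Proof. by rewrite -!mul_mpolyC rmorphM /= sym_mapC. Qed.

Lemma sym_mapX L (i : 'I_n) : sym_map L 'X_i = sym_vec (L e`_i).
Proof. by rewrite /sym_map comp_mpolyXU -tnth_nth tnth_mktuple. Qed.

Lemma sym_map_vec L v : sym_map L (sym_vec v) = sym_vec (L v).
Proof.
rewrite {1}/sym_vec raddf_sum /= [in RHS](vbasis_sum v) !linear_sum.
by apply: eq_bigr => i _; rewrite sym_mapZ sym_mapX !linearZ.
Qed.

Lemma sym_map_comp (L M : 'End(V)) f : sym_map (L \o M)%VF f = sym_map L (sym_map M f).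
Proof.
elim/mpoly_closed_ind: f => [a|i|f q ef eq|f q ef eq].
- by rewrite !sym_mapC.
- by rewrite !sym_mapX sym_map_vec lfunE.
- by rewrite !raddfD /= ef eq.
by rewrite !rmorphM /= ef eq.
Qed.

Lemma sym_map1 f : sym_map \1%VF f = f.
Proof.
elim/mpoly_closed_ind: f => [a|i|f q ef eq|f q ef eq].
- by rewrite !sym_mapC.
- by rewrite sym_mapX lfunE sym_vec_basis.
- by rewrite !raddfD /= ef eq.
by rewrite !rmorphM /= ef eq.
Qed.

Lemma dhomog_bigprod (I : Type) (r : seq I) (d : I -> nat) (q : I -> S) :
  (forall i, q i \is (d i).-homog) ->
  \prod_(i <- r) q i \is (\sum_(i <- r) d i)%N.-homog.
Proof.
move=> h; elim: r => [|i r IHr]; first by rewrite !big_nil dhomog1.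
by rewrite !big_cons dhomogM.
Qed.

Lemma sym_map_homog L d f : f \is d.-homog -> sym_map L f \is d.-homog.
Proof.
move=> /dhomogP hf; rewrite (mpolyE f) raddf_sum big_seq.
apply: rpred_sum => m /hf <- /=.
rewrite sym_mapZ rpredZ // mpolyXE_id rmorph_prod /= mdegE.
apply: dhomog_bigprod => i; rewrite rmorphXn /= sym_mapX.
by have := dhomogMn (m i) (sym_vec_homog (L e`_i)); rewrite mul1n.
Qed.

Lemma pihomog_sym_map L d f :
  pihomog mdeg d (sym_map L f) = sym_map L (pihomog mdeg d f).
Proof.
rewrite {1}(mpolyE f) [sym_map L _]raddf_sum [LHS]raddf_sum /=.
rewrite pihomogE [sym_map L _]raddf_sum [RHS]big_mkcond /=.
apply: eq_bigr => m _; rewrite sym_mapZ linearZ /=.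
have hm : sym_map L 'X_[m] \is (mdeg m).-homog.
  by apply: sym_map_homog; rewrite dhomogX.
case: eqP => [<-|/eqP ne]; first by rewrite pihomog_dE // sym_mapZ.
by rewrite (pihomog_ne0 ne hm) scaler0.
Qed.

(* The retraction of S onto a complement of (a), along the linear form a:     *)
(* its kernel is the ideal generated by a, which is therefore prime.          *)
Section LinearForm.
Variables (a : V) (i0 : 'I_n).
Hypothesis a_i0 : coord e i0 a != 0.

Definition lf_retract (f : S) : S :=
  f \mPo [tuple 'X_i - (coord e i e`_i0 / coord e i0 a) *: sym_vec a | i < n].
Fact lf_retract_zmod : zmod_morphism lf_retract.
Proof. by move=> f q; rewrite /lf_retract raddfB. Qed.
Fact lf_retract_monoid : monoid_morphism lf_retract.
Proof. by split=> [|f q]; rewrite /lf_retract ?rmorph1 ?rmorphM. Qed.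
HB.instance Definition _ :=
  GRing.isZmodMorphism.Build S S lf_retract lf_retract_zmod.
HB.instance Definition _ :=
  GRing.isMonoidMorphism.Build S S lf_retract lf_retract_monoid.

Lemma lf_retractX i :
  lf_retract 'X_i = 'X_i - (coord e i e`_i0 / coord e i0 a) *: sym_vec a.
Proof. by rewrite /lf_retract comp_mpolyXU -tnth_nth tnth_mktuple. Qed.

Lemma lf_retract_vec v :
  lf_retract (sym_vec v) = sym_vec (v - (coord e i0 v / coord e i0 a) *: a).
Proof.
rewrite {1}/sym_vec raddf_sum /= raddfB /= linearZ /= {2}/sym_vec.
under eq_bigr do rewrite -mul_mpolyC rmorphM /= lf_retractX
  [lf_retract _]comp_mpolyC mul_mpolyC scalerBr scalerA.
rewrite sumrB; congr (_ - _); rewrite -scaler_suml; congr (_ *: _).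
rewrite (bigD1 i0) //= coord_vbasis_eq eqxx mul1r big1 ?addr0 // => i ni.
by rewrite coord_vbasis_eq (negPf ni) mul0r mulr0.
Qed.

Lemma lf_retract_mod f : exists q, f = lf_retract f + sym_vec a * q.
Proof.
elim/mpoly_closed_ind: f => [b|i|f f' [q ef] [q' ef']|f f' [q ef] [q' ef']].
- by exists 0; rewrite mulr0 addr0 [lf_retract _]comp_mpolyC.
- exists (coord e i e`_i0 / coord e i0 a)%:MP.
  by rewrite lf_retractX [sym_vec a * _]mulrC mul_mpolyC addrNK.
- exists (q + q'); rewrite raddfD /= mulrDr addrACA -ef -ef' //.
exists (q * lf_retract f' + f * q').
rewrite rmorphM /= mulrDr [X in _ + (X + _)]mulrA addrA -mulrDl -ef.
by rewrite mulrCA -mulrDr -ef'.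
Qed.

Lemma lf_retract_eq0 f : lf_retract f = 0 <-> exists q, f = sym_vec a * q.
Proof.
split=> [h|[q ->]].
  by have [q] := lf_retract_mod f; rewrite h add0r => ->; exists q.
rewrite rmorphM /= lf_retract_vec divff // scale1r subrr.
by rewrite [X in X * _](linear0 (@sym_vec k V)) mul0r.
Qed.

Lemma lf_retract_vec_eq0 v : lf_retract (sym_vec v) = 0 -> v \in <[a]>%VS.
Proof.
rewrite lf_retract_vec => /eqP; rewrite sym_vec_eq0 subr_eq0 => /eqP->.
by rewrite memvZ ?memv_line.
Qed.

End LinearForm.

Lemma vec_coord_neq0 v : v != 0 -> exists i, coord e i v != 0.
Proof.
move=> v0; apply/existsP; apply: contraNT v0 => /existsPn h.
rewrite (vbasis_sum v) big1 // => i _.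
by move: (h i); rewrite negbK => /eqP->; rewrite scale0r.
Qed.

Lemma linear_form_dvdM (a : V) (b q : S) : a != 0 ->
  (exists q', b * q = sym_vec a * q') ->
  (exists b', b = sym_vec a * b') \/ (exists q', q = sym_vec a * q').
Proof.
move=> /vec_coord_neq0[i ai] /(lf_retract_eq0 ai) /eqP.
rewrite rmorphM /= mulf_eq0 => /orP[] /eqP /(lf_retract_eq0 ai).
  by left.
by right.
Qed.

Lemma linear_form_dvd (a b : V) q : a != 0 ->
  sym_vec b = sym_vec a * q -> b \in <[a]>%VS.
Proof.
move=> /vec_coord_neq0[i ai] h; apply: (lf_retract_vec_eq0 (i0 := i)).
by apply/lf_retract_eq0 => //; exists q.
Qed.

(** The prime element a does not divide b, since a linear form divisible by a is proportional to
    a. *)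
Lemma linear_form_cross (a b : V) (f q : S) : a != 0 -> b \notin <[a]>%VS ->
  sym_vec a * f = sym_vec b * q -> exists q', q = sym_vec a * q'.
Proof.
move=> a0 ab h.
have /(linear_form_dvdM a0)[] : exists q', sym_vec b * q = sym_vec a * q'.
- by exists f.
- by case=> b' /(linear_form_dvd a0); rewrite (negPf ab).
by [].
Qed.

End SymmetricAlgebra.

(** * The action of the group on S(V) *)

Section RepresentationAction.
Variables (k : fieldType) (V : vectType k) (gT : finGroupType).
Variable rho : linRep gT V.
Notation sact g := (sym_map (rho g)).
Implicit Types (f : mpoly (\dim {:V}) k) (v : V) (g h : gT).

Lemma sact1 f : sact 1%g f = f.
Proof. by rewrite rep1 sym_map1. Qed.
Lemma sactM g h f : sact (g * h)%g f = sact g (sact h f).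
Proof. by rewrite repM sym_map_comp. Qed.
Lemma rep_mul g h v : rho (g * h)%g v = rho g (rho h v).
Proof. by rewrite repM lfunE. Qed.
Lemma rep_one v : rho 1%g v = v.
Proof. by rewrite rep1 lfunE. Qed.

End RepresentationAction.

(** * Frobenius and the Cartier operator *)

Section CartierOperator.
Variables (k : closedFieldType) (p : nat).
Hypothesis char_k : p \in [pchar k].

Let p_gt0 : (0 < p)%N. Proof. exact/prime_gt0/(pcharf_prime char_k). Qed.

Fact proot_exists (a : k) : exists x : k, x ^+ p == a.
Proof.
have [x hx] := @solve_monicpoly k p (fun i => if i == 0%N then a else 0) p_gt0.
exists x; rewrite hx; apply/eqP; case: p p_gt0 => // q _.
rewrite big_ord_recl /= expr0 mulr1 big1 ?addr0 // => i _.
by rewrite mul0r.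
Qed.

Definition proot (a : k) : k := xchoose (proot_exists a).

Lemma prootK a : proot a ^+ p = a.
Proof. exact/eqP/(xchooseP (proot_exists a)). Qed.

Lemma expp_inj : injective (fun x : k => x ^+ p).
Proof. exact: (fmorph_inj (pFrobenius_aut char_k)). Qed.

Lemma exppK a : proot (a ^+ p) = a.
Proof. by apply: expp_inj; rewrite /= prootK. Qed.

Lemma proot0 : proot 0 = 0.
Proof. by rewrite -[X in proot X](_ : 0 ^+ p = 0) ?exppK // expr0n gtn_eqF. Qed.

Lemma prootD a b : proot (a + b) = proot a + proot b.
Proof.
apply: expp_inj; rewrite /= prootK -[(_ + _) ^+ p]/(pFrobenius_aut char_k _).
by rewrite rmorphD /= !pFrobenius_autE !prootK.
Qed.

Lemma prootM a b : proot (a * b) = proot a * proot b.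
Proof. by apply: expp_inj; rewrite /= exprMn !prootK. Qed.

Lemma proot_eq0 a : (proot a == 0) = (a == 0).
Proof.
apply/eqP/eqP => [h|->]; last exact: proot0.
by rewrite -(prootK a) h expr0n gtn_eqF.
Qed.

Lemma mulrn_dvdp (m : nat) (a : k) : (p %| m)%N -> a *+ m = 0.
Proof. by case/dvdnP=> j ->; rewrite mulrnA mulrn_pchar. Qed.

Section Multivariate.
Variable n : nat.
Notation S := {mpoly k[n]}.
Implicit Types (f q h : S) (m : 'X_{1..n}).

(** Cuts a coefficient function down to finite support. In each use below the bound exceeds the
    degree of every nonzero coefficient, so that nothing is lost. *)
Definition mpoly_trunc (N : nat) (E : 'X_{1..n} -> k) : S :=
  \sum_(m : 'X_{1..n < N}) E m *: 'X_[m].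

Lemma mpoly_truncE N E m :
  (mpoly_trunc N E)@_m = if (mdeg m < N)%N then E m else 0.
Proof.
case: ltnP => hm; first by rewrite /mpoly_trunc mcoeff_mpoly.
rewrite /mpoly_trunc raddf_sum big1 //= => m' _.
rewrite mcoeffZ mcoeffX; case: eqP => [em|]; last by rewrite mulr0.
by have := bmdeg m'; rewrite em ltnNge hm.
Qed.

Lemma mcoeff_ge_msize f m : (msize f <= mdeg m)%N -> f@_m = 0.
Proof. by move=> h; apply: memN_msupp_eq0; apply: msize_mdeg_ge. Qed.

Lemma dhomog_coeff d f :
  (forall m, f@_m != 0 -> mdeg m = d) -> f \is d.-homog.
Proof. by move=> h; apply/dhomogP=> m; rewrite mcoeff_msupp => /h. Qed.

Lemma dhomog_coeff_neq0 d f m : f \is d.-homog -> f@_m != 0 -> mdeg m = d.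
Proof. by move=> hf; apply: contraNeq => /(dhomog_nemf_coeff hf) ->. Qed.

(* The p-th root of the part of q spanned by the monomials 'X_i^(p-1) * m^p.  *)
(* On closed 1-forms \sum_i a_i dx_i, the map (a_i) |-> (cartier i a_i) is    *)
(* the Cartier operator.                                                      *)
Definition cartier_mon (i : 'I_n) m : 'X_{1..n} := (m *+ p + U_(i) *+ p.-1)%MM.
Definition cartier (i : 'I_n) q : S :=
  mpoly_trunc (msize q) (fun m => proot q@_(cartier_mon i m)).

Lemma mdeg_cartier_mon i m : mdeg (cartier_mon i m) = (mdeg m * p + p.-1)%N.
Proof. by rewrite mdegD !mdegMn mdeg1 mul1n. Qed.

Lemma mcoeff_cartier i q m : (cartier i q)@_m = proot q@_(cartier_mon i m).
Proof.
rewrite mpoly_truncE; case: ltnP => // h.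
rewrite mcoeff_ge_msize ?proot0 // (leq_trans h) // mdeg_cartier_mon.
by rewrite (leq_trans (leq_pmulr _ p_gt0)) ?leq_addr.
Qed.

Lemma cartierD i : {morph cartier i : f q / f + q}.
Proof.
by move=> f q; apply/mpolyP=> m; rewrite mcoeffD !mcoeff_cartier mcoeffD prootD.
Qed.

Lemma cartier0 i : cartier i 0 = 0.
Proof. by apply/mpolyP=> m; rewrite mcoeff_cartier !mcoeff0 proot0. Qed.

(** Differentiation along x_i produces the exponent p a + p - 1 only with the factor p a + p, which
    is 0 in k. *)
Lemma cartier_deriv i h : cartier i h^`M(i) = 0.
Proof.
apply/mpolyP=> m; rewrite mcoeff_cartier mcoeff0 mcoeff_mderiv.
apply/eqP; rewrite proot_eq0 mulrn_dvdp // mnmDE !mulmnE mnm1E eqxx mul1n.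
by rewrite -addnS prednK // dvdn_add ?dvdn_mull.
Qed.

Lemma mpoly_Frobenius_sum (I : Type) (r : seq I) (F : I -> S) :
  (\sum_(i <- r) F i) ^+ p = \sum_(i <- r) F i ^+ p.
Proof.
have ch : p \in [pchar S] by rewrite (pchar_lalg S).
by rewrite -[LHS]/(pFrobenius_aut ch _) rmorph_sum.
Qed.

Lemma mpoly_Frobenius_D f q : (f + q) ^+ p = f ^+ p + q ^+ p.
Proof.
have ch : p \in [pchar S] by rewrite (pchar_lalg S).
by rewrite -[LHS]/(pFrobenius_aut ch _) rmorphD.
Qed.

Lemma mpoly_Frobenius_inj : injective (fun f : S => f ^+ p).
Proof.
move=> f q /= h; apply/eqP; rewrite -subr_eq0.
have ch : p \in [pchar S] by rewrite (pchar_lalg S).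
have : pFrobenius_aut ch (f - q) = 0.
  by rewrite rmorphB /= !pFrobenius_autE h subrr.
by rewrite pFrobenius_autE => /eqP; rewrite expf_eq0 => /andP[].
Qed.

Lemma mcoeffMX_lem m q m' :
  (q * 'X_[m])@_m' = if (m <= m')%MM then q@_(m' - m) else 0.
Proof.
case: ifP => [/submK e|le].
  by rewrite -[in LHS]e addmC mcoeffMX.
apply: memN_msupp_eq0; rewrite (perm_mem (msuppMX _ _)); apply/mapP=> -[m'' _ e].
by move: le; rewrite e lem_addr.
Qed.

(** This inverse-Frobenius linearity is what later makes the obstruction [obstr] a derivation. *)
Lemma cartierMp i f q : cartier i (f ^+ p * q) = f * cartier i q.
Proof.
rewrite {1}(mpolyE f) mpoly_Frobenius_sum [in RHS](mpolyE f) !mulr_suml.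
elim/big_rec2: _ => [|m y x _ <-]; first exact: cartier0.
rewrite cartierD; congr (_ + _); apply/mpolyP=> m'; rewrite mcoeff_cartier.
rewrite exprZn mpolyXn -!scalerAl !mcoeffZ prootM exppK; congr (_ * _).
rewrite ['X_[m *+ p] * _]mulrC ['X_[m] * _]mulrC !mcoeffMX_lem.
(* Componentwise, p a <= p b + r with 0 <= r <= p - 1 holds exactly when a <= b. *)
have e : (m *+ p <= cartier_mon i m')%MM = (m <= m')%MM.
  apply/mnm_lepP/mnm_lepP=> h j; have := h j;
    rewrite /cartier_mon mnmDE !mulmnE mnm1E; last by move=> ?; nia.
  by case: eqP => _; move: p_gt0; nia.
rewrite e; case: ifP => [/mnm_lepP le|_]; last by rewrite proot0.
rewrite mcoeff_cartier; congr (proot _@__); apply/mnmP=> j.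
rewrite /cartier_mon !(mnmBE, mnmDE, mulmnE) mulnBl addnBAC //.
by rewrite leq_mul2r le orbT.
Qed.

(** A monomial of degree j in the image comes from one of degree j p + p - 1. Adding 1 to this
    degree gives p (j + 1), which is why a bound on [msize] needs no subtraction. *)
Lemma msize_cartier i d q : q \is d.-homog -> (msize (cartier i q) * p <= d.+1)%N.
Proof.
move=> hq; have [->|c0] := eqVneq (cartier i q) 0; first by rewrite msize0.
have := mlead_supp c0; rewrite mcoeff_msupp mcoeff_cartier proot_eq0.
move=> /(dhomog_coeff_neq0 hq) <-; rewrite mdeg_cartier_mon -mlead_deg //.
by rewrite mulSn -addnS prednK // addnC.
Qed.

(* A coefficient of the primitive is read off any index i at which the        *)
(* exponent is prime to p; closedness makes the choice of i irrelevant, and   *)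
(* [cartier] detects the monomials for which there is no such i.              *)
Lemma closed_form_exact d (al : 'I_n -> S) :
  (forall i, al i \is d.-homog) ->
  (forall i j, (al i)^`M(j) = (al j)^`M(i)) -> (forall i, cartier i (al i) = 0) ->
  exists2 h, h \is d.+1.-homog & forall i, h^`M(i) = al i.
Proof.
move=> hom closed c0.
pose hc m := if [pick i | ~~ (p %| m i)%N] is Some i
  then (al i)@_(m - U_(i)) / (m i)%:R else 0.
have natp0 i m : ~~ (p %| m i)%N -> (m i)%:R != 0 :> k.
  by rewrite -(dvdn_pcharf char_k).
have ndvd i m : ~~ (p %| m i)%N -> (U_(i) <= m)%MM.
  by rewrite lep1mP; apply: contraNneq => ->.
exists (mpoly_trunc d.+2 hc) => [|j].
  apply: dhomog_coeff => m; rewrite mpoly_truncE; case: ifP => _; last by rewrite eqxx.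
  rewrite /hc; case: pickP => [i mi|_]; last by rewrite eqxx.
  rewrite mulf_eq0 negb_or => /andP[/(dhomog_coeff_neq0 (hom i)) <- _].
  have /submK {1}<- := ndvd _ _ mi.
  by rewrite mdegD mdeg1 addn1.
(* Closedness, read at the monomial m - U_(i) - U_(j): the two derivatives restore the factors m j
   and m i. *)
have key m i : ~~ (p %| m i)%N -> (U_(j) <= m)%MM ->
    (al i)@_(m - U_(i)) *+ m j = (al j)@_(m - U_(j)) *+ m i.
  move=> mi mj; have [->//|ij] := eqVneq i j.
  have mi' := ndvd _ _ mi.
  have e : (m - U_(i) - U_(j) = m - U_(j) - U_(i))%MM.
    by rewrite !submDA addmC.
  have le_j : (U_(j) <= m - U_(i))%MM.
    by rewrite lep1mP mnmBE mnm1E (negPf ij) subn0 -lep1mP.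
  have le_i : (U_(i) <= m - U_(j))%MM.
    by rewrite lep1mP mnmBE mnm1E [j == i]eq_sym (negPf ij) subn0 -lep1mP.
  have := congr1 (mcoeff (m - U_(i) - U_(j))%MM) (closed i j).
  rewrite !mcoeff_mderiv submK // {2}e submK // !mnmBE !mnm1E !eqxx.
  rewrite [j == i]eq_sym (negPf ij) !subn0 !subn1.
  by move: mj mi'; rewrite !lep1mP -!lt0n => mj mi'; rewrite !prednK.
apply/mpolyP=> v; rewrite mcoeff_mderiv mpoly_truncE.
set m := (v + U_(j))%MM; have ev : v = (m - U_(j))%MM by rewrite addmK.
have mj : m j = (v j).+1 by rewrite mnmDE mnm1E eqxx addn1.
have le_mj : (U_(j) <= m)%MM by rewrite lep1mP mj.
rewrite mdegD mdeg1 addn1 ltnS; case: ltnP => [_|dv]; last first.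
  rewrite mul0rn; symmetry; apply: (dhomog_nemf_coeff (hom j)) => /=.
  by rewrite gtn_eqF.
rewrite -mj /hc; case: pickP => [i mi|all_p].
  by rewrite -mulrnAl key // -ev -[X in X / _]mulr_natr mulfK ?natp0.
(* All exponents of m are now divisible by p, so v = m - U_(j) has the form [cartier_mon j w], and
   its coefficient in [al j] is killed by the hypothesis on [cartier]. *)
pose w := [multinom m i %/ p - (i == j) | i < n]%MM.
have ew : cartier_mon j w = v.
  apply/mnmP=> i; rewrite /cartier_mon mnmDE !mulmnE mnm1E mnmE [i == j]eq_sym.
  have /negbFE/dvdnP[x ex] := all_p i.
  have ei : m i = (v i + (j == i))%N by rewrite mnmDE mnm1E.
  rewrite ex mulnK //; move: ei; rewrite ex.
  by case: (j == i) => /=; move: p_gt0; case: x {ex} => [|x] /=; nia.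
have := mcoeff_cartier j (al j) w; rewrite c0 mcoeff0 ew.
by move/esym/eqP; rewrite proot_eq0 mul0rn => /eqP->.
Qed.

Definition frob_root h : S := mpoly_trunc (msize h) (fun m => proot h@_(m *+ p)).

Lemma mcoeff_frob_root h m : (frob_root h)@_m = proot h@_(m *+ p).
Proof.
rewrite mpoly_truncE; case: ltnP => // le.
by rewrite mcoeff_ge_msize ?proot0 // (leq_trans le) // mdegMn leq_pmulr.
Qed.

(** A monomial with some exponent prime to p survives in the corresponding partial derivative. So
    only exponents divisible by p occur, and the root is taken coefficientwise. *)
Lemma frob_rootK h : (forall i, h^`M(i) = 0) -> frob_root h ^+ p = h.
Proof.
move=> dh; have dvd m i : h@_m != 0 -> (p %| m i)%N.
  have [->|mi] := eqVneq (m i) 0%N; first by rewrite dvdn0.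
  have := congr1 (mcoeff (m - U_(i))%MM) (dh i).
  rewrite mcoeff_mderiv mcoeff0 submK ?lep1mP // mnmBE mnm1E eqxx subn1.
  rewrite prednK ?lt0n // => /eqP; rewrite -mulr_natr mulf_eq0 => /orP[->//|].
  by rewrite -(dvdn_pcharf char_k).
rewrite (mpolyE (frob_root h)) mpoly_Frobenius_sum; apply/mpolyP=> m.
under eq_bigr do rewrite exprZn mpolyXn mcoeff_frob_root prootK.
rewrite raddf_sum /=; under eq_bigr do rewrite mcoeffZ mcoeffX.
have [hm|hm] := eqVneq (h@_m) 0.
  rewrite hm big1 // => m' _; case: eqP => [->|_]; last by rewrite mulr0.
  by rewrite hm mul0r.
pose r := [multinom m i %/ p | i < n]%MM.
have er : (r *+ p)%MM = m.
  by apply/mnmP=> i; rewrite mulmnE mnmE divnK ?dvd.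
rewrite (bigD1_seq r) ?msupp_uniq //=; last first.
  by rewrite mcoeff_msupp mcoeff_frob_root er proot_eq0.
rewrite er eqxx mulr1 big1 ?addr0 // => m' m'r; case: eqP => [e|_]; last by rewrite mulr0.
case/eqP: m'r; apply/mnmP=> i; rewrite mnmE -e mulmnE mulnK //.
Qed.

Lemma frob_root_homog d h : h \is d.-homog -> frob_root h \is (d %/ p).-homog.
Proof.
move=> hh; apply: dhomog_coeff => m; rewrite mcoeff_frob_root proot_eq0.
by move=> /(dhomog_coeff_neq0 hh) <-; rewrite mdegMn mulnK.
Qed.

End Multivariate.
End CartierOperator.

(** * Derivations of the ring of invariants *)

Section GenericVectors.
Variables (k : closedFieldType) (V : vectType k).

Lemma closed_field_avoid (s : seq k) : exists c, c \notin s.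
Proof.
have : \prod_(a <- s) ('X - a%:P) != 0 :> {poly k}.
  by rewrite prodf_seq_neq0; apply/allP=> a _; rewrite polyXsubC_eq0.
by move=> /closed_nonrootP[c]; rewrite root_prod_XsubC; exists c.
Qed.

(** A subspace that does not contain u meets the line x + k u in at most one point, and k is
    infinite. *)
Lemma avoid_subspaces_line (Ws : seq {vspace V}) u x :
  (forall W, W \in Ws -> u \notin W) ->
  exists c : k, forall W, W \in Ws -> x + c *: u \notin W.
Proof.
move=> hu; pose bad (W : {vspace V}) := if pselect (exists c : k, x + c *: u \in W) is left h
  then xchoose h else 0.
have [c hc] := closed_field_avoid [seq bad W | W <- Ws].
exists c => W hW; apply: contra hc => xW.
apply/mapP; exists W => //; rewrite /bad; case: pselect => [h|[]]; last by exists c.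
apply/eqP/negPn; apply: contra (hu W hW); rewrite -subr_eq0 => c0.
have /(memvZ (c - xchoose h)^-1) := memvB xW (xchooseP h).
by rewrite opprD addrACA subrr add0r -scalerBl scalerA mulVf // scale1r.
Qed.

(** A vector space over an infinite field is not a finite union of proper subspaces. *)
Lemma avoid_subspaces (Ws : seq {vspace V}) :
  (forall W, W \in Ws -> exists v, v \notin W) ->
  exists u, forall W, W \in Ws -> u \notin W.
Proof.
elim: Ws => [|W Ws IH] h; first by exists 0.
have [u hu] : exists u, forall W, W \in Ws -> u \notin W.
  by apply: IH => W' hW'; apply: h; rewrite inE hW' orbT.
have [uW|uW] := boolP (u \in W); last first.
  by exists u => W'; rewrite inE => /predU1P[->|/hu].
have [w wW] := h W (mem_head _ _).
have [c hc] := avoid_subspaces_line w hu.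
exists (w + c *: u) => W'; rewrite inE => /predU1P[->|/hc//].
by rewrite rpredDr // memvZ.
Qed.

End GenericVectors.

Section Invariants.
Variables (k : closedFieldType) (V : vectType k) (gT : finGroupType).
Variable rho : linRep gT V.
Notation n := (\dim {:V}).
Notation S := (mpoly n k).
Notation sact g := (sym_map (rho g)).
Implicit Types (f q y : S) (u v x : V) (H K : {poly S}).

Definition sinv f := forall g, sact g f = f.

Lemma sinv0 : sinv 0. Proof. by move=> g; rewrite raddf0. Qed.
Lemma sinv1 : sinv 1. Proof. by move=> g; rewrite rmorph1. Qed.
Lemma sinvC a : sinv a%:MP. Proof. by move=> g; rewrite sym_mapC. Qed.
Lemma sinvD f q : sinv f -> sinv q -> sinv (f + q).
Proof. by move=> hf hq g; rewrite raddfD /= hf hq. Qed.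
Lemma sinvM f q : sinv f -> sinv q -> sinv (f * q).
Proof. by move=> hf hq g; rewrite rmorphM /= hf hq. Qed.
Lemma sinv_sum (I : Type) (r : seq I) (P : pred I) (F : I -> S) :
  (forall i, P i -> sinv (F i)) -> sinv (\sum_(i <- r | P i) F i).
Proof. by move=> h; elim/big_ind: _ => [||i /h//]; [exact: sinv0|exact: sinvD]. Qed.
Lemma sinv_pihomog d f : sinv f -> sinv (pihomog mdeg d f).
Proof. by move=> hf g; rewrite -pihomog_sym_map hf. Qed.

Definition pinv H := forall i, sinv H`_i.
Lemma pinvP H : (forall g, map_poly (sact g) H = H) -> pinv H.
Proof. by move=> h i g; rewrite -[in RHS](h g) coef_map. Qed.
Lemma pinvD H K : pinv H -> pinv K -> pinv (H + K).
Proof. by move=> hH hK i; rewrite coefD; apply: sinvD. Qed.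
Lemma pinvM H K : pinv H -> pinv K -> pinv (H * K).
Proof. by move=> hH hK i; rewrite coefM; apply: sinv_sum => j _; apply: sinvM. Qed.
Lemma pinvC f : sinv f -> pinv f%:P.
Proof. by move=> hf i; rewrite coefC; case: eqP => // _; apply: sinv0. Qed.
Lemma pinvXn i : pinv 'X^i.
Proof. by move=> j; rewrite coefXn; case: eqP => _; [exact: sinv1|exact: sinv0]. Qed.
Lemma pinvN H : pinv H -> pinv (- H).
Proof. by move=> h i g; rewrite coefN raddfN /= h. Qed.

(* Conversion must not unfold these polynomials, hence the locks.             *)
Fact invariants_key : unit. Proof. by []. Qed.

Definition orbit_poly : V -> {poly S} := locked_with invariants_key
  (fun u => \prod_g ('X - (sym_vec (rho g u))%:P)).

(* Lagrange interpolation: the value at u is y times the different of u.      *)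
Definition interp : V -> S -> {poly S} := locked_with invariants_key
  (fun u y => \sum_g (sact g y)%:P * \prod_(h | h != g) ('X - (sym_vec (rho h u))%:P)).

(** The derivative of [orbit_poly u] at its root u, see [horner_deriv_orbit_poly]; the factorization
    into linear forms is what the divisibility arguments use. *)
Definition different : V -> S := locked_with invariants_key
  (fun u => \prod_(g : gT | g != 1%g) sym_vec (u - rho g u)).

Lemma orbit_polyE u : orbit_poly u = \prod_g ('X - (sym_vec (rho g u))%:P).
Proof. by rewrite /orbit_poly unlock. Qed.

Lemma interpE u y : interp u y =
  \sum_g (sact g y)%:P * \prod_(h | h != g) ('X - (sym_vec (rho h u))%:P).
Proof. by rewrite /interp unlock. Qed.

Lemma differentE u : different u = \prod_(g : gT | g != 1%g) sym_vec (u - rho g u).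
Proof. by rewrite /different unlock. Qed.

Lemma orbit_poly_inv u : pinv (orbit_poly u).
Proof.
apply: pinvP => g; rewrite orbit_polyE rmorph_prod /= [RHS](reindex_inj (mulgI g)) /=.
apply: eq_bigr => h _; rewrite rmorphB /= map_polyX map_polyC /=.
by rewrite sym_map_vec -rep_mul.
Qed.

Lemma interp_inv u y : pinv (interp u y).
Proof.
apply: pinvP => g; rewrite interpE raddf_sum /= [RHS](reindex_inj (mulgI g)) /=.
apply: eq_bigr => h _; rewrite rmorphM /= map_polyC /= -sactM; congr (_ * _).
rewrite rmorph_prod /= [RHS](reindex_inj (mulgI g)) /=.
apply: eq_big => [h'|h' _]; first by rewrite (inj_eq (mulgI g)).
by rewrite rmorphB /= map_polyX map_polyC /= sym_map_vec -rep_mul.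
Qed.

Lemma interpD u y y' : interp u (y + y') = interp u y + interp u y'.
Proof.
rewrite !interpE -big_split; apply: eq_bigr => g _ /=.
by rewrite raddfD polyCD mulrDl.
Qed.

Lemma interp_sinv u f : sinv f -> interp u f = f%:P * interp u 1.
Proof.
move=> hf; rewrite !interpE mulr_sumr; apply: eq_bigr => g _.
by rewrite hf rmorph1 polyC1 mul1r.
Qed.

Lemma horner_interp u y : (interp u y).[sym_vec u] = y * different u.
Proof.
rewrite interpE differentE horner_sum (bigD1 1%g) //= [X in _ + X]big1 ?addr0 => [|g g1].
  rewrite hornerM hornerC sact1 horner_prod; congr (_ * _).
  by apply: eq_bigr => g _; rewrite hornerXsubC raddfB.
rewrite hornerM horner_prod (bigD1 1%g) /=; last by rewrite eq_sym.
rewrite [X in _ * (X * _)](_ : _ = 0) ?mul0r ?mulr0 //.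
by rewrite hornerXsubC rep_one subrr.
Qed.

Lemma orbit_poly_factor u : orbit_poly u = ('X - (sym_vec u)%:P) *
  \prod_(g : gT | g != 1%g) ('X - (sym_vec (rho g u))%:P).
Proof. by rewrite orbit_polyE (bigD1 1%g isT) /= rep_one. Qed.

Lemma horner_orbit_poly u : (orbit_poly u).[sym_vec u] = 0.
Proof. by rewrite orbit_poly_factor hornerM hornerXsubC subrr mul0r. Qed.

Lemma horner_deriv_orbit_poly u :
  (orbit_poly u)^`().[sym_vec u] = different u.
Proof.
rewrite orbit_poly_factor derivM derivXsubC mul1r hornerD hornerM hornerXsubC.
rewrite subrr mul0r addr0 horner_prod differentE.
by apply: eq_bigr => g _; rewrite hornerXsubC raddfB.
Qed.

Lemma orbit_poly_monic u : orbit_poly u \is monic.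
Proof. by rewrite orbit_polyE monic_prod_XsubC. Qed.

Lemma size_orbit_poly u : size (orbit_poly u) = #|gT|.+1.
Proof. by rewrite orbit_polyE size_prod_XsubC cardT enumT; case: index_enum_key. Qed.

(** The stabilizer of u is trivial: the conjugates of u are distinct, and u generates the fraction
    field of S over that of the invariants. *)
Definition regular_vec u := forall g : gT, g != 1%g -> u - rho g u != 0.

Lemma different_neq0 u : regular_vec u -> different u != 0.
Proof. by move=> hu; rewrite differentE; apply/prodf_neq0 => g /hu; rewrite sym_vec_eq0. Qed.

Lemma regular_orbit_inj u : regular_vec u -> injective (fun g => sym_vec (rho g u)).
Proof.
move=> hu g h e; have {}e : rho g u = rho h u.
  by apply/eqP; rewrite -subr_eq0 -sym_vec_eq0 raddfB /= subr_eq0; apply/eqP.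
apply/eqP; rewrite eq_mulVg1; apply/negPn/negP => /hu /eqP[].
by rewrite rep_mul -e -rep_mul mulVg rep_one subrr.
Qed.

(* Homogeneity of total degree D, the indeterminate having degree 1.          *)
Definition pgraded (D : nat) H :=
  (size H <= D.+1)%N /\ forall i, H`_i \is (D - i).-homog.

Lemma pgradedD D H K : pgraded D H -> pgraded D K -> pgraded D (H + K).
Proof.
move=> [sH hH] [sK hK]; split; last by move=> i; rewrite coefD rpredD.
by rewrite (leq_trans (size_polyD _ _)) // geq_max sH.
Qed.

Lemma pgradedM D E H K : pgraded D H -> pgraded E K -> pgraded (D + E) (H * K).
Proof.
move=> [sH hH] [sK hK]; split.
  rewrite (leq_trans (size_polyMleq _ _)) //; move: sH sK; lia.
move=> i; rewrite coefM; apply: rpred_sum => j _.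
have [Dj|jD] := ltnP D j; first by rewrite nth_default ?mul0r ?rpred0 // (leq_trans sH).
have [Ej|jE] := ltnP E (i - j).
  by rewrite [K`_ _]nth_default ?mulr0 ?rpred0 // (leq_trans sK).
have -> : (D + E - i = (D - j) + (E - (i - j)))%N by have := ltn_ord j; lia.
exact: dhomogM.
Qed.

Lemma pgradedC D f : f \is D.-homog -> pgraded D f%:P.
Proof.
move=> hf; split; first by rewrite (leq_trans (size_polyC_leq1 _)).
by move=> i; rewrite coefC; case: eqP => [->|_]; rewrite ?subn0 ?rpred0.
Qed.

Lemma pgraded_XsubC v : pgraded 1 ('X - (sym_vec v)%:P).
Proof.
split; first by rewrite size_XsubC.
move=> i; rewrite coefB coefX coefC; case: i => [|[|i]] /=.
- by rewrite sub0r rpredN sym_vec_homog.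
- by rewrite subr0 dhomog1.
by rewrite subr0 rpred0.
Qed.

Lemma pgraded_prod (A : pred gT) u :
  pgraded #|A| (\prod_(g in A) ('X - (sym_vec (rho g u))%:P)).
Proof.
rewrite -big_enum /= cardE; elim: (enum A) => [|g r IHr] /=.
  by rewrite big_nil -polyC1; apply: pgradedC; rewrite dhomog1.
by rewrite big_cons -add1n; apply: pgradedM => //; apply: pgraded_XsubC.
Qed.

Lemma pgraded_orbit_poly u : pgraded #|gT| (orbit_poly u).
Proof. by rewrite orbit_polyE; have := pgraded_prod predT u; rewrite cardT -cardE. Qed.

Lemma pgraded_interp u d y : y \is d.-homog -> pgraded (d + #|gT|.-1) (interp u y).
Proof.
move=> hy; rewrite interpE; apply: (big_ind (pgraded _)) => [|H K|g _].
- split; first by rewrite size_poly0.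
  by move=> i; rewrite coef0 rpred0.
- exact: pgradedD.
apply: pgradedM; first by apply/pgradedC/sym_map_homog.
by have := pgraded_prod (predC1 g) u; rewrite cardC1.
Qed.

Lemma pgraded_horner D H u : pgraded D H -> H.[sym_vec u] \is D.-homog.
Proof.
move=> [sH hH]; rewrite horner_coef; apply: rpred_sum => i _.
have -> : D = ((D - i) + 1 * i)%N.
  by have := ltn_ord i; move: sH; lia.
by rewrite dhomogM ?hH // ?(addnK, dhomogMn) ?sym_vec_homog.
Qed.

Lemma different_homog u : different u \is #|gT|.-1.-homog.
Proof.
rewrite -[different u]mul1r -horner_interp; apply: pgraded_horner.
by rewrite -[X in pgraded X _]add0n; apply/pgraded_interp/dhomog1.
Qed.

Lemma pgraded_deriv D H : pgraded D.+1 H -> pgraded D H^`().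
Proof.
move=> [sH hH]; split.
  by have [->|H0] := eqVneq H 0; rewrite ?linear0 ?size_poly0 // -ltnS (leq_trans (lt_size_deriv H0)).
by move=> i; rewrite coef_deriv rpredMn // -subSS hH.
Qed.

Lemma msize_homog d f : f \is d.-homog -> (msize f <= d.+1)%N.
Proof.
have [->|f0] := eqVneq f 0; first by rewrite msize0.
by move=> /dhomogP h; rewrite -mlead_deg // h // mlead_supp.
Qed.

Lemma msizeM_pred f q a b : (msize f <= a)%N -> (msize q <= b)%N ->
  (msize (f * q) <= (a + b).-1)%N.
Proof.
have [->|f0] := eqVneq f 0; first by rewrite mul0r msize0.
have [->|q0] := eqVneq q 0; first by rewrite mulr0 msize0.
by move=> ha hb; rewrite msizeM // -!subn1 leq_sub2r // leq_add.
Qed.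

Section Derivation.
Variable de : S -> S.
Hypothesis deD : forall f q, sinv f -> sinv q -> de (f + q) = de f + de q.
Hypothesis deM : forall f q, sinv f -> sinv q -> de (f * q) = f * de q + q * de f.
Hypothesis de_deg : forall d f, sinv f -> f \is d.-homog -> (msize (de f) <= d.-1)%N.

Lemma de0 : de 0 = 0.
Proof. by apply: (addrI (de 0)); rewrite -deD ?addr0 //; apply: sinv0. Qed.

Definition dep H : {poly S} := \poly_(i < size H) de H`_i.

Lemma coef_dep H i : (dep H)`_i = de H`_i.
Proof. by rewrite coef_poly; case: ltnP => // h; rewrite nth_default // de0. Qed.

Lemma depD H K : pinv H -> pinv K -> dep (H + K) = dep H + dep K.
Proof.
by move=> hH hK; apply/polyP=> i; rewrite coefD !coef_dep coefD deD.
Qed.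

Lemma de_sum (I : Type) (r : seq I) (F : I -> S) :
  (forall i, sinv (F i)) -> de (\sum_(i <- r) F i) = \sum_(i <- r) de (F i).
Proof.
move=> h; elim: r => [|i r IHr]; first by rewrite !big_nil de0.
by rewrite !big_cons deD ?IHr //; apply: sinv_sum.
Qed.

Lemma depM H K : pinv H -> pinv K -> dep (H * K) = H * dep K + dep H * K.
Proof.
move=> hH hK; apply/polyP=> i; rewrite coefD !coefM coef_dep coefM.
rewrite de_sum => [|j]; last exact: sinvM.
rewrite -big_split; apply: eq_bigr => j _ /=.
by rewrite !coef_dep deM // [de _ * _]mulrC.
Qed.

Section RegularVector.
Variable u : V.
Hypothesis u_reg : regular_vec u.
Notation su := (sym_vec u).

(* (different u)^2 times the extension of [de] to the fraction field, applied *)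
(* to H.[u]: the value of this derivation at u is forced by P.[u] = 0.        *)
Definition de_at H : S :=
  different u * (dep H).[su] - (dep (orbit_poly u)).[su] * H^`().[su].

Lemma de_atD H K : pinv H -> pinv K -> de_at (H + K) = de_at H + de_at K.
Proof.
move=> hH hK; rewrite /de_at depD // derivD !hornerD !mulrDr opprD.
by rewrite addrACA.
Qed.

Lemma de_atM H K : pinv H -> pinv K ->
  de_at (H * K) = H.[su] * de_at K + K.[su] * de_at H.
Proof.
move=> hH hK; rewrite /de_at depM // derivM !hornerD !hornerM.
move: (different u) (H.[su]) (K.[su]) (H^`().[su]) (K^`().[su]) => D a b a' b'.
by move: (dep H).[su] (dep K).[su] (dep _).[su] => c c' c''; ring.
Qed.

Lemma de_atC f : de_at f%:P = different u * de f.
Proof.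
rewrite /de_at derivC horner0 mulr0 subr0; congr (_ * _).
suff -> : dep f%:P = (de f)%:P by rewrite hornerC.
apply/polyP=> i; rewrite coef_dep.
by rewrite [X in de X]coefC [RHS]coefC; case: ifP => _; last exact: de0.
Qed.

Lemma de_at_orbit_poly : de_at (orbit_poly u) = 0.
Proof. by rewrite /de_at horner_deriv_orbit_poly mulrC subrr. Qed.

(** This makes the extension of [de] well defined. Dividing by the monic [orbit_poly u] reduces the
    claim to H of degree less than |Gamma|. The coefficients being invariant, such an H has all
    |Gamma| conjugates of u as roots and is 0. *)
Lemma de_at_eq0 H : pinv H -> H.[su] = 0 -> de_at H = 0.
Proof.
elim: {H}(size H) {-2}H (leqnn (size H)) => [|m IHm] H sH hH Hu.
  move: sH; rewrite leqn0 size_poly_eq0 => /eqP->.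
  by rewrite -polyC0 de_atC de0 mulr0.
have [le_P|lt_P] := leqP (size H) #|gT|; last first.
  have sP := size_orbit_poly u.
  have mP := orbit_poly_monic u.
  have iP := orbit_poly_inv u.
  pose c := lead_coef H; pose j := ((size H).-1 - #|gT|)%N.
  have ic : sinv c by apply: hH.
  have iq : pinv (c%:P * 'X^j) by apply: pinvM; [apply: pinvC|apply: pinvXn].
  pose K := H - c%:P * 'X^j * orbit_poly u.
  have iK : pinv K by apply: pinvD => //; apply: pinvN; apply: pinvM.
  have eH : H = K + c%:P * 'X^j * orbit_poly u by rewrite subrK.
  rewrite eH de_atD //; last exact: pinvM.
  rewrite de_atM // de_at_orbit_poly horner_orbit_poly mul0r mulr0 !addr0.
  apply: IHm => //; last first.
    by rewrite hornerD hornerN Hu hornerM horner_orbit_poly mulr0 subrr.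
  have H0 : H != 0 by rewrite -size_poly_gt0; apply: leq_trans lt_P.
  have c0 : c != 0 by rewrite lead_coef_eq0.
  have sq : size (c%:P * 'X^j * orbit_poly u) = size H.
    rewrite (size_Mmonic _ mP); last first.
      by rewrite mulf_neq0 ?polyC_eq0 ?monic_neq0 ?monicXn.
    rewrite (size_Mmonic _ (monicXn _ _)) ?polyC_eq0 //.
    rewrite size_polyXn size_polyC c0 sP.
    by move: lt_P; rewrite /j; lia.
  have lq : lead_coef (c%:P * 'X^j * orbit_poly u) = lead_coef H.
    by rewrite !lead_coefM lead_coefC lead_coefXn (monicP mP) !mulr1.
  have : (size K <= m.+1)%N.
    by rewrite (leq_trans (size_polyD _ _)) // size_polyN sq maxnn.
  rewrite leq_eqVlt => /predU1P[sK|//].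
  have : K`_m = 0.
    rewrite coefB; move: lq; rewrite !lead_coefE sq.
    have -> : (size H).-1 = m.
      apply/eqP; move: (size_polyD H (- (c%:P * 'X^j * orbit_poly u))).
      by rewrite size_polyN sq maxnn -/K sK => le; apply/eqP; move: le sH; lia.
    by move=> ->; rewrite subrr.
  have K0 : K != 0 by rewrite -size_poly_gt0 sK.
  by move/eqP; rewrite -[m]/(m.+1.-1) -sK -lead_coefE lead_coef_eq0 (negPf K0).
suff -> : H = 0 by rewrite -polyC0 de_atC de0 mulr0.
apply: contraTeq le_P => H0; rewrite -ltnNge.
have : (size [seq sym_vec (rho g u) | g <- enum gT] < size H)%N.
  apply: max_poly_roots => //.
    apply/allP=> _ /mapP[g _ ->]; rewrite rootE -sym_map_vec.
    have <- : map_poly (sact g) H = H by apply/polyP=> i; rewrite coef_map /= hH.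
    by rewrite horner_map /= Hu raddf0.
  by rewrite map_inj_uniq ?enum_uniq //; apply: regular_orbit_inj.
by rewrite size_map -cardE cardT.
Qed.

(** The polynomial [interp u y] takes the value y * [different u] at u, so by the Leibniz rule this
    is (different u)^2 times the extension of [de] at y: one factor comes from [de_at], the other
    from [interp]. *)
Definition de_ext y : S := de_at (interp u y) - y * de_at (interp u 1).

Lemma de_extD y y' : de_ext (y + y') = de_ext y + de_ext y'.
Proof.
rewrite /de_ext interpD de_atD; [|exact: interp_inv|exact: interp_inv].
by rewrite mulrDl opprD addrACA.
Qed.

(** The polynomials [interp u y * interp u y'] and [interp u 1 * interp u (y * y')] agree at u, so
    [de_at] agrees on them; expanding both sides gives the Leibniz rule after cancelling
    [different u]. *)
Lemma de_extM y y' : de_ext (y * y') = y * de_ext y' + y' * de_ext y.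
Proof.
have iQ := interp_inv u; have d0 := different_neq0 u_reg.
have : de_at (interp u y * interp u y' - interp u 1 * interp u (y * y')) = 0.
  apply: de_at_eq0; first by apply: pinvD; [|apply: pinvN]; apply: pinvM.
  have e a b c d t : (a * b - c * d : {poly S}).[t] = a.[t] * b.[t] - c.[t] * d.[t].
    by rewrite hornerD hornerN !hornerM.
  rewrite e (horner_interp u y) (horner_interp u y') (horner_interp u 1).
  rewrite (horner_interp u (y * y')).
  by move: (different u) => D; ring.
have eN H : pinv H -> de_at (- H) = - de_at H.
  move=> hH; apply/eqP; rewrite -addr_eq0 -de_atD ?addNr //; last exact: pinvN.
  by rewrite -polyC0 de_atC de0 mulr0.
rewrite de_atD; [|exact: pinvM|by apply: pinvN; apply: pinvM].
rewrite eN; last exact: pinvM.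
rewrite !de_atM // !horner_interp => /eqP; rewrite subr_eq0 => /eqP h.
apply: (mulfI d0); rewrite /de_ext.
move: (different u) (de_at (interp u (y * y'))) (de_at (interp u 1)) h.
move: (de_at (interp u y)) (de_at (interp u y')) => a a' D b c h.
have -> : D * (b - y * y' * c) =
  (1 * D * b + y * y' * D * c) - (y * y' * D * c) *+ 2 by ring.
by rewrite -h; ring.
Qed.

Lemma de_ext_sinv f : sinv f -> de_ext f = different u ^+ 2 * de f.
Proof.
move=> hf; rewrite /de_ext interp_sinv // de_atM; last 2 first.
- exact: pinvC.
- exact: interp_inv.
rewrite de_atC hornerC horner_interp.
by move: (different u) (de f) (de_at _) => D b c; ring.
Qed.

Lemma msize_horner_dep D H : pgraded D H -> pinv H -> (msize (dep H).[su] <= D.-1)%N.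
Proof.
move=> [sH hH] iH; rewrite horner_coef; apply: leq_trans (msize_sum _ _ _) _.
apply/bigmax_leqP_seq => i _ _; rewrite coef_dep.
have [->|d0] := eqVneq (de H`_i) 0; first by rewrite mul0r msize0.
have sdi := de_deg (iH i) (hH i).
have ui : (msize (su ^+ i) <= i.+1)%N.
  by apply: msize_homog; have := dhomogMn i (sym_vec_homog u); rewrite mul1n.
apply: leq_trans (msizeM_pred sdi ui) _; move: sdi.
case e: (D - i)%N => [|j] /=; first by rewrite leqn0 msize_poly_eq0 (negPf d0).
by move=> _; move: (nat_of_ord i) e => i0 e; lia.
Qed.

(** The extension lowers degrees by at least 2 and [different u] has degree |Gamma| - 1, so vectors
    are sent to degrees below that of (different u)^2. *)
Lemma msize_de_ext x : (0 < #|gT|)%N ->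
  (msize (de_ext (sym_vec x)) <= #|gT|.-1.*2)%N.
Proof.
case er: #|gT| => [//|r] _; rewrite /de_ext /de_at.
have gP := pgraded_orbit_poly u; have h1 : (1 : S) \is 0.-homog by exact: dhomog1.
have g1 := pgraded_interp u h1.
have gx := pgraded_interp u (sym_vec_homog x).
rewrite er /= ?add0n ?add1n in gP g1 gx.
have mD : (msize (different u) <= r.+1)%N.
  by apply: msize_homog; have := different_homog u; rewrite er.
have mP := msize_horner_dep gP (@orbit_poly_inv u).
have m1 := msize_horner_dep g1 (@interp_inv u 1).
have mx := msize_horner_dep gx (@interp_inv u (sym_vec x)).
have dx : (msize (interp u (sym_vec x))^`().[su] <= r.+1)%N.
  exact/msize_homog/pgraded_horner/pgraded_deriv.
have sx := msize_homog (sym_vec_homog x).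
have leD a b c : (msize a <= c)%N -> (msize b <= c)%N -> (msize (a - b : S) <= c)%N.
  move=> ha hb; apply: leq_trans (msizeD_le _ _) _.
  by rewrite geq_max ha msizeN.
(* For trivial Gamma the predecessors in the bounds are truncated; there the three values of [dep]
   are 0. *)
have [r0|r_gt0] := posnP r.
  rewrite r0 /= in mP m1 mx *; move: mP m1 mx.
  rewrite !leqn0 !msize_poly_eq0 => /eqP-> /eqP-> /eqP->.
  by rewrite !(mulr0, mul0r, subrr).
have d1 : (msize (interp u 1)^`().[su] <= r)%N.
  rewrite -(prednK r_gt0); apply/msize_homog/pgraded_horner/pgraded_deriv.
  by rewrite prednK.
apply: (leD); first apply: (leD).
- by apply: leq_trans (msizeM_pred mD mx) _; rewrite /=; lia.
- by apply: leq_trans (msizeM_pred mP dx) _; rewrite /=; lia.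
have : (msize (different u * (dep (interp u 1)).[su] -
    (dep (orbit_poly u)).[su] * (interp u 1)^`().[su]) <= r.*2.-1)%N.
  apply: leD; first by apply: leq_trans (msizeM_pred mD m1) _; rewrite /=; lia.
  by apply: leq_trans (msizeM_pred mP d1) _; rewrite /=; lia.
by move=> h; apply: leq_trans (msizeM_pred sx h) _; rewrite /=; lia.
Qed.

End RegularVector.
End Derivation.

(** Linear forms are primes of S. Each a in s divides the right-hand side but no b in t, hence
    divides q; the a are split off one after the other. *)
Lemma linear_forms_coprime (s t : seq V) (f q : S) :
  (forall a, a \in s -> a != 0) -> (forall a b, a \in s -> b \in t -> b \notin <[a]>%VS) ->
  \prod_(a <- s) sym_vec a * f = \prod_(b <- t) sym_vec b * q ->
  exists q', q = \prod_(a <- s) sym_vec a * q'.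
Proof.
elim: s f q => [|a s IHs] f q s0 st; first by exists q; rewrite big_nil mul1r.
have a0 : a != 0 by apply: s0; rewrite mem_head.
rewrite big_cons -mulrA => e.
have [q1 eq1] : exists q1, q = sym_vec a * q1.
  have {}e : exists q1, \prod_(b <- t) sym_vec b * q = sym_vec a * q1.
    by rewrite -e; eexists.
  have {}st b : b \in t -> b \notin <[a]>%VS by apply: st; rewrite mem_head.
  elim: t q {IHs f} st e => [|b t IHt] q st; first by rewrite big_nil mul1r.
  rewrite big_cons -mulrA => -[q1].
  have ab : b \notin <[a]>%VS by apply: st; rewrite mem_head.
  move=> /esym /(linear_form_cross a0 ab) h.
  by apply: IHt => // c ct; apply: st; rewrite inE ct orbT.
have [|||f' ef'] := IHs f q1.
- by move=> b bs; apply: s0; rewrite inE bs orbT.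
- by move=> b c bs; apply: st; rewrite inE bs orbT.
- apply: (mulfI (x := sym_vec a)); first by rewrite sym_vec_eq0.
  by rewrite e eq1 mulrCA.
by exists f'; rewrite eq1 ef' mulrA.
Qed.

(** * Derivations of S that vanish on the invariants *)

Section Uniqueness.
Variable B : S -> S.
Hypothesis BD : forall y y', B (y + y') = B y + B y'.
Hypothesis BM : forall y y', B (y * y') = y * B y' + y' * B y.

Fact derivation0 : B 0 = 0.
Proof. by apply: (addrI (B 0)); rewrite -BD !addr0. Qed.

Lemma derivation_eq0 : (forall a, B a%:MP = 0) ->
  (forall v, B (sym_vec v) = 0) -> forall f, B f = 0.
Proof.
move=> BC BV; elim/mpoly_closed_ind => [//|i|f q hf hq|f q hf hq].
- by rewrite -sym_vec_basis.
- by rewrite BD hf hq addr0.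
by rewrite BM hf hq !mulr0 addr0.
Qed.

Lemma derivation_horner H y : (forall i, B H`_i = 0) -> B H.[y] = H^`().[y] * B y.
Proof.
elim/poly_ind: H => [|H c IH] h.
  by rewrite horner0 derivation0 deriv0 horner0 mul0r.
have hc : B c = 0 by have := h 0%N; rewrite coefD coefMX coefC add0r.
have hH i : B H`_i = 0 by have := h i.+1; rewrite coefD coefMX coefC addr0.
rewrite hornerMXaddC BD hc addr0 BM IH // derivD derivC addr0 derivM derivX mulr1.
rewrite hornerD hornerMX; move: (H.[y]) (H^`().[y]) (B y) => a b d; ring.
Qed.

(** Applied to the relation [(orbit_poly v).[sym_vec v] = 0], B yields [different v] * B v = 0, so B
    kills every regular vector; and any v has the form (v + c u) - c u with v + c u regular. *)
Lemma derivation_inv_eq0 u : regular_vec u -> (forall f, sinv f -> B f = 0) ->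
  forall f, B f = 0.
Proof.
move=> hu hB; have BC a : B a%:MP = 0 by apply/hB/sinvC.
have Breg v : regular_vec v -> B (sym_vec v) = 0.
  move=> hv; apply: (mulfI (different_neq0 hv)).
  rewrite -horner_deriv_orbit_poly -derivation_horner => [|i]; last exact/hB/orbit_poly_inv.
  by rewrite horner_orbit_poly derivation0 mulr0.
apply: derivation_eq0 => // v.
have [W|c hc] := avoid_subspaces_line (Ws := [seq lker (\1 - rho g)%VF | g <- enum gT & g != 1%g]) (u := u) v.
  move=> /mapP[g]; rewrite mem_filter => /andP[g1 _] ->.
  by rewrite memv_ker !(add_lfunE, opp_lfunE, id_lfunE) hu.
have {hc} : regular_vec (v + c *: u).
  move=> g g1; have := hc (lker (\1 - rho g)%VF).
  rewrite memv_ker !(add_lfunE, opp_lfunE, id_lfunE); apply.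
  by apply: map_f; rewrite mem_filter g1 mem_enum.
move/Breg; rewrite raddfD /= linearZ /= BD -mul_mpolyC BM BC mulr0 addr0.
by rewrite (Breg u hu) mulr0 addr0.
Qed.

End Uniqueness.

(* No pseudo-reflections: each 1 - g with g != 1 has rank at least 2.         *)
Hypothesis no_refl : forall (g : gT) (a : V), g != 1%g ->
  exists v, v - rho g v \notin <[a]>%VS.

(** For g <> 1, the v with v - g v in a given line form a proper subspace by [no_refl]. The vector
    u' avoids these subspaces for the finitely many lines spanned by the u - g u. *)
Lemma generic_pair : exists u u', [/\ regular_vec u, regular_vec u' &
  forall g h : gT, g != 1%g -> h != 1%g -> u' - rho h u' \notin <[u - rho g u]>%VS].
Proof.
pose pre (a : V) (g : gT) := ((\1 - rho g)%VF @^-1: <[a]>)%VS.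
have preE a g v : (v \in pre a g) = (v - rho g v \in <[a]>%VS).
  by rewrite -memv_preim !(add_lfunE, opp_lfunE, id_lfunE).
pose G := [seq g <- enum gT | g != 1%g].
have memG g : (g \in G) = (g != 1%g) by rewrite mem_filter mem_enum andbT.
have ex (Ws : seq V) : exists u, forall a g, a \in Ws -> g != 1%g -> u - rho g u \notin <[a]>%VS.
  have [W|u hu] := avoid_subspaces (Ws := [seq pre a g | a <- Ws, g <- G]).
    case/allpairsP=> -[a g] /= [_]; rewrite memG => /(no_refl a)[v hv] ->.
    by exists v; rewrite preE.
  exists u => a g aW g1; rewrite -preE; apply: hu.
  by apply/allpairsP; exists (a, g); rewrite memG.
have reg a (Ws : seq V) u : a \in Ws ->
    (forall a g, a \in Ws -> g != 1%g -> u - rho g u \notin <[a]>%VS) -> regular_vec u.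
  move=> aW hu g g1; apply: contraNneq (hu a g aW g1) => ->; exact: mem0v.
have [u hu] := ex [:: 0]; have [u' hu'] := ex [seq u - rho g u | g <- enum gT].
exists u, u'; split.
- exact: reg (mem_head _ _) hu.
- by apply: (reg (u - rho 1%g u)) hu'; apply: (map_f (fun g => u - rho g u)); rewrite mem_enum.
by move=> g h g1 h1; apply: hu' => //; apply: (map_f (fun g => u - rho g u)); rewrite mem_enum.
Qed.

Lemma different_prod u :
  different u = \prod_(a <- [seq u - rho g u | g <- enum gT & g != 1%g]) sym_vec a.
Proof.
by rewrite differentE big_map big_filter big_enum_cond.
Qed.

Lemma different_sqr u (s := [seq u - rho g u | g <- enum gT & g != 1%g]) :
  \prod_(a <- s ++ s) sym_vec a = different u ^+ 2.
Proof. by rewrite big_cat /= -different_prod expr2. Qed.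

(** Let D, D' be the differents of a generic pair, and A, A' the extensions of [de] multiplied by
    D^2 and D'^2. The derivation D'^2 A - D^2 A' kills the invariants, hence vanishes. As D and D'
    are coprime, D^2 divides A v for every vector v, and A v has smaller degree than D^2, so A =
    0. *)
Theorem invariant_derivation_eq0 (de : S -> S) :
  (forall f q, sinv f -> sinv q -> de (f + q) = de f + de q) ->
  (forall f q, sinv f -> sinv q -> de (f * q) = f * de q + q * de f) ->
  (forall d f, sinv f -> f \is d.-homog -> (msize (de f) <= d.-1)%N) ->
  forall f, sinv f -> de f = 0.
Proof.
move=> deD deM de_deg f hf; have [u [u' [ru ru' uu']]] := generic_pair.
pose A := de_ext de u; pose A' := de_ext de u'.
have AD := de_extD deD u; have AM := de_extM deD deM ru.
have A'D := de_extD deD u'; have A'M := de_extM deD deM ru'.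
have Ainv q (hq : sinv q) := de_ext_sinv deD deM u hq.
have A'inv q (hq : sinv q) := de_ext_sinv deD deM u' hq.
pose B y := different u' ^+ 2 * A y - different u ^+ 2 * A' y.
have BD y y' : B (y + y') = B y + B y'.
  by rewrite /B /A /A' AD A'D; move: (different u) (different u') => D D'; ring.
have BM y y' : B (y * y') = y * B y' + y' * B y.
  rewrite /B /A /A' AM A'M; move: (different u) (different u') => D D'.
  by move: (de_ext _ _ _) (de_ext _ _ _) (de_ext _ _ _) (de_ext _ _ _) => a b c d; ring.
have B0 y : B y = 0.
  apply: (derivation_inv_eq0 BD BM ru) => q hq; rewrite /B /A /A' Ainv // A'inv //.
  by move: (different u) (different u') (de q) => D D' b; ring.
have de_C a : de a%:MP = 0.
  apply/eqP; rewrite -msize_poly_eq0 -leqn0.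
  by apply: (de_deg 0%N); [apply: sinvC|rewrite -alg_mpolyC rpredZ ?dhomog1].
have A0 y : A y = 0.
  apply: (derivation_eq0 AD AM) => [a|v].
    by rewrite Ainv ?de_C ?mulr0 //; apply: sinvC.
  have [|||q eq] := @linear_forms_coprime
    ([seq u - rho g u | g <- enum gT & g != 1%g] ++ [seq u - rho g u | g <- enum gT & g != 1%g])
    ([seq u' - rho g u' | g <- enum gT & g != 1%g] ++ [seq u' - rho g u' | g <- enum gT & g != 1%g])
    (A' (sym_vec v)) (A (sym_vec v)).
  - move=> a; rewrite mem_cat orbb => /mapP[g]; rewrite mem_filter => /andP[g1 _] ->.
    exact: ru.
  - move=> a b; rewrite !mem_cat !orbb => /mapP[g]; rewrite mem_filter => /andP[g1 _] ->.
    by move=> /mapP[h]; rewrite mem_filter => /andP[h1 _] ->; apply: uu'.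
  - rewrite !different_sqr; apply/eqP; rewrite eq_sym -subr_eq0.
    by apply/eqP/B0.
  rewrite different_sqr in eq.
  have card_gT : (0 < #|gT|)%N by apply/card_gt0P; exists 1%g.
  have := msize_de_ext deD de_deg u v card_gT; rewrite -/(A _) eq.
  have D0 := different_neq0 ru.
  have [->|q0] := eqVneq q 0; first by rewrite mulr0.
  have sD2 : msize (different u ^+ 2) = (#|gT|.-1.*2).+1.
    rewrite -mlead_deg ?expf_neq0 // mleadX // mdegMn muln2.
    by move/dhomogP: (different_homog u) => ->; rewrite ?mlead_supp.
  rewrite msizeM ?expf_neq0 // sD2.
  have : (0 < msize q)%N by rewrite lt0n msize_poly_eq0.
  by move: (msize q) => sq ? ?; exfalso; lia.
apply: (mulfI (x := different u ^+ 2)); first by rewrite expf_neq0 ?different_neq0.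
by rewrite mulr0 -(Ainv _ hf) -/(A f) A0.
Qed.

End Invariants.

(** * The Poincare-Birkhoff-Witt operators *)

Section EndomorphismRing.
Variable U : zmodType.

(** The ring of additive endomorphisms serves twice: the relations of the algebra are checked in it,
    and [lie_exp_p] computes in it with left and right multiplications. *)
Record endo := Endo { endo_fun :> U -> U; endo_zmod : zmod_morphism endo_fun }.
HB.instance Definition _ := gen_eqMixin endo.
HB.instance Definition _ := gen_choiceMixin endo.
HB.instance Definition _ (f : endo) :=
  GRing.isZmodMorphism.Build U U (endo_fun f) (endo_zmod f).
Implicit Types f g h : endo.

Lemma endoP f g : f =1 g -> f = g.
Proof.
case: f g => [f hf] [g hg] /= /funext fg; move: hf hg; rewrite fg => hf hg.
by congr Endo; apply: Prop_irrelevance.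
Qed.

Fact endo0_zmod : zmod_morphism (fun _ : U => 0 : U).
Proof. by move=> x y; rewrite subrr. Qed.
Fact endoN_zmod f : zmod_morphism (fun x => - f x).
Proof. by move=> x y; rewrite raddfB opprB opprK addrC. Qed.
Fact endoD_zmod f g : zmod_morphism (fun x => f x + g x).
Proof. by move=> x y; rewrite !raddfB opprD addrACA. Qed.
Fact endo1_zmod : zmod_morphism (id : U -> U).
Proof. by []. Qed.
Fact endoM_zmod f g : zmod_morphism (fun x => f (g x)).
Proof. by move=> x y; rewrite !raddfB. Qed.

Definition endo0 := Endo endo0_zmod.
Definition endoN f := Endo (endoN_zmod f).
Definition endoD f g := Endo (endoD_zmod f g).
Definition endo1 := Endo endo1_zmod.
Definition endoM f g := Endo (endoM_zmod f g).

Fact endoDA : associative endoD.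
Proof. by move=> f g h; apply: endoP => x /=; rewrite addrA. Qed.
Fact endoDC : commutative endoD.
Proof. by move=> f g; apply: endoP => x /=; rewrite addrC. Qed.
Fact endoD0 : left_id endo0 endoD.
Proof. by move=> f; apply: endoP => x /=; rewrite add0r. Qed.
Fact endoDN : left_inverse endo0 endoN endoD.
Proof. by move=> f; apply: endoP => x /=; rewrite addNr. Qed.
HB.instance Definition _ := GRing.isZmodule.Build endo endoDA endoDC endoD0 endoDN.

Fact endoMA : associative endoM.
Proof. by move=> f g h; apply: endoP. Qed.
Fact endo1M : left_id endo1 endoM.
Proof. by move=> f; apply: endoP. Qed.
Fact endoM1 : right_id endo1 endoM.
Proof. by move=> f; apply: endoP. Qed.
Fact endoMDl : left_distributive endoM endoD.
Proof. by move=> f g h; apply: endoP. Qed.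
Fact endoMDr : right_distributive endoM endoD.
Proof. by move=> f g h; apply: endoP => x /=; rewrite raddfD. Qed.
HB.instance Definition _ := GRing.Zmodule_isPzRing.Build endo
  endoMA endo1M endoM1 endoMDl endoMDr.

Lemma endo_addE f g x : (f + g) x = f x + g x. Proof. by []. Qed.
Lemma endo_mulE f g x : (f * g) x = f (g x). Proof. by []. Qed.
Lemma endo_subE f g x : (f - g) x = f x - g x. Proof. by []. Qed.
Lemma endo_oneE x : (1 : endo) x = x. Proof. by []. Qed.
Lemma endo_zeroE x : (0 : endo) x = 0. Proof. by []. Qed.
Lemma endo_sumE (I : Type) (r : seq I) (P : pred I) (F : I -> endo) x :
  (\sum_(i <- r | P i) F i) x = \sum_(i <- r | P i) F i x.
Proof.
elim: r => [|i r IHr]; first by rewrite !big_nil.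
by rewrite !big_cons; case: (P i); rewrite ?endo_addE IHr.
Qed.

End EndomorphismRing.

(* The Poincare-Birkhoff-Witt theorem: left multiplication by v on the basis  *)
(* h (x) m of k Gamma (x) S is defined by recursion on the degree of m.       *)
Section PBW.
Variables (k : fieldType) (V : vectType k) (gT : finGroupType).
Variable rho : linRep gT V.
Notation n := (\dim {:V}).
Notation e := (vbasis {:V}).
Notation S := (mpoly n k).
Notation M := {ffun gT -> mpoly n k}.
Implicit Types (u v w : V) (f : M) (p q : S) (m : 'X_{1..n}) (g h : gT).

(** [kap u v g] is the coefficient of g in the commutator of u and v. Equivariance and the Jacobi
    identity are the conditions under which the Poincare-Birkhoff-Witt theorem holds. *)
Variable kap : V -> V -> gT -> k.
Hypothesis kapP : forall g a u u' v, kap (a *: u + u') v g = a * kap u v g + kap u' v g.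
Hypothesis kap_alt : forall g v, kap v v g = 0.
Hypothesis kap_skew : forall g u v, kap u v g = - kap v u g.
Hypothesis kap_conj : forall g h u v,
  kap (rho h u) (rho h v) (h * g * h^-1)%g = kap u v g.
Hypothesis kap_jacobi : forall g u v w,
  kap u v g *: (w - rho g w) + kap v w g *: (u - rho g u) +
  kap w u g *: (v - rho g v) = 0.

(** An element f of M stands for the sum of the h (x) f h, with group elements on the left; this is
    left multiplication by h. *)
Definition Gop h f : M := [ffun x => f (h^-1 * x)%g].
Definition tens h p : M := [ffun x => if x == h then p else 0].

Fact Gop_linear h : linear (Gop h).
Proof. by move=> a f f'; apply/ffunP=> x; rewrite !ffunE. Qed.
HB.instance Definition _ h := GRing.isLinear.Build k M M *:%R (Gop h) (Gop_linear h).

Fact tens_linear h : linear (tens h).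
Proof.
move=> a p q; apply/ffunP=> x; rewrite !ffunE.
by case: eqP; rewrite // scaler0 addr0.
Qed.
HB.instance Definition _ h := GRing.isLinear.Build k S M *:%R (tens h) (tens_linear h).

Lemma Gop1 f : Gop 1%g f = f.
Proof. by apply/ffunP=> x; rewrite ffunE invg1 mul1g. Qed.

Lemma GopM g h f : Gop (g * h)%g f = Gop g (Gop h f).
Proof. by apply/ffunP=> x; rewrite !ffunE invMg mulgA. Qed.

Lemma Gop_tens g h p : Gop g (tens h p) = tens (g * h)%g p.
Proof.
apply/ffunP=> x; rewrite !ffunE -[x in RHS](mulKVg g) (inj_eq (mulgI g)) //.
Qed.

Lemma tens_sum f : f = \sum_h tens h (f h).
Proof.
apply/ffunP=> x; rewrite sum_ffunE (bigD1 x) //= ffunE eqxx big1 ?addr0 // => h /negPf hx.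
by rewrite ffunE eq_sym hx.
Qed.

Definition mext (a : 'X_{1..n} -> M) p : M := \sum_(m <- msupp p) p@_m *: a m.

Lemma mextE a p d : (msize p <= d)%N ->
  mext a p = \sum_(m : 'X_{1..n < d}) p@_m *: a m.
Proof.
by move=> le_pd; apply: (@msupp_sumE _ _ _ (fun m c => c *: a m)) => // m; rewrite scale0r.
Qed.

Fact mext_linear a : linear (mext a).
Proof.
move=> c p q; pose d := maxn (msize p) (msize q).
have [hp hq] : (msize p <= d)%N /\ (msize q <= d)%N by rewrite leq_maxl leq_maxr.
have hpq : (msize (c *: p + q) <= d)%N.
  rewrite (leq_trans (msizeD_le _ _)) // geq_max hq andbT.
  exact: leq_trans (msizeZ_le _ _) hp.
rewrite !(@mextE a _ d) // scaler_sumr -big_split; apply: eq_bigr => m _ /=.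
by rewrite mcoeffD mcoeffZ scalerDl scalerA.
Qed.
HB.instance Definition _ a := GRing.isLinear.Build k S M *:%R (mext a) (mext_linear a).

Lemma mextX a m : mext a 'X_[m] = a m.
Proof. by rewrite /mext msuppX big_seq1 mcoeffX eqxx scale1r. Qed.

(** The degree is bounded strictly, as [msize] is the degree plus one: [Mdeg 0] means zero. *)
Definition Mdeg d f := forall h, (msize (f h) <= d)%N.

Lemma Mdeg_le d d' f : (d <= d')%N -> Mdeg d f -> Mdeg d' f.
Proof. by move=> dd' hf h; apply: leq_trans (hf h) dd'. Qed.

Lemma Mdeg0 d : Mdeg d 0.
Proof. by move=> h; rewrite ffunE msize0. Qed.

Lemma MdegD d f f' : Mdeg d f -> Mdeg d f' -> Mdeg d (f + f').
Proof.
move=> hf hf' h; rewrite ffunE (leq_trans (msizeD_le _ _)) //.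
by rewrite geq_max hf hf'.
Qed.

Lemma MdegZ d c f : Mdeg d f -> Mdeg d (c *: f).
Proof. by move=> hf h; rewrite ffunE (leq_trans (msizeZ_le _ _)). Qed.

Lemma Mdeg_sum d (I : Type) (r : seq I) (P : pred I) (F : I -> M) :
  (forall i, P i -> Mdeg d (F i)) -> Mdeg d (\sum_(i <- r | P i) F i).
Proof.
by move=> hF; apply: (big_ind (Mdeg d)) => //; [exact: Mdeg0|exact: MdegD].
Qed.

Lemma Mdeg_Gop d g f : Mdeg d f -> Mdeg d (Gop g f).
Proof. by move=> hf h; rewrite ffunE. Qed.

Lemma Mdeg_tens d h p : (msize p <= d)%N -> Mdeg d (tens h p).
Proof. by move=> hp x; rewrite ffunE; case: eqP => // _; rewrite msize0. Qed.

Lemma Mdeg_mext d a p : (forall m, m \in msupp p -> Mdeg d (a m)) -> Mdeg d (mext a p).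
Proof.
move=> ha; rewrite /mext big_seq; apply: Mdeg_sum => m hm.
by apply: MdegZ; apply: ha.
Qed.

Section Operator.
Variable l : 'I_n -> 'X_{1..n} -> M.

Definition lop1 v p : M := \sum_(i < n) coord e i v *: mext (l i) p.
(** Encodes v (h (x) q) = h ((h^-1 v) (1 (x) q)), that is, v is moved past h before the operators
    [l] apply. *)
Definition lop v f : M := \sum_h Gop h (lop1 (rho h^-1%g v) (f h)).

Lemma lop1P v a p q : lop1 v (a *: p + q) = a *: lop1 v p + lop1 v q.
Proof.
rewrite /lop1 scaler_sumr -big_split; apply: eq_bigr => i _ /=.
by rewrite linearP scalerDr !scalerA mulrC.
Qed.

Lemma lop1_vecP a u v p : lop1 (a *: u + v) p = a *: lop1 u p + lop1 v p.
Proof.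
rewrite /lop1 scaler_sumr -big_split; apply: eq_bigr => i _ /=.
by rewrite linearP scalerDl scalerA.
Qed.

Fact lop_linear v : linear (lop v).
Proof.
move=> a f f'; rewrite /lop scaler_sumr -big_split; apply: eq_bigr => h _ /=.
by rewrite !ffunE lop1P linearP.
Qed.
HB.instance Definition _ v := GRing.isLinear.Build k M M *:%R (lop v) (lop_linear v).

Lemma lop_vecP a u v f : lop (a *: u + v) f = a *: lop u f + lop v f.
Proof.
rewrite /lop scaler_sumr -big_split; apply: eq_bigr => h _ /=.
by rewrite linearP lop1_vecP linearP.
Qed.

Lemma lop_Gop h v f : Gop h (lop v f) = lop (rho h v) (Gop h f).
Proof.
rewrite /lop linear_sum [RHS](reindex_inj (mulgI h)) /=; apply: eq_bigr => g _.
by rewrite -GopM ffunE mulKg invMg -rep_mul -mulgA mulVg mulg1.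
Qed.

Lemma lop_tens1 v p : lop v (tens 1%g p) = lop1 v p.
Proof.
rewrite /lop (bigD1 1%g) //= big1 ?addr0 => [|h /negPf h1].
  by rewrite invg1 rep_one ffunE eqxx Gop1.
rewrite ffunE h1 /lop1 big1 ?linear0 // => i _.
by rewrite linear0 scaler0.
Qed.

Lemma lop_basis (i : 'I_n) m : lop e`_i (tens 1%g 'X_[m]) = l i m.
Proof.
rewrite lop_tens1 /lop1 (bigD1 i) //= coord_vbasis_eq eqxx scale1r mextX.
by rewrite big1 ?addr0 // => j ji; rewrite coord_vbasis_eq (negPf ji) scale0r.
Qed.

Lemma lop_deg d v f : (forall i m, (mdeg m < d)%N -> Mdeg d.+1 (l i m)) ->
  Mdeg d f -> Mdeg d.+1 (lop v f).
Proof.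
move=> hl hf; apply: Mdeg_sum => h _; apply: Mdeg_Gop; apply: Mdeg_sum => i _.
apply: MdegZ; apply: Mdeg_mext => m hm; apply: hl.
exact: leq_trans (msize_mdeg_lt hm) (hf h).
Qed.

End Operator.

Lemma lop_ext l l' d v f : (forall i m, (mdeg m < d)%N -> l i m = l' i m) ->
  Mdeg d f -> lop l v f = lop l' v f.
Proof.
move=> ll hf; apply: eq_bigr => h _; congr (Gop _ _); apply: eq_bigr => i _.
congr (_ *: _); rewrite /mext big_seq [RHS]big_seq; apply: eq_bigr => m hm.
rewrite ll //; exact: leq_trans (msize_mdeg_lt hm) (hf h).
Qed.

Definition kact u v f : M := \sum_g kap u v g *: Gop g f.

Fact kact_linear u v : linear (kact u v).
Proof.
move=> a f f'; rewrite /kact scaler_sumr -big_split; apply: eq_bigr => g _ /=.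
by rewrite linearP scalerDr !scalerA mulrC.
Qed.
HB.instance Definition _ u v :=
  GRing.isLinear.Build k M M *:%R (kact u v) (kact_linear u v).

Lemma kact_skew u v f : kact u v f = - kact v u f.
Proof.
by rewrite -sumrN; apply: eq_bigr => g _; rewrite kap_skew scaleNr.
Qed.

Lemma kact_alt v f : kact v v f = 0.
Proof. by rewrite /kact big1 // => g _; rewrite kap_alt scale0r. Qed.

Lemma kact_vecP a u u' v f : kact (a *: u + u') v f = a *: kact u v f + kact u' v f.
Proof.
rewrite /kact scaler_sumr -big_split; apply: eq_bigr => g _ /=.
by rewrite kapP scalerDl scalerA.
Qed.

Lemma kact_Gop h u v f : Gop h (kact u v f) = kact (rho h u) (rho h v) (Gop h f).
Proof.
rewrite /kact linear_sum /= [RHS](reindex_inj (conjg_inj h^-1%g)) /=.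
apply: eq_bigr => g _; rewrite linearZ /= -!GopM conjgE invgK mulgA.
by rewrite mulgKV kap_conj.
Qed.

Lemma Mdeg_kact d u v f : Mdeg d f -> Mdeg d (kact u v f).
Proof. by move=> hf; apply: Mdeg_sum => g _; apply/MdegZ/Mdeg_Gop. Qed.

(** The condition for x_j m to be an ordered monomial beginning with x_j, so that multiplication by
    e_j needs no reordering. *)
Definition below (j : 'I_n) m := [forall i : 'I_n, (i < j)%N ==> (m i == 0%N)].

Definition minidx (j : 'I_n) m :=
  [pick i : 'I_n | [&& (i < j)%N, m i != 0%N & below i m]].

Lemma belowP (j : 'I_n) m :
  reflect (forall i : 'I_n, (i < j)%N -> m i = 0%N) (below j m).
Proof.
by apply: (iffP forallP) => h i; [move=> ij; apply/eqP; have /implyP := h i; apply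
                                 |apply/implyP => /h/eqP].
Qed.

Lemma minidx_below j m : below j m -> minidx j m = None.
Proof.
move=> /belowP h; rewrite /minidx; case: pickP => // i /and3P[ij].
by rewrite h.
Qed.

Lemma minidx_none j m : minidx j m = None -> below j m.
Proof.
rewrite /minidx; case: pickP => // h _; apply/belowP => i ij.
apply/eqP; apply: contraT => mi.
have [i' /andP[ij' mi'] hmin] := @arg_minnP _ i
  (fun i : 'I_n => (i < j)%N && (m i != 0%N)) (@nat_of_ord n)
  (introT andP (conj ij mi)).
have := h i'; rewrite ij' mi' /= => /negbT/negP[]; apply/belowP => i2 lt.
apply/eqP; apply: contraT => mi2; have := hmin i2.
by rewrite (ltn_trans lt ij') mi2 leqNgt lt => /(_ isT).
Qed.

Lemma minidxP j m i : minidx j m = Some i -> [/\ (i < j)%N, m i != 0%N & below i m].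
Proof. by rewrite /minidx; case: pickP => // x /and3P[? ? ?] [<-]. Qed.

(** With d as fuel. If m = x_i m' begins with x_i and i < j, the value is forced by x_j x_i m' = x_i
    (x_j m') + [x_j, x_i] m'. *)
Fixpoint ell (d : nat) (j : 'I_n) m : M :=
  let stop := tens 1%g 'X_[U_(j) + m] in
  if d is d'.+1 then
    if minidx j m is Some i then
      lop (ell d') e`_i (ell d' j (m - U_(i))%MM)
      + kact e`_j e`_i (tens 1%g 'X_[m - U_(i)])
    else stop
  else stop.

Lemma ellS d j m : ell d.+1 j m =
  if minidx j m is Some i then
    lop (ell d) e`_i (ell d j (m - U_(i))%MM) + kact e`_j e`_i (tens 1%g 'X_[m - U_(i)])
  else tens 1%g 'X_[U_(j) + m].
Proof. by []. Qed.

Lemma ell_stop d j m : below j m -> ell d j m = tens 1%g 'X_[U_(j) + m].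
Proof. by case: d => //= d /minidx_below ->. Qed.

Lemma below_add (i j : 'I_n) m : (i < j)%N -> below i m -> below i (U_(j) + m)%MM.
Proof.
move=> ij /belowP h; apply/belowP => i' ii'; rewrite mnmDE mnm1E h // addn0.
by case: eqP ii' => // <- /(ltn_trans ij); rewrite ltnn.
Qed.

Lemma below_sub (i : 'I_n) m i' : below i m -> below i (m - U_(i'))%MM.
Proof. by move=> /belowP h; apply/belowP => j ji; rewrite mnmBE h. Qed.

Lemma mdeg_sub1 i m : m i != 0%N -> mdeg m = (mdeg (m - U_(i))%MM).+1.
Proof. by move=> mi; rewrite -{1}(@submK _ U_(i)%MM m) ?lep1mP // mdegD mdeg1 addn1. Qed.

Lemma mnm_add_sub1 i j m : m i != 0%N -> (U_(i) + (U_(j) + (m - U_(i))) = U_(j) + m)%MM.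
Proof. by move=> mi; rewrite addmC -addmA submK ?lep1mP. Qed.

Lemma Mdeg_top d h m : (mdeg m < d)%N -> Mdeg d (tens h 'X_[m]).
Proof. by move=> hm; apply: Mdeg_tens; rewrite msizeX. Qed.

Lemma Mdeg_lead d f h m : (mdeg m < d)%N -> Mdeg d (f - tens h 'X_[m]) -> Mdeg d f.
Proof. by move=> hm hf; rewrite -[f](subrK (tens h 'X_[m])); apply/MdegD/Mdeg_top. Qed.

(** Up to lower degree the operators are the commutative multiplications; independence of the fuel
    and the computation of symbols both rest on this. *)
Lemma ell_lead d j m : (mdeg m <= d)%N ->
  Mdeg (mdeg m).+1 (ell d j m - tens 1%g 'X_[U_(j) + m]).
Proof.
elim: d j m => [|d IHd] j m dm; first by rewrite /= subrr; apply: Mdeg0.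
rewrite /=; case E: minidx => [i|]; last by rewrite subrr; apply: Mdeg0.
have [ij mi im] := minidxP E; have em := mdeg_sub1 mi.
set m' := (m - U_(i))%MM in em *; have dm' : (mdeg m' <= d)%N by rewrite -ltnS -em.
have hw := IHd j m' dm'; set w := _ - _ in hw.
have -> : ell d j m' = tens 1%g 'X_[U_(j) + m'] + w by rewrite addrC subrK.
rewrite linearD /= lop_basis ell_stop; last exact/below_add/below_sub.
rewrite mnm_add_sub1 // addrAC [_ + _ - _]addrAC subrr add0r.
apply: MdegD; last by rewrite em; apply/Mdeg_kact/Mdeg_top/leqW.
rewrite em; apply: lop_deg hw => i' m2; rewrite ltnS => hm2.
have dm2 := leq_trans hm2 dm'.
apply: (@Mdeg_lead _ _ 1%g (U_(i') + m2)%MM); first by rewrite mdegD mdeg1.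
by apply: Mdeg_le (IHd i' m2 dm2); apply: leqW.
Qed.

(* Only the leading term of ell d j m exceeds the degree covered by the fuel, *)
(* and on it the recursion has already stopped.                               *)
Lemma lop_ell_eq l l' d (i j : 'I_n) m : (i < j)%N -> below i m -> (mdeg m <= d)%N ->
  l i (U_(j) + m)%MM = l' i (U_(j) + m)%MM ->
  (forall i' m', (mdeg m' <= mdeg m)%N -> l i' m' = l' i' m') ->
  lop l e`_i (ell d j m) = lop l' e`_i (ell d j m).
Proof.
move=> ij im dm etop ll; have hw := ell_lead j dm; set w := _ - _ in hw.
have -> : ell d j m = tens 1%g 'X_[U_(j) + m] + w by rewrite addrC subrK.
clearbody w.
rewrite !linearD /= !lop_basis etop; congr (_ + _).
by apply: lop_ext hw => i' m'; rewrite ltnS => /ll ->.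
Qed.

Lemma ell_succ d j m : (mdeg m <= d)%N -> ell d j m = ell d.+1 j m.
Proof.
elim: d j m => [|d IHd] j m.
  rewrite leqn0 mdeg_eq0 => /eqP->; rewrite [RHS]ell_stop //.
  by apply/belowP => i _; rewrite mnm0E.
move=> dm; rewrite [LHS]ellS [RHS]ellS; case E: minidx => [i|//].
have [ij mi im] := minidxP E; have em := mdeg_sub1 mi.
have dm' : (mdeg (m - U_(i))%MM <= d)%N by rewrite -ltnS -em.
congr (_ + _); rewrite -IHd //; apply: (lop_ell_eq (d := d)) => //; first exact: below_sub.
  by rewrite !ell_stop //; apply/below_add/below_sub.
by move=> i' m' hm'; apply: IHd; apply: leq_trans hm' dm'.
Qed.

Lemma ell_fuel d j m : (mdeg m <= d)%N -> ell d j m = ell (mdeg m) j m.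
Proof.
elim: d => [|d IHd]; first by rewrite leqn0 => /eqP->.
rewrite leq_eqVlt => /predU1P[->//|]; rewrite ltnS => dm.
by rewrite -ell_succ // IHd.
Qed.

Fact pbw_key : unit. Proof. by []. Qed.
Definition pbw_mul : V -> M -> M :=
  locked_with pbw_key (lop (fun j m => ell (mdeg m) j m)).

Lemma pbw_mulE : pbw_mul = lop (fun j m => ell (mdeg m) j m).
Proof. by rewrite /pbw_mul unlock. Qed.

Fact pbw_mul_linear v : linear (pbw_mul v).
Proof. by rewrite pbw_mulE; apply: lop_linear. Qed.
HB.instance Definition _ v :=
  GRing.isLinear.Build k M M *:%R (pbw_mul v) (pbw_mul_linear v).

Lemma pbw_mul_stop (j : 'I_n) m : below j m ->
  pbw_mul e`_j (tens 1%g 'X_[m]) = tens 1%g 'X_[U_(j) + m].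
Proof. by move=> jm; rewrite pbw_mulE lop_basis ell_stop. Qed.

Lemma pbw_mul_step (i j : 'I_n) m : (i < j)%N -> below i m ->
  pbw_mul e`_j (tens 1%g 'X_[U_(i) + m]) =
  pbw_mul e`_i (pbw_mul e`_j (tens 1%g 'X_[m])) + kact e`_j e`_i (tens 1%g 'X_[m]).
Proof.
move=> ij im; rewrite !pbw_mulE !lop_basis mdegD mdeg1 add1n ellS.
have -> : minidx j (U_(i) + m)%MM = Some i.
  rewrite /minidx; case: pickP => [i' /and3P[i'j mi' /belowP i'm]|/(_ i)].
    congr Some; apply/eqP; move: mi'; rewrite mnmDE mnm1E.
    case: (eqVneq i i') => [//|ii'] mi'; rewrite add0n in mi'.
    have := i'm i; rewrite mnmDE mnm1E eqxx /= => h.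
    case: (ltngtP i i') => [/h//|lt|/val_inj e0].
      by move/belowP: im => /(_ _ lt) e0; rewrite e0 in mi'.
    by rewrite e0 eqxx in ii'.
  rewrite ij mnmDE mnm1E eqxx /= => /belowP[] i' lt.
  rewrite mnmDE mnm1E; move/belowP: im => /(_ _ lt) ->.
  by case: eqP lt => [->|//]; rewrite ltnn.
have -> : (U_(i) + m - U_(i))%MM = m by rewrite addmC addmK.
apply: (f_equal (fun x => x + _)).
apply: (lop_ell_eq (d := mdeg m)) => //.
  by rewrite !ell_stop //; apply: below_add.
by move=> i' m' hm'; apply: ell_fuel.
Qed.

Lemma pbw_mul_lead (j : 'I_n) m :
  Mdeg (mdeg m).+1 (pbw_mul e`_j (tens 1%g 'X_[m]) - tens 1%g 'X_[U_(j) + m]).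
Proof. by rewrite pbw_mulE lop_basis; apply: ell_lead. Qed.

Lemma pbw_mul_deg d v f : Mdeg d f -> Mdeg d.+1 (pbw_mul v f).
Proof.
rewrite pbw_mulE; apply: lop_deg => i m hm; apply: (@Mdeg_lead _ _ 1%g (U_(i) + m)%MM).
  by rewrite mdegD mdeg1.
by apply: Mdeg_le (ell_lead i (leqnn _)); apply: leqW.
Qed.

Lemma pbw_mul_Gop h v f : Gop h (pbw_mul v f) = pbw_mul (rho h v) (Gop h f).
Proof. by rewrite pbw_mulE lop_Gop. Qed.

Lemma pbw_mul_vecP a u v f : pbw_mul (a *: u + v) f = a *: pbw_mul u f + pbw_mul v f.
Proof. by rewrite pbw_mulE lop_vecP. Qed.

Fact pbw_mul_vec_linear f : linear (pbw_mul^~ f).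
Proof. by move=> a u v; apply: pbw_mul_vecP. Qed.

Definition pbw_comm u v f :=
  pbw_mul u (pbw_mul v f) - pbw_mul v (pbw_mul u f) = kact u v f.

Lemma pbw_comm_sym u v f : pbw_comm u v f -> pbw_comm v u f.
Proof. by move=> h; rewrite /pbw_comm -opprB h kact_skew opprK. Qed.

Lemma pbw_commP u v a f f' : pbw_comm u v f -> pbw_comm u v f' ->
  pbw_comm u v (a *: f + f').
Proof.
by rewrite /pbw_comm => h h'; rewrite !linearP /= -h -h' scalerBr scalerN addrACA.
Qed.

Lemma pbw_comm_vecP a u u' v f : pbw_comm u v f -> pbw_comm u' v f ->
  pbw_comm (a *: u + u') v f.
Proof.
rewrite /pbw_comm kact_vecP !pbw_mul_vecP => <- <-.
by rewrite !linearP /= scalerBr scalerN addrACA.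
Qed.

Lemma pbw_comm0 v f : pbw_comm 0 v f.
Proof.
have z f' : pbw_mul 0 f' = 0 by have := pbw_mul_vecP (-1) 0 0 f'; rewrite scaler0 addr0 scaleN1r addNr.
rewrite /pbw_comm !z linear0 subrr.
by have := kact_vecP (-1) 0 0 v f; rewrite scaler0 addr0 scaleN1r addNr.
Qed.

Lemma pbw_comm_ext f : (forall i j : 'I_n, (i < j)%N -> pbw_comm e`_j e`_i f) ->
  forall u v, pbw_comm u v f.
Proof.
move=> h; have hb (i j : 'I_n) : pbw_comm e`_i e`_j f.
  case: (ltngtP i j) => [/h/pbw_comm_sym//|/h//|/val_inj->].
  by rewrite /pbw_comm subrr kact_alt.
have sumP u w : (forall i : 'I_n, pbw_comm e`_i w f) -> pbw_comm u w f.
  move=> hi; rewrite (vbasis_sum u).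
  elim/big_ind: _ => [|x y hx hy|i _]; first exact: pbw_comm0.
    by rewrite -[x]scale1r; apply: pbw_comm_vecP.
  by rewrite -[_ *: _]addr0; apply: pbw_comm_vecP => //; apply: pbw_comm0.
by move=> u v; apply: (sumP) => i; apply/pbw_comm_sym/sumP.
Qed.

Lemma pbw_comm_Gop h u v f : pbw_comm u v f -> pbw_comm (rho h u) (rho h v) (Gop h f).
Proof.
by rewrite /pbw_comm => e; rewrite -!pbw_mul_Gop -linearB /= e kact_Gop.
Qed.

(** As h (x) q is h applied to 1 (x) q, [pbw_comm_Gop] reduces the claim to the component 1. *)
Lemma pbw_comm_deg d :
  (forall m u v, (mdeg m < d)%N -> pbw_comm u v (tens 1%g 'X_[m])) ->
  forall f u v, Mdeg d f -> pbw_comm u v f.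
Proof.
move=> hm f u v hf; rewrite (tens_sum f).
have c0 u' v' : pbw_comm u' v' 0 by rewrite /pbw_comm !linear0 addr0.
have cD u' v' x y : pbw_comm u' v' x -> pbw_comm u' v' y -> pbw_comm u' v' (x + y).
  by move=> hx hy; have := pbw_commP 1 hx hy; rewrite scale1r.
have cZ u' v' a x : pbw_comm u' v' x -> pbw_comm u' v' (a *: x).
  by move=> hx; have := pbw_commP a hx (c0 u' v'); rewrite addr0.
apply: (big_ind (pbw_comm u v) (c0 u v) (cD u v)) => h _.
have := hf h; move: (f h) => p hp.
have eh v0 : v0 = rho h (rho h^-1%g v0) by rewrite -rep_mul mulgV rep_one.
rewrite -[h]mulg1 -Gop_tens [u]eh [v]eh.
apply: pbw_comm_Gop; rewrite (mpolyE p) linear_sum big_seq.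
apply: (big_ind (pbw_comm _ _) (c0 _ _) (cD _ _)) => m mp.
have mlt := leq_trans (msize_mdeg_lt mp) hp.
move: (rho h^-1%g u) (rho h^-1%g v) => u' v'; rewrite linearZ /=.
exact/cZ/hm.
Qed.

Lemma pbw_comm_base (i j : 'I_n) m : (i < j)%N -> below i m ->
  pbw_comm e`_j e`_i (tens 1%g 'X_[m]).
Proof.
move=> ij im; rewrite /pbw_comm (pbw_mul_stop im) pbw_mul_step //.
by rewrite addrAC subrr add0r.
Qed.

Lemma pbw_mul_kact w u v f :
  pbw_mul w (kact u v f) - kact u v (pbw_mul w f) =
  \sum_g pbw_mul (kap u v g *: (w - rho g w)) (Gop g f).
Proof.
rewrite /kact linear_sum -sumrB; apply: eq_bigr => g _ /=.
pose L : {linear V -> M} := HB.pack (pbw_mul^~ (Gop g f))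
  (GRing.isLinear.Build k V M *:%R _ (pbw_mul_vec_linear (Gop g f))).
rewrite linearZ /= pbw_mul_Gop -scalerBr -[RHS]/(L _) [RHS]linearZ /=.
by congr (_ *: _); have /= <- := linearB L w (rho g w).
Qed.

(** By [pbw_mul_kact], the g-component of [w, [u, v]] is g followed by multiplication by kap u v g
    (w - g w), so the cyclic sum vanishes by [kap_jacobi]. *)
Lemma pbw_mul_jacobi u v w f :
  (pbw_mul w (kact u v f) - kact u v (pbw_mul w f)) +
  (pbw_mul u (kact v w f) - kact v w (pbw_mul u f)) +
  (pbw_mul v (kact w u f) - kact w u (pbw_mul v f)) = 0.
Proof.
rewrite !pbw_mul_kact -2!big_split big1 // => g _ /=.
pose L : {linear V -> M} := HB.pack (pbw_mul^~ (Gop g f))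
  (GRing.isLinear.Build k V M *:%R _ (pbw_mul_vec_linear (Gop g f))).
rewrite -![pbw_mul _ (Gop g f)]/(L _) -!linearD kap_jacobi; exact: linear0.
Qed.

(** The overlap check of the diamond lemma, by induction on the degree. If m = x_l m' begins with l
    < i < j, both e_i and e_j are moved past e_l; the commutators that arise cancel by the Jacobi
    identity. *)
Theorem pbw_comm_all u v f : pbw_comm u v f.
Proof.
have [d] : exists d, Mdeg d f.
  exists (\max_h msize (f h)) => h; exact: leq_bigmax.
elim/ltn_ind: d f u v => d IHd f u v; apply: pbw_comm_deg => {f u v} m u v md.
elim/ltn_ind: d m md IHd u v => d _ m md IHd u v.
have IH f u' v' : Mdeg (mdeg m) f -> pbw_comm u' v' f by apply: IHd.
apply: pbw_comm_ext => {u v} i j ij.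
have [im|] := boolP (below i m); first exact: pbw_comm_base.
case E: (minidx i m) => [l|]; last by rewrite minidx_none.
move=> _; have [li ml lm] := minidxP E.
have em := mdeg_sub1 ml; have eUm : m = (U_(l) + (m - U_(l)))%MM.
  by rewrite addmC submK // lep1mP.
set m' := (m - U_(l))%MM in em eUm.
have lm' : below l m' by apply: below_sub.
have lj := ltn_trans li ij; set x := tens 1%g 'X_[m'].
(* The product of e_i1 and m' is x_i1 m' plus lower terms: on the former [pbw_comm_base] applies
   since l is minimal, on the latter the induction hypothesis. *)
have comm2 (i1 j1 : 'I_n) : (l < i1)%N -> (l < j1)%N ->
    pbw_comm e`_j1 e`_l (pbw_mul e`_i1 x).
  move=> li1 lj1; rewrite -[pbw_mul _ x](subrK (tens 1%g 'X_[U_(i1) + m'])).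
  rewrite -[_ - _]scale1r; apply: pbw_commP.
    by apply: IH; rewrite em; apply: pbw_mul_lead.
  by apply: pbw_comm_base => //; apply: below_add.
have cx : pbw_comm e`_j e`_i x by apply: IH; apply: Mdeg_top; rewrite em.
have c1 := comm2 i j li lj; have c2 := comm2 j i lj li.
rewrite /pbw_comm eUm !pbw_mul_step // -/x; rewrite /pbw_comm in c1 c2 cx.
have jac := pbw_mul_jacobi e`_j e`_i e`_l x.
rewrite !linearD /=.
have -> : tens 1%g 'X_[U_(l) + m'] = pbw_mul e`_l x by rewrite pbw_mul_stop.
move/eqP: c1; rewrite subr_eq => /eqP->; move/eqP: c2; rewrite subr_eq => /eqP->.
move: jac; rewrite (kact_skew e`_l e`_j) [kact e`_l e`_j (pbw_mul _ _)]kact_skew.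
rewrite linearN /= -cx linearB /=.
move: (pbw_mul e`_l (pbw_mul e`_j (pbw_mul e`_i x))).
move: (pbw_mul e`_l (pbw_mul e`_i (pbw_mul e`_j x))) => a b.
move: (kact e`_j e`_l (pbw_mul e`_i x)) (kact e`_i e`_l (pbw_mul e`_j x)) => c d'.
move: (kact e`_j e`_i (pbw_mul e`_l x)) (pbw_mul e`_j (kact e`_i e`_l x)) => r s.
move: (pbw_mul e`_i (kact e`_j e`_l x)) => t.
move=> h; apply/eqP; rewrite -subr_eq0 -h opprK opprD !addrA.
by apply/eqP; rewrite [RHS](ACl (7*1*4*5*2*6*3)).
Qed.

Lemma pbw_mul_lead_poly d v p : (msize p <= d)%N ->
  Mdeg d (pbw_mul v (tens 1%g p) - tens 1%g (sym_vec v * p)).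
Proof.
move=> hp; pose D u q := pbw_mul u (tens 1%g q) - tens 1%g (sym_vec u * q).
have Dp u a q q' : D u (a *: q + q') = a *: D u q + D u q'.
  by rewrite /D mulrDr -scalerAr !linearP /= scalerBr scalerN addrACA.
have Dv a u u' q : D (a *: u + u') q = a *: D u q + D u' q.
  rewrite /D pbw_mul_vecP (linearP (@sym_vec k V)) mulrDl -scalerAl.
  by rewrite (linearP (tens 1%g : {linear S -> M})) /= scalerBr opprD addrACA.
have DV0 q : D 0 q = 0 by have := Dv (-1) 0 0 q; rewrite scaler0 addr0 scaleN1r addNr.
have D0 u : D u 0 = 0 by have := Dp u (-1) 0 0; rewrite scaler0 addr0 scaleN1r addNr.
rewrite -/(D v p) (mpolyE p) big_seq.
apply: (big_ind (fun q => Mdeg d (D v q))) => [|q q' hq hq'|m mp].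
- by rewrite D0; apply: Mdeg0.
- by rewrite -[q]scale1r Dp scale1r; apply: MdegD.
rewrite -[_ *: _]addr0 Dp D0 addr0; apply: MdegZ; rewrite (vbasis_sum v).
apply: (big_ind (fun u => Mdeg d (D u 'X_[m]))) => [|u u' hu hu'|i _].
- by rewrite DV0; apply: Mdeg0.
- by rewrite -[u]scale1r Dv scale1r; apply: MdegD.
rewrite -[_ *: _]addr0 Dv DV0 addr0; apply: MdegZ.
rewrite /D sym_vec_basis -mpolyXD; apply: Mdeg_le (pbw_mul_lead i m).
exact: leq_trans (msize_mdeg_lt mp) hp.
Qed.

Lemma pbw_mul_lead_tens d v g p : (msize p <= d)%N ->
  Mdeg d (pbw_mul v (tens g p) - tens g (sym_vec (rho g^-1%g v) * p)).
Proof.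
move=> hp; have := pbw_mul_lead_poly (rho g^-1%g v) hp => /(Mdeg_Gop g).
by rewrite linearB /= pbw_mul_Gop !Gop_tens mulg1 -rep_mul mulgV rep_one.
Qed.

End PBW.

(** * The forms omega_s and the action of the smash product *)

Section SympReflKappa.
Variables (gT : finGroupType) (k : fieldType) (V : vectType k).
Variables (rho : linRep gT V) (omega : V -> V -> k).
Hypothesis omegaP : forall a u u' v, omega (a *: u + u') v = a * omega u v + omega u' v.
Hypothesis omega_alt : forall v, omega v v = 0.
Hypothesis omega_skew : forall u v, omega u v = - omega v u.
Hypothesis omega_inv : forall g u v, omega (rho g u) (rho g v) = omega u v.
Hypothesis ord_neq0 : forall s : gT, #[s]%g%:R != 0 :> k.
Implicit Types (s g h : gT) (u v w : V).

Local Notation im s := (im_1sub rho s).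
Local Notation ker s := (ker_1sub rho s).
Local Notation pr s := (daddv_pi (im s) (ker s)).

Lemma omega0l v : omega 0 v = 0.
Proof. by have := omegaP (-1) 0 0 v; rewrite scaler0 addr0 mulN1r addNr. Qed.
Lemma omega0r v : omega v 0 = 0.
Proof. by rewrite omega_skew omega0l oppr0. Qed.
Lemma omegaDl u u' v : omega (u + u') v = omega u v + omega u' v.
Proof. by rewrite -[u in LHS]scale1r omegaP mul1r. Qed.
Lemma omegaZl a u v : omega (a *: u) v = a * omega u v.
Proof. by rewrite -[a *: u]addr0 omegaP omega0l addr0. Qed.
Lemma omegaBl u u' v : omega (u - u') v = omega u v - omega u' v.
Proof. by rewrite omegaDl -scaleN1r omegaZl mulN1r. Qed.
Lemma omegaDr v u u' : omega v (u + u') = omega v u + omega v u'.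
Proof. by rewrite omega_skew omegaDl opprD -!omega_skew. Qed.
Lemma omegaZr a u v : omega u (a *: v) = a * omega u v.
Proof. by rewrite omega_skew omegaZl -mulrN -omega_skew. Qed.
Lemma omega_sumr (I : Type) (r : seq I) (P : pred I) (F : I -> V) v :
  omega v (\sum_(i <- r | P i) F i) = \sum_(i <- r | P i) omega v (F i).
Proof. exact: (big_morph (omega v) (omegaDr v) (omega0r v)). Qed.

Lemma im_ker_direct s : (im s :&: ker s = 0)%VS.
Proof. exact: im_ker_1sub. Qed.

Lemma im_ker_full s : (im s + ker s = fullv)%VS.
Proof.
apply/eqP; rewrite eqEdim subvf dimv_disjoint_sum; last exact: im_ker_direct.
have := limg_ker_dim (\1 - rho s)%VF fullv.
by rewrite capfv addnC /im_1sub /ker_1sub => ->; rewrite leqnn.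
Qed.

Lemma sub1E s v : (\1 - rho s)%VF v = v - rho s v.
Proof. by rewrite !(add_lfunE, opp_lfunE, id_lfunE). Qed.

Lemma mem_im s v : v - rho s v \in im s.
Proof. by rewrite -sub1E memv_img ?memvf. Qed.

Lemma im_mem s x : x \in im s -> exists v, x = v - rho s v.
Proof. by case/memv_imgP=> v _ ->; exists v; rewrite sub1E. Qed.

Lemma mem_ker s v : (v \in ker s) = (rho s v == v).
Proof. by rewrite memv_ker sub1E subr_eq0 eq_sym. Qed.

Lemma pr_im s v : pr s v \in im s.
Proof. exact: memv_pi. Qed.

Lemma pr_ker s v : v - pr s v \in ker s.
Proof.
have vf : v \in (im s + ker s)%VS by rewrite im_ker_full memvf.
have := daddv_pi_add (im_ker_direct s) vf => {1}<-.
by rewrite addrAC subrr add0r memv_pi.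
Qed.

Lemma pr_unique s a b : a \in im s -> b \in ker s -> pr s (a + b) = a.
Proof.
move=> ai bk; apply/eqP; rewrite -subr_eq0 -memv0 -(im_ker_direct s) memv_cap.
rewrite memvB ?pr_im //=.
have -> : pr s (a + b) - a = b - (a + b - pr s (a + b)).
  by rewrite opprB addrCA opprD [b + _]addrCA subrr addr0.
by rewrite memvB ?pr_ker.
Qed.

Lemma pr_sub s v : pr s v - rho s (pr s v) = v - rho s v.
Proof.
have := pr_ker s v; rewrite mem_ker linearB /= => /eqP h.
have -> : rho s v = v - pr s v + rho s (pr s v) by rewrite -h subrK.
by rewrite opprD opprB addrA [v + _]addrC subrK.
Qed.

Lemma im_conj g s x : x \in im s -> rho g x \in im (g * s * g^-1)%g.
Proof.
case/im_mem=> v ->; have -> : rho g (v - rho s v) = rho g v - rho (g * s * g^-1)%g (rho g v).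
  by rewrite linearB /= -!rep_mul mulgKV.
exact: mem_im.
Qed.

Lemma ker_conj g s x : x \in ker s -> rho g x \in ker (g * s * g^-1)%g.
Proof. by rewrite !mem_ker -rep_mul mulgKV rep_mul => /eqP->. Qed.

Lemma pr_conj g s v : pr (g * s * g^-1)%g (rho g v) = rho g (pr s v).
Proof.
have -> : rho g v = rho g (pr s v) + rho g (v - pr s v) by rewrite -linearD addrCA subrr addr0.
by rewrite pr_unique ?im_conj ?pr_im ?ker_conj ?pr_ker.
Qed.

Lemma omega_s_conj g s u v :
  omega_s rho omega (g * s * g^-1)%g (rho g u) (rho g v) = omega_s rho omega s u v.
Proof. by rewrite /omega_s (pr_conj g s u) (pr_conj g s v) omega_inv. Qed.

Lemma dim_im_conj g s : \dim (im (g * s * g^-1)%g) = \dim (im s).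
Proof.
have le g' s' : (\dim (im s') <= \dim (im (g' * s' * g'^-1)%g))%N.
  have <- : \dim (rho g' @: im s') = \dim (im s').
    apply: limg_dim_eq; apply/eqP; rewrite -subv0; apply/subvP => x.
    rewrite memv_cap memv_ker memv0 => /andP[_ /eqP x0].
    by rewrite -(rep_one rho x) -(mulVg g') rep_mul x0 linear0.
  by apply: dimvS; apply/subvP => _ /memv_imgP[x xi ->]; apply: im_conj.
apply/eqP; rewrite eqn_leq le andbT.
by have := le g^-1%g (g * s * g^-1)%g; rewrite invgK !mulgA mulVg mul1g mulgKV.
Qed.

Lemma symp_refl_conj g s : symp_refl rho (g * s * g^-1)%g = symp_refl rho s.
Proof. by rewrite /symp_refl /= dim_im_conj. Qed.

Lemma symp_refl1 : symp_refl rho 1%g = false.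
Proof.
apply/negbTE; rewrite /symp_refl /= (_ : im 1%g = 0%VS) ?dimv0 //.
apply/eqP; rewrite -subv0; apply/subvP=> x /im_mem[v ->].
by rewrite rep_one subrr mem0v.
Qed.

(** The left-hand side is trilinear and alternating, so it vanishes on a plane. *)
Lemma omega_dim2 (W : {vspace V}) u v w : \dim W = 2%N ->
  u \in W -> v \in W -> w \in W ->
  omega u v *: w + omega v w *: u + omega w u *: v = 0.
Proof.
move=> dW uW vW wW.
have [x [y W2]] : exists x y, forall z, z \in W -> exists a b, z = a *: x + b *: y.
  have := fun z => @coord_vbasis _ _ z W; move: (vbasis W); rewrite dW => X hX.
  exists X`_0, X`_1 => z /hX ->; rewrite !big_ord_recl big_ord0 addr0.
  by do 2 eexists.
have [[a [a' ->]] [b [b' ->]] [d [d' ->]]] := And3 (W2 u uW) (W2 v vW) (W2 w wW).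
rewrite !omegaDl !omegaZl !omegaDr !omegaZr !omega_alt (omega_skew y x).
rewrite !scalerDr !scalerA; move: (omega x y) => o.
rewrite !(mulr0, add0r, addr0).
rewrite (_ : _ + _ = ((a * (b' * o) + a' * (b * - o)) * d + (b * (d' * o) + b' * (d * - o)) * a +
   (d * (a' * o) + d' * (a * - o)) * b) *: x + ((a * (b' * o) + a' * (b * - o)) * d' + (b * (d' * o) + b' * (d * - o)) * a' +
   (d * (a' * o) + d' * (a * - o)) * b') *: y); last first.
  by rewrite !scalerDl !addrA [LHS](ACl (1*3*5*2*4*6)).
rewrite [X in X *: x](_ : _ = 0) ?[X in X *: y](_ : _ = 0) ?scale0r ?addr0 //; ring.
Qed.

Variables (t : k) (c : gT -> k).
Hypothesis c_inv : forall s g : gT, s \in symp_refl rho -> c (s ^ g)%g = c s.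

(** The coefficient of g in the right-hand side of the defining relation for [u, v]. *)
Definition kappa u v g : k := (if g == 1%g then t * omega u v else 0) +
  (if symp_refl rho g then c g * omega_s rho omega g u v else 0).

Lemma kappa1 u v : kappa u v 1%g = t * omega u v.
Proof. by rewrite /kappa eqxx symp_refl1 addr0. Qed.

Lemma kappaP g a u u' v : kappa (a *: u + u') v g = a * kappa u v g + kappa u' v g.
Proof.
rewrite /kappa /omega_s linearP !omegaP.
by case: eqP => _; case: ifP => _; ring.
Qed.

Lemma kappa_alt g v : kappa v v g = 0.
Proof. by rewrite /kappa /omega_s !omega_alt !mulr0; do 2 case: ifP => _; rewrite addr0. Qed.

Lemma kappa_skew g u v : kappa u v g = - kappa v u g.
Proof.
rewrite /kappa /omega_s (omega_skew u) (omega_skew (pr g u)) !mulrN opprD.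
by do 2 case: ifP => _; rewrite ?oppr0.
Qed.

Lemma kappa_conj g h u v : kappa (rho h u) (rho h v) (h * g * h^-1)%g = kappa u v g.
Proof.
rewrite /kappa omega_inv omega_s_conj symp_refl_conj.
have -> : (h * g * h^-1)%g = (g ^ h^-1)%g by rewrite conjgE invgK mulgA.
by rewrite conjg_eq1; congr (_ + _); case: ifP => // sg; rewrite c_inv.
Qed.

(** Both omega_g and 1 - g factor through the projection to Im(1 - g), a plane when g is a
    symplectic reflection; [omega_dim2] applies there. *)
Lemma kappa_jacobi g u v w :
  kappa u v g *: (w - rho g w) + kappa v w g *: (u - rho g u) +
  kappa w u g *: (v - rho g v) = 0.
Proof.
rewrite -(pr_sub g u) -(pr_sub g v) -(pr_sub g w) -!sub1E.
have E a b d x y z : a *: (\1 - rho g)%VF x + b *: (\1 - rho g)%VF y +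
    d *: (\1 - rho g)%VF z = (\1 - rho g)%VF (a *: x + b *: y + d *: z).
  by rewrite !linearD !linearZ.
rewrite E; have [->|g1] := eqVneq g 1%g.
  by rewrite sub1E rep_one subrr.
rewrite /kappa (negPf g1) !add0r.
case: ifP => [sg|_]; last by rewrite !scale0r !addr0 linear0.
rewrite -!scalerA -!scalerDr (omega_dim2 (W := im g)) ?pr_im //; last exact/eqP.
by rewrite scaler0 linear0.
Qed.

Hypothesis rho_inj : injective rho.
Hypothesis omega_nondeg : forall u, (forall v, omega u v = 0) -> u = 0.

(** As g is an isometry, Im(1 - g) is orthogonal to Ker(1 - g). If it lay in a line, it would be
    orthogonal to itself too, hence to V; then 1 - g = 0, and g = 1 by faithfulness. *)
Lemma rank_1sub_ge2 g (a : V) : g != 1%g -> exists v, v - rho g v \notin <[a]>%VS.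
Proof.
move=> g1; apply: contrapT => /forallNP h.
have him x : x \in im g -> x \in <[a]>%VS.
  by case/im_mem=> v ->; have /negP := h v; rewrite negbK.
have im0 x : x \in im g -> x = 0.
  move=> xi; apply: omega_nondeg => y.
  rewrite -[y](subrK (pr g y)) omegaDr.
  have -> : omega x (pr g y) = 0.
    have /vlineP[b ->] := him _ xi; have /vlineP[b' ->] := him _ (pr_im g y).
    by rewrite omegaZl omegaZr omega_alt !mulr0.
  have yk : rho g (y - pr g y) = y - pr g y by apply/eqP; rewrite -mem_ker pr_ker.
  have [v ->] := im_mem xi.
  by rewrite addr0 omegaBl -[in X in _ - X]yk omega_inv subrr.
case/eqP: g1; apply: rho_inj; rewrite rep1; apply/lfunP => v.
by apply/eqP; rewrite id_lfunE -subr_eq0 -oppr_eq0 opprB; apply/eqP/im0/mem_im.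
Qed.

End SympReflKappa.

(** * The smash product as an algebra of operators *)

Section TensorWords.
Variables (k : fieldType) (V : vectType k).
Notation n := (\dim {:V}).

Lemma tensor_word_sum (x : tensor V) : x = \sum_(w <- monalg.msupp x)
  pzscal (monalg.mcoeff w x) * \prod_(i <- (w : seq 'I_n)) (<< fmu i >> : tensor V).
Proof.
have word (w : {fmonom 'I_n}) :
    << w >> = \prod_(i <- (w : seq 'I_n)) (<< fmu i >> : tensor V) :> tensor V.
  case: w => s; elim: s => [|i s IHs] /=; first by rewrite big_nil -fmoneE.
  rewrite big_cons -IHs.
  have -> : FMonom (i :: s) = mmul (fmu i) (FMonom s).
    by apply/val_inj; rewrite /= fmM fmU.
  by rewrite [RHS]fgmulUU mulr1.
rewrite [LHS]monalgE; apply: eq_bigr => w _; rewrite -word.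
by rewrite [RHS]fgmulUU mul1m mulr1.
Qed.

Lemma tensor_ind (P : tensor V -> Prop) :
  P 0 -> (forall x y, P x -> P y -> P (x + y)) ->
  (forall a (l : seq 'I_n), P (pzscal a * \prod_(i <- l) (<< fmu i >> : tensor V))) ->
  forall x, P x.
Proof.
move=> P0 PD Pw x; rewrite (tensor_word_sum x).
by apply: (big_ind P P0 PD) => w _; apply: Pw.
Qed.

End TensorWords.

Section PBWAction.
Variables (k : fieldType) (V : vectType k) (gT : finGroupType).
Variables (rho : linRep gT V) (kap : V -> V -> gT -> k).
Notation n := (\dim {:V}).
Notation M := {ffun gT -> mpoly n k}.
Notation TG := (smash (tensor_action rho)).

Lemma endo_nonzero : (1 : endo M) != 0.
Proof.
apply/eqP => /(congr1 (fun f : endo M => f (tens 1%g (1 : mpoly n k)) 1%g)).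
rewrite endo_oneE endo_zeroE !ffunE eqxx => /eqP; exact/negP/oner_neq0.
Qed.
HB.instance Definition _ := GRing.PzSemiRing_isNonZero.Build (endo M) endo_nonzero.

Fact scal_endo_subproof (a : k) : zmod_morphism (fun f : M => a *: f).
Proof. by move=> f f'; rewrite scalerBr. Qed.
Definition scal_endo (a : k) : endo M := Endo (scal_endo_subproof a).

Fact scal_endo_zmod : zmod_morphism scal_endo.
Proof. by move=> a b; apply: endoP => f; rewrite endo_subE /= scalerBl. Qed.
Fact scal_endo_monoid : monoid_morphism scal_endo.
Proof.
split=> [|a b]; apply: endoP => f; first by rewrite /= scale1r.
by rewrite endo_mulE /= scalerA.
Qed.
HB.instance Definition _ :=
  GRing.isZmodMorphism.Build k (endo M) scal_endo scal_endo_zmod.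
HB.instance Definition _ :=
  GRing.isMonoidMorphism.Build k (endo M) scal_endo scal_endo_monoid.

Definition mul_endo (v : V) : endo M := Endo (raddfB (pbw_mul rho kap v)).
Definition grp_endo (g : gT) : endo M := Endo (raddfB (Gop g : M -> M)).

Lemma scal_endoC_mul a v : scal_endo a * mul_endo v = mul_endo v * scal_endo a.
Proof. by apply: endoP => f; rewrite !endo_mulE /= linearZ. Qed.
Lemma scal_endoC_grp a g : scal_endo a * grp_endo g = grp_endo g * scal_endo a.
Proof. by apply: endoP => f; rewrite !endo_mulE /= linearZ. Qed.
Lemma grp_endo1 : grp_endo 1%g = 1.
Proof. by apply: endoP => f; rewrite /= Gop1. Qed.
Lemma grp_endoM g h : grp_endo (g * h)%g = grp_endo g * grp_endo h.
Proof. by apply: endoP => f; rewrite endo_mulE /= GopM. Qed.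

Definition word_endo (w : {fmonom 'I_n}) : endo M :=
  \prod_(i <- (w : seq 'I_n)) mul_endo (vbasis {:V})`_i.

Fact word_endo_mmorph : mmorphism word_endo.
Proof.
split=> [v w|]; rewrite /word_endo; first by rewrite fmM big_cat.
by rewrite fm1 big_nil.
Qed.
HB.instance Definition _ :=
  monalg.isMultiplicative.Build _ _ word_endo word_endo_mmorph.

Definition tensor_endo : tensor V -> endo M := monalg.mmap scal_endo word_endo.

Fact tensor_endo_zmod : zmod_morphism tensor_endo.
Proof. exact: monalg.mmap_is_additive. Qed.

Lemma scal_endoC_word a w : scal_endo a * word_endo w = word_endo w * scal_endo a.
Proof.
rewrite /word_endo; elim: (w : seq _) => [|i l IHl]; first by rewrite big_nil mulr1 mul1r.
by rewrite big_cons mulrA scal_endoC_mul -[LHS]mulrA IHl mulrA.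
Qed.

Fact tensor_endo_monoid : monoid_morphism tensor_endo.
Proof.
have C : forall (g : {malg k[{fmonom 'I_n}]}) m m',
    GRing.comm (scal_endo (monalg.mcoeff m g)) (word_endo m').
  by move=> g m m'; apply: scal_endoC_word.
have [hM h1] := monalg.commr_mmap_is_multiplicative C.
by split; [apply: h1|apply: hM].
Qed.
HB.instance Definition _ :=
  GRing.isZmodMorphism.Build (tensor V) (endo M) tensor_endo tensor_endo_zmod.
HB.instance Definition _ :=
  GRing.isMonoidMorphism.Build (tensor V) (endo M) tensor_endo tensor_endo_monoid.

Lemma tensor_endo_scal a : tensor_endo (pzscal a) = scal_endo a.
Proof.
have -> : tensor_endo (pzscal a) = scal_endo a * word_endo mone by exact: monalg.mmapU.
by rewrite (word_endo_mmorph).2 mulr1.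
Qed.

Lemma tensor_endo_gen i : tensor_endo << fmu i >> = mul_endo (vbasis {:V})`_i.
Proof.
have -> : tensor_endo << fmu i >> = scal_endo 1 * word_endo (fmu i) by exact: monalg.mmapU.
by rewrite scal_endo_monoid.1 mul1r /word_endo fmU big_seq1.
Qed.

Lemma mul_endo_sum v :
  mul_endo v = \sum_(i < n) scal_endo (coord (vbasis {:V}) i v) * mul_endo (vbasis {:V})`_i.
Proof.
apply: endoP => f; rewrite endo_sumE {1}(vbasis_sum v) /=.
pose L : {linear V -> M} := HB.pack ((pbw_mul rho kap)^~ f)
  (GRing.isLinear.Build k V M *:%R _ (@pbw_mul_vec_linear _ _ _ rho kap f)).
rewrite -[LHS]/(L _) linear_sum; apply: eq_bigr => i _.
by rewrite linearZ.
Qed.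

Lemma tensor_endo_vec v : tensor_endo (tensor_vec v) = mul_endo v.
Proof.
rewrite mul_endo_sum /tensor_vec raddf_sum; apply: eq_bigr => i _ /=.
by rewrite -tensor_scalZ rmorphM /= [tensor_endo (tensor_scal V _)]tensor_endo_scal tensor_endo_gen.
Qed.

Lemma grp_endo_mul g v : grp_endo g * mul_endo v = mul_endo (rho g v) * grp_endo g.
Proof. by apply: endoP => f; rewrite !endo_mulE /= pbw_mul_Gop. Qed.

Lemma grp_endo_tensor g x :
  grp_endo g * tensor_endo x = tensor_endo (tensor_map (rho g) x) * grp_endo g.
Proof.
elim/tensor_ind: x => [|x y hx hy|a l].
- by rewrite !raddf0 mulr0 mul0r.
- by rewrite !raddfD /= mulrDr mulrDl hx hy.
rewrite !rmorphM /= tensor_map_scal tensor_endo_scal mulrA -scal_endoC_grp -!mulrA.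
congr (_ * _); elim: l => [|i l IHl]; first by rewrite big_nil !rmorph1 mulr1 mul1r.
rewrite big_cons !rmorphM /= tensor_endo_gen tensor_map_gen tensor_endo_vec mulrA.
by rewrite grp_endo_mul -[LHS]mulrA IHl mulrA.
Qed.

Definition smash_endo (x : TG) : endo M := \sum_g tensor_endo (x g) * grp_endo g.

Fact smash_endo_zmod : zmod_morphism smash_endo.
Proof.
move=> x y; rewrite /smash_endo -sumrB; apply: eq_bigr => g _.
by rewrite !ffunE raddfB mulrBl.
Qed.

Lemma smash_endo_elt a g : smash_endo (smash_elt (tensor_action rho) a g) =
  tensor_endo a * grp_endo g.
Proof.
rewrite /smash_endo (bigD1 g) //= ffunE eqxx big1 ?addr0 // => h /negPf hg.
by rewrite ffunE hg raddf0 mul0r.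
Qed.

Fact smash_endo_monoid : monoid_morphism smash_endo.
Proof.
split=> [|x y].
  by rewrite [smash_endo 1]smash_endo_elt grp_endo1 rmorph1 mulr1.
rewrite /smash_endo mulr_suml.
transitivity (\sum_n \sum_h
    tensor_endo (x h) * grp_endo h * (tensor_endo (y (h^-1 * n)%g) * grp_endo (h^-1 * n)%g)).
  apply: eq_bigr => m _; rewrite ffunE raddf_sum /= mulr_suml; apply: eq_bigr => h _.
  rewrite rmorphM /= -!mulrA; congr (_ * _).
  by rewrite [RHS]mulrA grp_endo_tensor -[RHS]mulrA -grp_endoM mulKVg.
rewrite exchange_big; apply: eq_bigr => h _ /=.
by rewrite -mulr_sumr (reindex_inj (mulgI h)); under eq_bigr do rewrite mulKg.
Qed.
HB.instance Definition _ :=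
  GRing.isZmodMorphism.Build TG (endo M) smash_endo smash_endo_zmod.
HB.instance Definition _ :=
  GRing.isMonoidMorphism.Build TG (endo M) smash_endo smash_endo_monoid.

Lemma smash_endo_scal a : smash_endo (pzscal a) = scal_endo a.
Proof. by rewrite [LHS]smash_endo_elt tensor_endo_scal grp_endo1 mulr1. Qed.

End PBWAction.

(** * The symplectic reflection algebra *)

Section PzAlgTheory.
Variables (k : comNzRingType) (B : pzAlgType k).

Lemma pzscal0 : pzscal 0 = 0 :> B.
Proof. by rewrite -(subrr 0) pzscal_zmod subrr. Qed.
Lemma pzscal1 : pzscal 1 = 1 :> B.
Proof. exact: (pzscal_monoid (s := B)).1. Qed.
Lemma pzscalM (r r' : k) : pzscal (r * r') = pzscal r * pzscal r' :> B.
Proof. exact: (pzscal_monoid (s := B)).2. Qed.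
Lemma pzscalN (r : k) : pzscal (- r) = - pzscal r :> B.
Proof. by rewrite -sub0r pzscal_zmod pzscal0 sub0r. Qed.
Lemma pzscalD (r r' : k) : pzscal (r + r') = pzscal r + pzscal r' :> B.
Proof. by rewrite -[r' in LHS]opprK pzscal_zmod pzscalN opprK. Qed.
Lemma pzscal_nat (m : nat) : pzscal m%:R = m%:R :> B.
Proof. by elim: m => [|m IH]; rewrite ?pzscal0 // !mulrS pzscalD pzscal1 IH. Qed.

End PzAlgTheory.

Lemma sum_split_if (U : zmodType) (I : finType) (P : pred I) i0 (F G : I -> U) :
  \sum_i ((if i == i0 then F i else 0) + (if P i then G i else 0)) =
  F i0 + \sum_(i | P i) G i.
Proof. by rewrite big_split /= -!big_mkcond big_pred1_eq. Qed.

Lemma commutator_morph (R R' : pzRingType) (phi : R -> R') x y :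
  zmod_morphism phi -> {morph phi : u v / u * v} ->
  phi x * phi y - phi y * phi x = phi (x * y - y * x).
Proof. by move=> phiB phiM; rewrite phiB !phiM. Qed.

Lemma sumM_morph (R R' : pzRingType) (phi : R -> R') (I : finType) (P : pred I)
    (F G : I -> R) :
  {morph phi : u v / u + v} -> phi 0 = 0 -> {morph phi : u v / u * v} ->
  phi (\sum_(i | P i) F i * G i) = \sum_(i | P i) phi (F i) * phi (G i).
Proof.
by move=> phiD phi0 phiM; rewrite (big_morph phi phiD phi0); apply: eq_bigr.
Qed.

Lemma commutator_rel_morph (R R' : pzRingType) (phi : R -> R') (I : finType) (P : pred I)
    (X Y Z : R) (F G : I -> R) x y z f g :
  zmod_morphism phi -> {morph phi : u v / u * v} ->
  phi X = x -> phi Y = y -> phi Z = z ->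
  (forall i, phi (F i) = f i) -> (forall i, phi (G i) = g i) ->
  phi (X * Y - Y * X - (Z + \sum_(i | P i) F i * G i)) =
  x * y - y * x - (z + \sum_(i | P i) f i * g i).
Proof.
move=> phiB phiM <- <- <- eF eG; rewrite !phiB !phiM; congr (_ - _).
have phi0 : phi 0 = 0 by rewrite -(subrr 0) phiB subrr.
have phiD u v : phi (u + v) = phi u + phi v.
  by rewrite -[v in LHS]opprK phiB -[- v]sub0r phiB phi0 sub0r opprK.
rewrite phiD (big_morph phi phiD phi0); congr (_ + _).
by apply: eq_bigr => i _; rewrite phiM eF eG.
Qed.

Lemma smash_elt_scalM (gT : finGroupType) (k : comNzRingType) (B : pzAlgType k)
    (act : algAction gT B) r b g :
  smash_elt act (pzscal r * b) g = pzscal r * smash_elt act b g.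
Proof. by rewrite [RHS]smash_eltM alg_act1 mul1g. Qed.

Lemma smash_eltD (gT : finGroupType) (k : comNzRingType) (B : pzAlgType k)
    (act : algAction gT B) b b' g :
  smash_elt act (b + b') g = smash_elt act b g + smash_elt act b' g.
Proof. by apply/ffunP=> h; rewrite !ffunE; case: eqP => _; rewrite ?addr0. Qed.

Section SymplecticReflectionAlgebra.
Variables (gT : finGroupType) (k : fieldType) (V : vectType k).
Variables (rho : linRep gT V) (omega : V -> V -> k).
Hypothesis omegaP : forall a u u' v, omega (a *: u + u') v = a * omega u v + omega u' v.
Hypothesis omega_alt : forall v, omega v v = 0.
Hypothesis omega_skew : forall u v, omega u v = - omega v u.
Hypothesis omega_inv : forall g u v, omega (rho g u) (rho g v) = omega u v.
Hypothesis ord_neq0 : forall s : gT, #[s]%g%:R != 0 :> k.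
Variables (t : k) (c : gT -> k).
Hypothesis c_inv : forall s g : gT, s \in symp_refl rho -> c (s ^ g)%g = c s.
Notation n := (\dim {:V}).
Notation e := (vbasis {:V}).
Notation S := (mpoly n k).
Notation M := {ffun gT -> mpoly n k}.
Notation TG := (smash (tensor_action rho)).
Notation kap := (kappa rho omega t c).
Notation A := (sra rho omega t c).
Notation sact g := (sym_map (rho g)).
Implicit Types (a b z : A) (f : M) (p q : S) (u v w : V) (g h x : gT) (l : seq 'I_n).

Lemma kact_kappa u v f : kact kap u v f = (t * omega u v) *: f +
  \sum_(s | symp_refl rho s) (c s * omega_s rho omega s u v) *: Gop s f.
Proof.
have kE g : kap u v g *: Gop g f = (if g == 1%g then (t * omega u v) *: Gop g f else 0) +
    (if symp_refl rho g then (c g * omega_s rho omega g u v) *: Gop g f else 0).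
  by rewrite /kappa scalerDl; do 2 case: ifP => _; rewrite ?scale0r.
rewrite /kact; under eq_bigr do rewrite kE.
by rewrite big_split /= -!big_mkcond big_pred1_eq Gop1.
Qed.

Notation qpi := (quot_pi (sra_ideal rho omega t c)).

Fact sra_key : unit. Proof. by []. Qed.
Definition sra_pi : TG -> A := locked_with sra_key qpi.
Lemma sra_piE y : sra_pi y = qpi y.
Proof. by rewrite /sra_pi unlock. Qed.
Lemma sra_piM y y' : sra_pi (y * y') = sra_pi y * sra_pi y'.
Proof. by rewrite /sra_pi unlock; apply: quot_piM. Qed.
Lemma sra_piD y y' : sra_pi (y + y') = sra_pi y + sra_pi y'.
Proof. by rewrite /sra_pi unlock; apply: quot_piD. Qed.
Lemma sra_piB y y' : sra_pi (y - y') = sra_pi y - sra_pi y'.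
Proof. by rewrite /sra_pi unlock; apply: quot_pi_zmod. Qed.
Lemma sra_pi_comm y y' : sra_pi y * sra_pi y' - sra_pi y' * sra_pi y = sra_pi (y * y' - y' * y).
Proof. exact: (commutator_morph _ _ sra_piB sra_piM). Qed.
Lemma sra_pi_scal r : sra_pi (pzscal r) = pzscal r.
Proof. by rewrite sra_piE. Qed.
Lemma sra_piP r y y' : sra_pi (pzscal r * y + y') = pzscal r * sra_pi y + sra_pi y'.
Proof. by rewrite sra_piD sra_piM sra_pi_scal. Qed.
Lemma sra_pi0 : sra_pi 0 = 0.
Proof. by rewrite -(subrr (0 : TG)) sra_piB subrr. Qed.
Lemma sra_pi_sum (I : finType) (P : pred I) (F G : I -> TG) :
  sra_pi (\sum_(i | P i) F i * G i) = \sum_(i | P i) sra_pi (F i) * sra_pi (G i).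
Proof. exact: (sumM_morph _ _ _ sra_piD sra_pi0 sra_piM). Qed.
Lemma sra_pi_surj a : exists y, a = sra_pi y.
Proof. by have [y ->] := quot_pi_surj a; exists y; rewrite sra_piE. Qed.

(** [pbw_comm_all] is the defining relation, read as an identity of operators. *)
Lemma smash_endo_rel (y : TG) : sra_rel omega t c y -> smash_endo kap y = 0.
Proof.
case=> [u [v ->]]; have ev w : smash_endo kap (smash_vec rho w) = mul_endo rho kap w.
  by rewrite [LHS]smash_endo_elt tensor_endo_vec grp_endo1 mulr1.
have eg g : smash_endo kap (smash_grp rho g) = grp_endo V g.
  by rewrite [LHS]smash_endo_elt rmorph1 mul1r.
have es r : smash_endo kap (pzscal r : TG) = scal_endo V gT r by apply: smash_endo_scal.
have eM := (smash_endo_monoid rho kap).2; have eB := @smash_endo_zmod _ _ _ rho kap.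
pose cs s := c s * omega_s rho omega s u v.
have := @commutator_rel_morph TG (endo M) (smash_endo kap) gT (symp_refl rho) _ _ _
  (fun s => pzscal (cs s)) (smash_grp rho) _ _ _ (fun s => scal_endo V gT (cs s)) (@grp_endo k V gT)
  eB eM (ev u) (ev v) (es (t * omega u v)) (fun s => es (cs s)) eg.
move=> ->.
apply: endoP => f; rewrite !endo_subE !endo_mulE endo_addE endo_sumE endo_zeroE /=.
have -> := pbw_comm_all (kappaP rho omegaP t c) (kappa_alt rho omega_alt t c)
  (kappa_skew rho omega_skew t c) (kappa_conj omega_inv ord_neq0 t c_inv)
  (kappa_jacobi rho omegaP omega_alt omega_skew ord_neq0 t c) u v f.
apply/eqP; rewrite subr_eq0; apply/eqP; rewrite kact_kappa.
by congr (_ + _); apply: eq_bigr => s _; rewrite endo_mulE.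
Qed.

Lemma smash_endo_ideal (y : TG) : y \in (sra_ideal rho omega t c : {pred TG}) ->
  smash_endo kap y = 0.
Proof.
have eM := (smash_endo_monoid rho kap).2.
move=> /asboolP[s [hs ->]]; rewrite raddf_sum big_seq big1 //= => w ws.
rewrite !eM [X in _ * X * _](_ : _ = 0) ?mulr0 ?mul0r //.
exact/smash_endo_rel/hs.
Qed.

(** Evaluated at a chosen representative; the choice does not matter, by [smash_endo_ideal]. *)
Definition sra_act : A -> endo M :=
  locked_with sra_key (fun a => smash_endo kap (repr (a : Quotient.quot (sra_ideal rho omega t c)))).

Lemma sra_act_pi (y : TG) : sra_act (sra_pi y) = smash_endo kap y.
Proof.
rewrite sra_piE /sra_act unlock; apply/eqP; rewrite -subr_eq0; apply/eqP.
rewrite -(@smash_endo_zmod _ _ _ rho kap); exact/smash_endo_ideal/repr_quot.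
Qed.

Fact sra_act_zmod : zmod_morphism sra_act.
Proof.
move=> a b; have [y ->] := sra_pi_surj a; have [z ->] := sra_pi_surj b.
by rewrite -sra_piB !sra_act_pi; apply: smash_endo_zmod.
Qed.
Fact sra_act_monoid : monoid_morphism sra_act.
Proof.
split=> [|a b].
  have -> : (1 : A) = sra_pi 1 by rewrite sra_piE.
  by rewrite sra_act_pi; have [] := smash_endo_monoid rho kap.
have [y ->] := sra_pi_surj a; have [z ->] := sra_pi_surj b.
by rewrite -sra_piM !sra_act_pi; have [_ ->] := smash_endo_monoid rho kap.
Qed.
HB.instance Definition _ := GRing.isZmodMorphism.Build A (endo M) sra_act sra_act_zmod.
HB.instance Definition _ := GRing.isMonoidMorphism.Build A (endo M) sra_act sra_act_monoid.

Definition sra_vec : V -> A := locked_with sra_key (fun v => sra_pi (smash_vec rho v)).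
Definition sra_grp : gT -> A := locked_with sra_key (fun g => sra_pi (smash_grp rho g)).

Lemma sra_vecE v : sra_vec v = sra_pi (smash_vec rho v). Proof. by rewrite /sra_vec unlock. Qed.
Lemma sra_grpE g : sra_grp g = sra_pi (smash_grp rho g). Proof. by rewrite /sra_grp unlock. Qed.

Lemma sra_vecP r u v : sra_vec (r *: u + v) = pzscal r * sra_vec u + sra_vec v.
Proof.
rewrite !sra_vecE; apply: etrans (sra_piP r _ _); congr (sra_pi _).
rewrite /smash_vec -smash_elt_scalM -smash_eltD; congr (smash_elt _ _ _).
transitivity (r *: (tensor_vec u : tensor V) + tensor_vec v).
  exact: tensor_vec_linear.
by congr (_ + _); symmetry; apply: tensor_scalZ.
Qed.

Lemma sra_grp1 : sra_grp 1%g = 1.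
Proof. by rewrite sra_grpE sra_piE. Qed.
Lemma sra_grpM g h : sra_grp (g * h)%g = sra_grp g * sra_grp h.
Proof.
by rewrite !sra_grpE -sra_piM smash_eltM mul1r (alg_act_monoid (tensor_action rho) g).1.
Qed.
Lemma sra_grp_vec g v : sra_grp g * sra_vec v = sra_vec (rho g v) * sra_grp g.
Proof.
rewrite sra_grpE (sra_vecE v) (sra_vecE (rho g v)).
apply: (etrans (esym (sra_piM _ _))); apply: etrans (sra_piM _ _).
apply: (congr1 sra_pi).
apply: (etrans (smash_eltM _ _ _ _ _)); symmetry.
apply: (etrans (smash_eltM _ _ _ _ _)); rewrite mul1g mulg1 alg_act1 mulr1 mul1r.
by congr (smash_elt _ _ _); symmetry; apply: tensor_map_vec.
Qed.

Lemma sra_commE u v : sra_vec u * sra_vec v - sra_vec v * sra_vec u = \sum_g pzscal (kap u v g) * sra_grp g.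
Proof.
pose y : TG := pzscal (t * omega u v) +
  \sum_(s | symp_refl rho s) pzscal (c s * omega_s rho omega s u v) * smash_grp rho s.
have -> : sra_vec u * sra_vec v - sra_vec v * sra_vec u = sra_pi y.
  rewrite (sra_vecE u) (sra_vecE v); apply: (etrans (sra_pi_comm _ _)); rewrite !sra_piE; apply/quot_piP.
  apply/asboolP; exists [:: (1, smash_vec rho u * smash_vec rho v
    - smash_vec rho v * smash_vec rho u - y, 1)].
  split=> [z|]; first by rewrite inE => /eqP->; exists u, v.
  by rewrite big_seq1 mul1r mulr1.
have -> : sra_pi y = pzscal (t * omega u v) +
    \sum_(s | symp_refl rho s) pzscal (c s * omega_s rho omega s u v) * sra_grp s.
  apply: (etrans (sra_piD _ _)); congr (_ + _); first exact: sra_pi_scal.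
  apply: (etrans (sra_pi_sum _ _ _)); apply: eq_bigr => s _.
  by rewrite sra_grpE; congr (_ * _); apply: sra_pi_scal.
have kE g : pzscal (kap u v g) * sra_grp g =
    (if g == 1%g then pzscal (t * omega u v) * sra_grp g else 0) +
    (if symp_refl rho g then pzscal (c g * omega_s rho omega g u v) * sra_grp g else 0).
  by rewrite /kappa pzscalD mulrDl; do 2 case: ifP => _; rewrite ?pzscal0 ?mul0r.
rewrite [RHS](eq_bigr _ (fun g _ => kE g)).
apply: etrans (esym (sum_split_if _ _ _ _)).
by apply: (congr1 (+%R^~ _)); rewrite sra_grp1 mulr1.
Qed.

Lemma sra_act_vec v : sra_act (sra_vec v) = mul_endo rho kap v.
Proof. by rewrite sra_vecE sra_act_pi smash_endo_elt tensor_endo_vec grp_endo1 mulr1. Qed.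
Lemma sra_act_grp g : sra_act (sra_grp g) = grp_endo V g.
Proof. by rewrite sra_grpE sra_act_pi smash_endo_elt rmorph1 mul1r. Qed.
Lemma sra_act_scal r : sra_act (pzscal r) = scal_endo V gT r.
Proof. by rewrite -sra_pi_scal sra_act_pi smash_endo_scal. Qed.

End SymplecticReflectionAlgebra.

(** * Symbols and lifting of p-th powers to the center *)

Section FilteredDeformation.
Variables (k : closedFieldType) (V : vectType k) (gT : finGroupType).
Variables (rho : linRep gT V) (A : pzAlgType k) (vec : V -> A) (grp : gT -> A).
Variable kap : V -> V -> gT -> k.
Notation n := (\dim {:V}).
Notation e := (vbasis {:V}).
Notation S := (mpoly n k).
Notation M := {ffun gT -> mpoly n k}.
Notation sact g := (sym_map (rho g)).
Implicit Types (a b z : A) (p q : S) (u v w : V) (g h x : gT) (l : seq 'I_n) (Q : nat -> bool).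

Hypothesis vecP : forall r u v, vec (r *: u + v) = pzscal r * vec u + vec v.
Hypothesis grp1 : grp 1%g = 1.
Hypothesis grpM : forall g h, grp (g * h)%g = grp g * grp h.
Hypothesis grp_vec : forall g v, grp g * vec v = vec (rho g v) * grp g.
Hypothesis commE : forall u v,
  vec u * vec v - vec v * vec u = \sum_g pzscal (kap u v g) * grp g.

Lemma vec0 : vec 0 = 0.
Proof. by have := vecP (-1) 0 0; rewrite scaler0 addr0 pzscalN pzscal1 mulN1r addNr. Qed.
Lemma vecD u v : vec (u + v) = vec u + vec v.
Proof. by rewrite -[u in LHS]scale1r vecP pzscal1 mul1r. Qed.
Lemma vecZ r v : vec (r *: v) = pzscal r * vec v.
Proof. by rewrite -[_ *: _]addr0 vecP vec0 addr0. Qed.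
Lemma vec_basis v : vec v = \sum_(i < n) pzscal (coord e i v) * vec e`_i.
Proof.
rewrite {1}(vbasis_sum v) (big_morph vec vecD vec0).
by apply: eq_bigr => i _; rewrite vecZ.
Qed.

Definition word l g : A := (\prod_(i <- l) vec e`_i) * grp g.

Lemma word_nil g : word [::] g = grp g.
Proof. by rewrite /word big_nil mul1r. Qed.

(** A predicate on word lengths covers both the filtration by length and its refinement [pfil] by
    parity. *)
Definition wspan Q a := exists r : seq (k * seq 'I_n * gT),
  all (fun t => Q (size t.1.2)) r /\ a = \sum_(t <- r) pzscal t.1.1 * word t.1.2 t.2.

Lemma wspan0 Q : wspan Q 0.
Proof. by exists [::]; rewrite big_nil. Qed.

Lemma wspanD Q a b : wspan Q a -> wspan Q b -> wspan Q (a + b).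
Proof.
by move=> [r [hr ->]] [s [hs ->]]; exists (r ++ s); rewrite all_cat hr hs big_cat.
Qed.

Lemma wspanZ Q c a : wspan Q a -> wspan Q (pzscal c * a).
Proof.
move=> [r [hr ->]]; exists [seq (c * t.1.1, t.1.2, t.2) | t <- r].
rewrite all_map; split=> //; rewrite big_map mulr_sumr.
by apply: eq_bigr => t _ /=; rewrite pzscalM mulrA.
Qed.

Lemma wspanN Q a : wspan Q a -> wspan Q (- a).
Proof. by rewrite -mulN1r -pzscal1 -pzscalN; apply: wspanZ. Qed.

Lemma wspanB Q a b : wspan Q a -> wspan Q b -> wspan Q (a - b).
Proof. by move=> ha hb; apply/wspanD/wspanN. Qed.

Lemma wspan_word Q l g : Q (size l) -> wspan Q (word l g).
Proof. by move=> ql; exists [:: (1, l, g)]; rewrite /= ql big_seq1 pzscal1 mul1r. Qed.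

Lemma wspan_sum Q (I : Type) (r : seq I) (P : pred I) (F : I -> A) :
  (forall i, P i -> wspan Q (F i)) -> wspan Q (\sum_(i <- r | P i) F i).
Proof. by move=> hF; apply: (big_ind (wspan Q)) => //; [exact: wspan0|exact: wspanD]. Qed.

Lemma wspan_ind Q (P : A -> Prop) : P 0 -> (forall a b, P a -> P b -> P (a + b)) ->
  (forall c l g, Q (size l) -> P (pzscal c * word l g)) -> forall a, wspan Q a -> P a.
Proof.
move=> P0 PD Pw a [r [/allP hr ->]]; rewrite big_seq.
by apply: (big_ind P) => // t /hr; apply: Pw.
Qed.

Lemma wspan_sub Q Q' a : (forall j, Q j -> Q' j) -> wspan Q a -> wspan Q' a.
Proof.
move=> QQ' [r [hr ->]]; exists r; split=> //.
by apply: sub_all hr => t; apply: QQ'.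
Qed.

Lemma vec_wspan Q Q' v a : (forall j, Q j -> Q' j.+1) -> wspan Q a -> wspan Q' (vec v * a).
Proof.
move=> QQ'; elim/wspan_ind => [|x y hx hy|c l g ql].
- by rewrite mulr0; apply: wspan0.
- by rewrite mulrDr; apply: wspanD.
rewrite mulrA -pzscalC -mulrA; apply: wspanZ; rewrite vec_basis mulr_suml.
apply: wspan_sum => i _; rewrite -mulrA; apply: wspanZ.
suff -> : vec e`_i * word l g = word (i :: l) g by apply/wspan_word/QQ'.
by rewrite /word big_cons mulrA.
Qed.

Lemma grp_wspan Q g a : wspan Q a -> wspan Q (grp g * a).
Proof.
elim/wspan_ind => [|x y hx hy|c l h ql].
- by rewrite mulr0; apply: wspan0.
- by rewrite mulrDr; apply: wspanD.
rewrite mulrA -pzscalC -mulrA; apply: wspanZ.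
have : wspan (pred1 (size l)) (grp g * word l h).
  elim: l {ql} => [|i l IHl].
    by rewrite /word big_nil mul1r -grpM; have := @wspan_word (pred1 0%N) [::] (g * h)%g; rewrite /word big_nil mul1r; apply.
  rewrite /word big_cons -!mulrA (mulrA (grp g)) grp_vec -mulrA.
  by apply: vec_wspan IHl => j /eqP->; rewrite /= eqxx.
by apply: wspan_sub => j /eqP->.
Qed.

Lemma wspan_grp Q g a : wspan Q a -> wspan Q (a * grp g).
Proof.
move=> [r [hr ->]]; exists [seq (t.1.1, t.1.2, (t.2 * g)%g) | t <- r].
rewrite all_map; split=> //; rewrite big_map mulr_suml.
by apply: eq_bigr => t _ /=; rewrite /word grpM !mulrA.
Qed.

Lemma wspan_mul Q Q' Q'' a b : (forall i j, Q i -> Q' j -> Q'' (i + j)%N) ->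
  wspan Q a -> wspan Q' b -> wspan Q'' (a * b).
Proof.
move=> QQ ha hb; move: ha; elim/wspan_ind => [|x y hx hy|c l g ql].
- by rewrite mul0r; apply: wspan0.
- by rewrite mulrDl; apply: wspanD.
rewrite -mulrA; apply: wspanZ; rewrite /word -mulrA.
have : wspan (fun j => (size l <= j)%N && Q' (j - size l)%N) ((\prod_(i <- l) vec e`_i) * (grp g * b)).
  elim: l {ql} => [|i l IHl]; first by rewrite big_nil mul1r; apply: wspan_sub (grp_wspan g hb) => j; rewrite subn0.
  by rewrite big_cons -mulrA; apply: vec_wspan IHl => j /=; rewrite subSS ltnS.
by apply: wspan_sub => j /andP[lj /(QQ _ _ ql)]; rewrite subnKC.
Qed.

(* The defining relations preserve the parity of the length of words: pfil d  *)
(* is spanned by the words of length d - 1, d - 3, ..., so that pfil 0 = 0 and *)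
(* pfil d.+1 / pfil d.-1 is the graded piece of degree d, even for d = 0.     *)
Definition pfil_pred (d : nat) : nat -> bool := fun j => (j < d)%N && (odd j != odd d).
Definition pfil d := wspan (pfil_pred d).

Lemma pfil0_eq0 a : pfil 0 a -> a = 0.
Proof. by case=> -[|t r] [] //=; rewrite big_nil. Qed.

Lemma pfil_le d d' a : (d <= d')%N -> odd d = odd d' -> pfil d a -> pfil d' a.
Proof.
by move=> le eo; apply: wspan_sub => j /andP[lt o]; rewrite /pfil_pred -eo o (leq_trans lt).
Qed.

Lemma pfil_mul d d' a b : pfil d.+1 a -> pfil d'.+1 b -> pfil (d + d').+1 (a * b).
Proof.
apply: wspan_mul => i j /andP[li oi] /andP[lj oj]; rewrite /pfil_pred !ltnS in li lj *.
rewrite leq_add //= oddD; move: oi oj; rewrite /= oddD.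
by case: (odd i) (odd j) (odd d) (odd d') => [] [] [] [].
Qed.

Lemma pfil_grpL d g a : pfil d a -> pfil d (grp g * a). Proof. exact: grp_wspan. Qed.
Lemma pfil_grpR d g a : pfil d a -> pfil d (a * grp g). Proof. exact: wspan_grp. Qed.

Lemma pfil_vec v : pfil 2 (vec v).
Proof.
rewrite -[vec v]mulr1 -grp1; apply: (@vec_wspan (pred1 0%N)); first by move=> j /eqP->.
by have := @wspan_word (pred1 0%N) [::] 1%g isT; rewrite /word big_nil mul1r.
Qed.

Lemma pfil_grp g : pfil 1 (grp g).
Proof. by have := @wspan_word (pfil_pred 1) [::] g isT; rewrite /word big_nil mul1r. Qed.

Lemma pfil_comm u v : pfil 1 (vec u * vec v - vec v * vec u).
Proof. by rewrite commE; apply: wspan_sum => g _; apply/wspanZ/pfil_grp. Qed.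

Lemma pfil_vecL d v a : pfil d a -> pfil d.+1 (vec v * a).
Proof. by apply: vec_wspan => j /andP[lj oj]; rewrite /pfil_pred /= ltnS lj; case: (odd j) oj; case: (odd d). Qed.

Lemma pfil_vecR d v a : pfil d a -> pfil d.+1 (a * vec v).
Proof.
by case: d => [/pfil0_eq0->|d ha]; [rewrite mul0r; apply: wspan0|rewrite -addn1; apply: pfil_mul (pfil_vec v)].
Qed.

Lemma wspan_split d a : wspan (fun j => j <= d)%N a ->
  exists a' a'', [/\ pfil d.+1 a', pfil d a'' & a = a' + a''].
Proof.
elim/wspan_ind => [|x y [x' [x'' [h1 h2 ->]]] [y' [y'' [h3 h4 ->]]]|c l g ld].
- by exists 0, 0; rewrite addr0; split=> //; apply: wspan0.
- by exists (x' + y'), (x'' + y''); rewrite addrACA; split=> //; apply: wspanD.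
have [eo|no] := boolP (odd (size l) == odd d).
  exists (pzscal c * word l g), 0; rewrite addr0; split=> //; last exact: wspan0.
  by apply/wspanZ/wspan_word; rewrite /pfil_pred ltnS ld /=; case: (odd _) eo; case: (odd d).
exists 0, (pzscal c * word l g); rewrite add0r; split=> //; first exact: wspan0.
apply/wspanZ/wspan_word; rewrite /pfil_pred no andbT ltn_neqAle ld andbT.
by apply: contraNneq no => ->.
Qed.

Lemma pfil_wspan d a : pfil d.+1 a -> wspan (fun j => j <= d)%N a.
Proof. by apply: wspan_sub => j /andP[]. Qed.

(** The existence of such maps is the Poincare-Birkhoff-Witt theorem; [sra_symbol] provides them. On
    the span of words of length at most d, [sigma d] is the symbol in S # Gamma; nothing is
    prescribed on longer words. *)
Variable sigma : nat -> A -> M.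
Hypothesis sigmaB : forall d, zmod_morphism (sigma d).
Hypothesis sigmaZ : forall d r a, sigma d (pzscal r * a) = r *: sigma d a.
Hypothesis sigma_word : forall d l g, (size l <= d)%N ->
  sigma d (word l g) = if size l == d then tens g (\prod_(i <- l) ('X_i : S)) else 0.

Lemma sigma0 d : sigma d 0 = 0.
Proof. by rewrite -(subrr 0) sigmaB subrr. Qed.
Lemma sigmaN d a : sigma d (- a) = - sigma d a.
Proof. by rewrite -sub0r sigmaB sigma0 sub0r. Qed.
Lemma sigmaD d a b : sigma d (a + b) = sigma d a + sigma d b.
Proof. by rewrite -[b in LHS]opprK sigmaB sigmaN opprK. Qed.
Lemma sigma_sum d (I : Type) (r : seq I) (P : pred I) (F : I -> A) :
  sigma d (\sum_(i <- r | P i) F i) = \sum_(i <- r | P i) sigma d (F i).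
Proof. exact: (big_morph _ (sigmaD d) (sigma0 d)). Qed.

Lemma tensE g p x : tens g p x = if x == g then p else 0 :> S.
Proof. by rewrite ffunE. Qed.

Lemma tens0 g : tens g (0 : S) = 0.
Proof. exact: (linear0 (tens g : {linear S -> M})). Qed.

Lemma eq_divLg g h x : (g^-1 * x == h)%g = (x == g * h)%g.
Proof. by rewrite -[RHS](inj_eq (mulgI g^-1%g)) mulKg. Qed.
Lemma eq_divRg g h x : (x * g^-1 == h)%g = (x == h * g)%g.
Proof. by rewrite -[RHS](inj_eq (mulIg g^-1%g)) mulgK. Qed.

Lemma ffun_addE (f f' : M) x : (f + f') x = f x + f' x. Proof. by rewrite ffunE. Qed.
Lemma ffun_subE (f f' : M) x : (f - f') x = f x - f' x. Proof. by rewrite !ffunE. Qed.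
Lemma ffun_scaleE r (f : M) x : (r *: f) x = r *: f x. Proof. by rewrite ffunE. Qed.
Lemma ffun_zeroE x : (0 : M) x = 0. Proof. by rewrite ffunE. Qed.

Lemma prodX_homog l : (\prod_(i <- l) ('X_i : S)) \is (size l).-homog.
Proof.
rewrite -sum1_size; apply: dhomog_bigprod => i.
by rewrite dhomogX /= mdeg1.
Qed.

Lemma prodX_s2m l : \prod_(i <- l) ('X_i : S) = 'X_[s2m l].
Proof.
elim: l => [|i l IHl].
  by rewrite big_nil -mpolyX0; congr 'X_[_]; apply/mnmP=> j; rewrite !mnmE.
rewrite big_cons IHl -mpolyXD; congr 'X_[_]; apply/mnmP=> j.
by rewrite !mnmE /= eq_sym.
Qed.

Lemma mdeg_s2m l : mdeg (s2m l) = size l.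
Proof. by have := prodX_homog l; rewrite prodX_s2m dhomogX => /eqP. Qed.

Notation le d := (fun j => j <= d)%N.
Notation lt d := (fun j => j < d)%N.

Lemma sigma_homog d a x : wspan (le d) a -> sigma d a x \is d.-homog.
Proof.
elim/wspan_ind => [|a1 a2 h1 h2|r l g ld].
- by rewrite sigma0 ffun_zeroE rpred0.
- by rewrite sigmaD ffun_addE rpredD.
rewrite sigmaZ sigma_word // ffun_scaleE; apply: rpredZ.
case: eqP => [<-|_]; last by rewrite ffun_zeroE rpred0.
by rewrite tensE; case: ifP; rewrite ?rpred0 ?prodX_homog.
Qed.

Lemma sigma_lt d a : wspan (lt d) a -> sigma d a = 0.
Proof.
elim/wspan_ind => [|a1 a2 h1 h2|r l g ld]; first exact: sigma0.
- by rewrite sigmaD h1 h2 addr0.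
by rewrite sigmaZ sigma_word ?(ltnW ld) // ltn_eqF // scaler0.
Qed.

Lemma pfil_lt d a : pfil d a -> wspan (lt d) a.
Proof. by apply: wspan_sub => j /andP[]. Qed.

Lemma sigma_E d d' a : (d <= d')%N -> pfil d a -> sigma d' a = 0.
Proof. by move=> dd' ha; apply/sigma_lt/(wspan_sub _ (pfil_lt ha)) => j /leq_trans; apply. Qed.

Lemma sigma_vecL d v a x : wspan (le d) a ->
  sigma d.+1 (vec v * a) x = sym_vec v * sigma d a x.
Proof.
elim/wspan_ind => [|a1 a2 h1 h2|r l g ld].
- by rewrite mulr0 !sigma0 ffun_zeroE mulr0.
- by rewrite mulrDr !sigmaD !ffun_addE h1 h2 mulrDr.
rewrite mulrA -pzscalC -mulrA !sigmaZ !ffun_scaleE -scalerAr; congr (_ *: _).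
rewrite vec_basis mulr_suml sigma_sum /sym_vec mulr_suml sum_ffunE.
apply: eq_bigr => i _; rewrite -mulrA sigmaZ ffun_scaleE -scalerAl; congr (_ *: _).
have -> : vec e`_i * word l g = word (i :: l) g by rewrite /word big_cons mulrA.
rewrite !sigma_word //= eqSS; case: eqP => _; last by rewrite !ffun_zeroE mulr0.
by rewrite big_cons !tensE; case: ifP; rewrite ?mulr0.
Qed.

Lemma prod_vec_wspan d l a : wspan (le d) a ->
  wspan (le (size l + d)%N) (\prod_(i <- l) vec e`_i * a).
Proof.
move=> ha; elim: l => [|i l IHl]; first by rewrite big_nil mul1r.
by rewrite big_cons -mulrA; apply: vec_wspan IHl.
Qed.

Lemma sigma_prod_vecL d l a x : wspan (le d) a ->
  sigma (size l + d) (\prod_(i <- l) vec e`_i * a) x =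
  \prod_(i <- l) ('X_i : S) * sigma d a x.
Proof.
move=> ha; elim: l => [|i l IHl]; first by rewrite !big_nil !mul1r.
rewrite !big_cons -!mulrA /= addSn sigma_vecL ?IHl ?sym_vec_basis //.
exact: prod_vec_wspan.
Qed.

Lemma sigma_grpL d g a x : wspan (le d) a ->
  sigma d (grp g * a) x = sact g (sigma d a (g^-1 * x)%g).
Proof.
elim/wspan_ind => [|a1 a2 h1 h2|r l h ld].
- by rewrite mulr0 !sigma0 !ffun_zeroE raddf0.
- by rewrite mulrDr !sigmaD !ffun_addE h1 h2 raddfD.
rewrite mulrA -pzscalC -mulrA !sigmaZ !ffun_scaleE sym_mapZ; congr (_ *: _).
have [eld|ned] := eqVneq (size l) d; last first.
  have lld : (size l < d)%N by rewrite ltn_neqAle ned.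
  rewrite sigma_lt; last by apply/grp_wspan/wspan_word.
  by rewrite sigma_lt ?ffun_zeroE ?raddf0 //; apply: wspan_word.
subst d => {ld r}; elim: l => [|i l IHl].
  rewrite -[X in grp g * X]mul1r /word big_nil !mul1r -grpM.
  have W g' : grp g' = word [::] g' by rewrite /word big_nil mul1r.
  rewrite !W !sigma_word //= !tensE big_nil eq_divLg.
  by case: ifP; rewrite ?rmorph1 ?raddf0.
rewrite /word big_cons -!mulrA (mulrA (grp g)) grp_vec -mulrA -/(word l h).
rewrite sigma_vecL; last by apply/grp_wspan/wspan_word.
rewrite IHl [sigma _ (vec _ * _) _]sigma_vecL; last exact: wspan_word.
by rewrite rmorphM /= sym_map_vec.
Qed.

Lemma sigma_grpR d g a x : wspan (le d) a ->
  sigma d (a * grp g) x = sigma d a (x * g^-1)%g.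
Proof.
elim/wspan_ind => [|a1 a2 h1 h2|r l h ld].
- by rewrite mul0r !sigma0 !ffun_zeroE.
- by rewrite mulrDl !sigmaD !ffun_addE h1 h2.
rewrite -mulrA !sigmaZ !ffun_scaleE; congr (_ *: _).
rewrite /word -mulrA -grpM !sigma_word //; case: eqP => _; last by rewrite !ffun_zeroE.
by rewrite !tensE eq_divRg.
Qed.

(** The convolution on the right is the product of S # Gamma. *)
Lemma sigma_mul d d' a b x : wspan (le d) a -> wspan (le d') b ->
  sigma (d + d') (a * b) x = \sum_h sigma d a h * sact h (sigma d' b (h^-1 * x)%g).
Proof.
move=> ha hb; elim/wspan_ind: ha => [|a1 a2 h1 h2|r l g ld].
- by rewrite mul0r !sigma0 ffun_zeroE big1 // => h _; rewrite ffun_zeroE mul0r.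
- rewrite mulrDl !sigmaD ffun_addE h1 h2 -big_split; apply: eq_bigr => h _ /=.
  by rewrite ffun_addE mulrDl.
rewrite -mulrA !sigmaZ ffun_scaleE.
under eq_bigr do rewrite ffun_scaleE -scalerAl.
rewrite -scaler_sumr; congr (_ *: _); rewrite sigma_word //.
have [eld|ned] := eqVneq (size l) d.
  subst d; rewrite /word -mulrA sigma_prod_vecL; last exact: grp_wspan.
  rewrite sigma_grpL // (bigD1 g) //= tensE eqxx [X in _ + X]big1 ?addr0 // => h /negPf hg.
  by rewrite tensE hg mul0r.
rewrite sigma_lt ?ffun_zeroE ?big1 // => [h _|]; first by rewrite ffun_zeroE mul0r.
apply: (@wspan_mul (lt d) (le d')) hb; last by apply: wspan_word; rewrite ltn_neqAle ned.
by move=> i j; rewrite -addSn; apply: leq_add.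
Qed.

Lemma vec_le1 v : wspan (le 1) (vec v).
Proof. exact/pfil_wspan/pfil_vec. Qed.

Lemma sigma_vec v x : sigma 1 (vec v) x = if x == 1%g then sym_vec v else 0.
Proof.
have W : vec v = vec v * word [::] 1%g by rewrite /word big_nil grp1 !mulr1.
rewrite W sigma_vecL; last exact: wspan_word.
by rewrite sigma_word //= tensE big_nil; case: ifP; rewrite ?mulr1 ?mulr0.
Qed.

Lemma sigma_vecR d v a x : wspan (le d) a ->
  sigma d.+1 (a * vec v) x = sigma d a x * sym_vec (rho x v).
Proof.
move=> ha; rewrite -addn1 (sigma_mul _ ha (vec_le1 v)).
rewrite (bigD1 x) //= mulVg sigma_vec eqxx sym_map_vec big1 ?addr0 // => h hx.
by rewrite sigma_vec eq_divLg mulg1 eq_sym (negPf hx) raddf0 mulr0.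
Qed.

(** * Reordering of words and lifting of symbols *)

Lemma word_cons i l g : word (i :: l) g = vec e`_i * word l g.
Proof. by rewrite /word big_cons mulrA. Qed.

Lemma pfil_word d l g : (size l <= d)%N -> odd (size l) = odd d -> pfil d.+1 (word l g).
Proof. by move=> ld o; apply: wspan_word; rewrite /pfil_pred ltnS ld /= o; case: odd. Qed.

Lemma pfil_vecL_pred d v a : pfil d.-1 a -> pfil d (vec v * a).
Proof.
case: d => [|d] /=; last exact: pfil_vecL.
by move=> /pfil0_eq0->; rewrite mulr0; apply: wspan0.
Qed.

(** Each transposition of neighbours costs a commutator, which lies in k Gamma: two letters
    disappear at once and the parity is kept. *)
Lemma word_insert i l1 l2 g :
  pfil (size (l1 ++ l2)) (word (l1 ++ i :: l2) g - word (i :: l1 ++ l2) g).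
Proof.
elim: l1 => [|j l IHl]; first by rewrite subrr; apply: wspan0.
rewrite !cat_cons !word_cons.
rewrite -[_ - _](subrKA (vec e`_j * word (i :: l ++ l2) g)) -mulrBr.
apply: wspanD; first exact: pfil_vecL.
rewrite word_cons 2!(mulrA (vec _) (vec _)) -mulrBl.
exact: pfil_mul (pfil_comm e`_j e`_i) (pfil_word g (leqnn (size (l ++ l2))) erefl).
Qed.

Lemma word_perm l l' g : perm_eq l l' -> pfil (size l).-1 (word l g - word l' g).
Proof.
elim: l l' => [|i l IHl] l' pl.
  by rewrite perm_sym in pl; rewrite (perm_nilP pl) subrr; apply: wspan0.
have il : i \in l' by rewrite -(perm_mem pl) mem_head.
have [l1 [l2 el']] : exists l1 l2, l' = l1 ++ i :: l2.
  by case/splitPr: il => l1 l2; exists l1, l2.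
have pl' : perm_eq l (l1 ++ l2).
  by rewrite -(perm_cons i) (perm_trans pl) // el' -cat1s perm_catCA.
rewrite el' -[_ - _](subrKA (word (i :: l1 ++ l2) g)) /=; apply: wspanD.
  by rewrite !word_cons -mulrBr; apply/pfil_vecL_pred/IHl.
by rewrite -opprB (perm_size pl'); apply/wspanN/word_insert.
Qed.

(** A linear section of [sigma d] over homogeneous symbols ([sigma_lift]), with [m2s m] as the
    chosen word for the monomial m. *)
Definition symbol_lift d (X : M) : A :=
  \sum_g \sum_(m : 'X_{1..n < d.+1}) pzscal (X g)@_m * word (m2s m) g.

Lemma liftD d X Y : symbol_lift d (X + Y) = symbol_lift d X + symbol_lift d Y.
Proof.
rewrite /symbol_lift -big_split; apply: eq_bigr => g _; rewrite -big_split.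
by apply: eq_bigr => m _; rewrite ffunE mcoeffD pzscalD mulrDl.
Qed.

Lemma liftZ d r X : symbol_lift d (r *: X) = pzscal r * symbol_lift d X.
Proof.
rewrite /symbol_lift mulr_sumr; apply: eq_bigr => g _; rewrite mulr_sumr.
by apply: eq_bigr => m _; rewrite ffunE mcoeffZ pzscalM mulrA.
Qed.

Lemma lift0 d : symbol_lift d 0 = 0.
Proof. by rewrite -(scale0r 0) liftZ pzscal0 mul0r. Qed.

Lemma lift_tensX d m g : (mdeg m <= d)%N -> symbol_lift d (tens g 'X_[m]) = word (m2s m) g.
Proof.
move=> md; rewrite /symbol_lift (bigD1 g) //= [X in _ + X]big1 => [|h /negPf hg]; last first.
  by apply: big1 => m' _; rewrite tensE hg mcoeff0 pzscal0 mul0r.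
have md' : (mdeg m < d.+1)%N by [].
rewrite addr0 (bigD1 (BMultinom md')) //= big1 => [|m' /negPf m'm].
  by rewrite tensE eqxx mcoeffX eqxx pzscal1 mul1r addr0.
rewrite tensE eqxx mcoeffX; case: eqP => [e|]; last by rewrite pzscal0 mul0r.
by case/negP: (negbT m'm); apply/eqP/val_inj.
Qed.

Lemma pfil_lift d (X : M) : (forall g, X g \is d.-homog) -> pfil d.+1 (symbol_lift d X).
Proof.
move=> hX; apply: wspan_sum => g _; apply: wspan_sum => m _.
have [->|c0] := eqVneq (X g)@_m 0; first by rewrite pzscal0 mul0r; apply: wspan0.
have dm : mdeg m = d by apply: dhomog_coeff_neq0 (hX g) c0.
by apply/wspanZ/pfil_word; rewrite size_m2s dm.
Qed.

Lemma sigma_lift d (X : M) : (forall g, X g \is d.-homog) -> sigma d (symbol_lift d X) = X.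
Proof.
move=> hX; rewrite [RHS]tens_sum sigma_sum; apply: eq_bigr => g _.
have hm : (msize (X g) <= d.+1)%N by apply: msize_homog.
rewrite sigma_sum [in RHS](mpolywE hm) [RHS]linear_sum; apply: eq_bigr => m _.
rewrite sigmaZ [RHS]linearZ /=.
have [->|c0] := eqVneq (X g)@_m 0; first by rewrite !scale0r.
have dm : mdeg m = d by apply: dhomog_coeff_neq0 (hX g) c0.
by rewrite sigma_word size_m2s dm // eqxx prodX_s2m s2mK.
Qed.

Lemma pfil_sub_lift d a : pfil d.+1 a -> pfil d.-1 (a - symbol_lift d (sigma d a)).
Proof.
elim/wspan_ind => [|a1 a2 h1 h2|r l g /andP[ld o]].
- by rewrite sigma0 lift0 subrr; apply: wspan0.
- by rewrite sigmaD liftD opprD addrACA; apply: wspanD.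
rewrite sigmaZ liftZ -mulrBr; apply: wspanZ; rewrite sigma_word //.
have [eld|ned] := eqVneq (size l) d.
  rewrite prodX_s2m lift_tensX ?mdeg_s2m ?eld // -eld; apply: word_perm.
  apply/allP => i _ /=; have cnt l' : count_mem i l' = s2m l' i by rewrite mnmE.
  by rewrite [X in _ == X]cnt s2mK cnt.
rewrite lift0 subr0; case: d => [|d] in ld o ned *; first by case: (size l) ld ned.
move: o; rewrite /= negbK => o.
apply: wspan_word; rewrite /pfil_pred /= o andbT ltn_neqAle.
by rewrite -[(size l <= d)%N]ltnS [(size l < _)%N]ltn_neqAle ned -ltnS ld !andbT; apply: contraNneq o => ->.
Qed.

Lemma sigma_eq0 d a : pfil d.+1 a -> sigma d a = 0 -> pfil d.-1 a.
Proof. by move=> ha s0; have := pfil_sub_lift ha; rewrite s0 lift0 subr0. Qed.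

(** Words of even and of odd length are independent: lying in [pfil d] kills the symbol in degree d,
    which lowers the other bound by 2, and so on down to 0. *)
Lemma pfil_disjoint d a : pfil d.+1 a -> pfil d a -> a = 0.
Proof.
elim: d => [_ /pfil0_eq0//|d IHd ha ha'].
by apply: IHd => //; apply: (@sigma_eq0 d.+1) => //; apply: sigma_E ha'.
Qed.

Lemma pfil_parity d d' a : odd d != odd d' -> pfil d a -> pfil d' a -> a = 0.
Proof.
wlog dd : d d' / (d <= d')%N => [H|o ha ha'].
  by case: (leqP d d') => [/H//|/ltnW/H h o ha ha']; apply: h => //; rewrite eq_sym.
case: d' => [|d'] in dd o ha' *; first by apply: pfil0_eq0 ha'.
have [e|ned] := eqVneq d d'.+1; first by rewrite e eqxx in o.
apply: (pfil_disjoint ha'); apply: pfil_le ha; first by rewrite -ltnS ltn_neqAle ned.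
by move: o => /=; case: (odd d); case: (odd d').
Qed.

(** * Commutators and Poisson brackets *)

Definition lie a b := a * b - b * a.

Lemma lieDl a b c : lie (a + b) c = lie a c + lie b c.
Proof. by rewrite /lie mulrDl mulrDr opprD addrACA. Qed.
Lemma lieNl a c : lie (- a) c = - lie a c.
Proof. by rewrite /lie mulNr mulrN opprB opprK addrC. Qed.
Lemma lieBl a b c : lie (a - b) c = lie a c - lie b c.
Proof. by rewrite lieDl lieNl. Qed.
Lemma lie0l c : lie 0 c = 0. Proof. by rewrite /lie mul0r mulr0 subrr. Qed.
Lemma lieMl a b c : lie (a * b) c = a * lie b c + lie a c * b.
Proof. by rewrite /lie mulrBr mulrBl !mulrA subrKA. Qed.
Lemma lie_suml (I : Type) (r : seq I) (P : pred I) (F : I -> A) c :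
  lie (\sum_(i <- r | P i) F i) c = \sum_(i <- r | P i) lie (F i) c.
Proof. by apply: (big_morph (lie^~ c)) => [a b|]; [apply: lieDl|apply: lie0l]. Qed.
Lemma lie_scall r a c : lie (pzscal r * a) c = pzscal r * lie a c.
Proof. by rewrite /lie mulrBr !mulrA (pzscalC r c). Qed.
Lemma lie_vecP a r u v :
  lie a (vec (r *: u + v)) = pzscal r * lie a (vec u) + lie a (vec v).
Proof.
by rewrite /lie vecP mulrDr mulrDl opprD addrACA mulrBr !mulrA (pzscalC r a).
Qed.

Lemma lie_vec_sum a (I : Type) (r : seq I) (c : I -> k) (w : I -> V) :
  lie a (vec (\sum_(i <- r) c i *: w i)) = \sum_(i <- r) pzscal (c i) * lie a (vec (w i)).
Proof.
elim: r => [|i r IHr]; first by rewrite !big_nil vec0 /lie mulr0 mul0r subrr.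
by rewrite !big_cons lie_vecP IHr.
Qed.

Lemma sigma_lie_vec d a v x : wspan (le d) a ->
  sigma d.+1 (lie a (vec v)) x = sigma d a x * sym_vec (rho x v - v).
Proof.
move=> ha; rewrite sigmaB ffun_subE sigma_vecR // sigma_vecL //.
by rewrite [sym_vec v * _]mulrC -mulrBr raddfB.
Qed.

Lemma pfil_lie_vec d a v : pfil d a -> pfil d.+1 (lie a (vec v)).
Proof. by move=> ha; apply: wspanB; [apply: pfil_vecR|apply: pfil_vecL]. Qed.

Definition supp1 (X : M) := forall x, x != 1%g -> X x = 0.

Lemma supp1_lie d a v : wspan (le d) a -> supp1 (sigma d a) ->
  sigma d.+1 (lie a (vec v)) = 0.
Proof.
move=> ha sa; apply/ffunP=> x; rewrite sigma_lie_vec // ffun_zeroE.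
have [->|/sa->] := eqVneq x 1%g; last by rewrite mul0r.
by rewrite rep_one subrr raddf0 mulr0.
Qed.

Lemma pfil_lie_vec1 d a v : pfil d.+1 a -> supp1 (sigma d a) -> pfil d (lie a (vec v)).
Proof.
move=> ha sa; apply: (@sigma_eq0 d.+1); first exact: pfil_lie_vec.
by apply: supp1_lie => //; apply: pfil_wspan.
Qed.

Lemma supp1_tens p : supp1 (tens 1%g p).
Proof. by move=> x /negPf x1; rewrite tensE x1. Qed.

(** The Poisson bracket of f with v. *)
Definition pois v f : S := \sum_(i < n) kap e`_i v 1%g *: f^`M(i).

Lemma poisD v f q : pois v (f + q) = pois v f + pois v q.
Proof.
by rewrite /pois -big_split; apply: eq_bigr => i _; rewrite mderivD scalerDr.
Qed.
Lemma poisZ v r f : pois v (r *: f) = r *: pois v f.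
Proof.
rewrite /pois scaler_sumr; apply: eq_bigr => i _.
by rewrite mderivZ !scalerA mulrC.
Qed.
Lemma poisM v f q : pois v (f * q) = f * pois v q + pois v f * q.
Proof.
rewrite /pois mulr_sumr mulr_suml -big_split; apply: eq_bigr => i _ /=.
by rewrite mderivM scalerDr addrC -scalerAl -scalerAr.
Qed.
Lemma pois1 v : pois v 1 = 0.
Proof. by rewrite /pois big1 // => i _; rewrite -mpolyC1 mderivC scaler0. Qed.
Lemma poisX v (i : 'I_n) : pois v 'X_i = (kap e`_i v 1%g)%:MP.
Proof.
rewrite /pois (bigD1 i) //= mderivX mnm1E eqxx scale1r -[X in (X - _)%MM]add0m addmK mpolyX0 big1 => [|j /negPf ji].
  by rewrite addr0 alg_mpolyC.
by rewrite mderivX mnm1E eq_sym ji !scale0r scaler0.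
Qed.

Lemma word_supp1 l : supp1 (sigma (size l) (word l 1%g)).
Proof. by rewrite sigma_word // eqxx; apply: supp1_tens. Qed.

Lemma sigma_lie_word l v :
  sigma (size l).-1 (lie (word l 1%g) (vec v)) 1%g = pois v (\prod_(i <- l) ('X_i : S)).
Proof.
have E1 l' g : pfil (size l').+1 (word l' g) by apply: pfil_word.
elim: l => [|i l IHl].
  have := pfil_lie_vec1 v (E1 [::] 1%g) (@word_supp1 [::]) => /pfil0_eq0 ->.
  by rewrite sigma0 ffun_zeroE big_nil pois1.
rewrite word_cons lieMl sigmaD ffun_addE big_cons poisM poisX /=; congr (_ + _).
  have h := pfil_lie_vec1 v (E1 l 1%g) (@word_supp1 l).
  case: l IHl h => [|j l] IHl h /=.
    by move/pfil0_eq0: h => ->; rewrite mulr0 sigma0 ffun_zeroE big_nil pois1 mulr0.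
  rewrite sigma_vecL ?sym_vec_basis; last exact: pfil_wspan h.
  by rewrite [sigma _ _ _]IHl.
rewrite /lie commE mulr_suml sigma_sum sum_ffunE.
rewrite (bigD1 1%g) //= [X in _ + X]big1 => [|g g1].
  rewrite addr0 grp1 mulr1 sigmaZ ffun_scaleE sigma_word // eqxx tensE eqxx.
  by rewrite mul_mpolyC.
rewrite -mulrA sigmaZ ffun_scaleE sigma_grpL; last exact: wspan_word.
by rewrite mulg1 word_supp1 ?invg_eq1 // raddf0 scaler0.
Qed.

(** When the symbol sits at 1, the expected top symbol of [a, v] vanishes, and the one two degrees
    lower is a Poisson bracket at 1. By [pfil_sub_lift] it suffices to treat words: the remainder
    contributes a multiple of v - v at 1. *)
Lemma sigma_lie_pred d a v : pfil d.+1 a -> supp1 (sigma d a) ->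
  sigma d.-1 (lie a (vec v)) 1%g = pois v (sigma d a 1%g).
Proof.
move=> ha sa; have hs x : sigma d a x \is d.-homog by apply/sigma_homog/pfil_wspan.
rewrite -{1}[a](subrK (symbol_lift d (sigma d a))) lieDl sigmaD ffun_addE.
have -> : sigma d.-1 (lie (a - symbol_lift d (sigma d a)) (vec v)) 1%g = 0.
  have := pfil_sub_lift ha; case: d => [|[|d]] in ha sa hs *.
  - by move=> /pfil0_eq0->; rewrite lie0l sigma0 ffun_zeroE.
  - by move=> /pfil0_eq0->; rewrite lie0l sigma0 ffun_zeroE.
  move=> /pfil_wspan h; rewrite sigma_lie_vec // rep_one subrr.
  by rewrite raddf0 mulr0.
rewrite add0r; move: (hs 1%g); set f := sigma d a 1%g => hf.
have -> : sigma d a = tens 1%g f.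
  by apply/ffunP=> x; rewrite tensE; case: eqP => [->|/eqP/sa].
have hm : (msize f <= d.+1)%N by apply: msize_homog.
rewrite /symbol_lift (bigD1 1%g) //= [X in _ + X]big1 ?addr0 => [|g /negPf g1]; last first.
  by apply: big1 => m _; rewrite tensE g1 mcoeff0 pzscal0 mul0r.
rewrite lie_suml sigma_sum sum_ffunE [in RHS](mpolywE hm).
rewrite (big_morph _ (poisD v) (_ : pois v 0 = 0)); last by rewrite -(scale0r 0) poisZ !scale0r.
apply: eq_bigr => m _; rewrite tensE eqxx lie_scall sigmaZ ffun_scaleE poisZ.
have [->|c0] := eqVneq f@_m 0; first by rewrite !scale0r.
have dm : mdeg m = d by apply: dhomog_coeff_neq0 hf c0.
have := sigma_lie_word (m2s m) v; rewrite size_m2s dm prodX_s2m s2mK => ->.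
by [].
Qed.

(** * Averaging over the group *)

Definition gcomm z := forall g, grp g * z = z * grp g.

Lemma gcommD a b : gcomm a -> gcomm b -> gcomm (a + b).
Proof. by move=> ha hb g; rewrite mulrDr ha hb mulrDl. Qed.
Lemma gcommN a : gcomm a -> gcomm (- a).
Proof. by move=> ha g; rewrite mulrN ha mulNr. Qed.
Lemma gcommB a b : gcomm a -> gcomm b -> gcomm (a - b).
Proof. by move=> ha hb; apply/gcommD/gcommN. Qed.
Lemma gcommM a b : gcomm a -> gcomm b -> gcomm (a * b).
Proof. by move=> ha hb g; rewrite mulrA ha -mulrA hb mulrA. Qed.
Lemma gcomm1 : gcomm 1. Proof. by move=> g; rewrite mulr1 mul1r. Qed.

Definition gconj g a := grp g * a * grp g^-1%g.

Lemma gcomm_conj g z : gcomm z -> gconj g z = z.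
Proof. by move=> hz; rewrite /gconj hz -mulrA -grpM mulgV grp1 mulr1. Qed.

Lemma conjB g a b : gconj g (a - b) = gconj g a - gconj g b.
Proof. by rewrite /gconj mulrBr mulrBl. Qed.

Lemma lie_conj g a v : lie (gconj g a) (vec v) = gconj g (lie a (vec (rho g^-1%g v))).
Proof.
have hV : grp g^-1%g * vec v = vec (rho g^-1%g v) * grp g^-1%g by apply: grp_vec.
have hg : vec v * grp g = grp g * vec (rho g^-1%g v).
  by rewrite grp_vec -rep_mul mulgV rep_one.
rewrite /lie /gconj mulrBr mulrBl -!mulrA hV (mulrA (vec v)) hg !mulrA; congr (_ - _).
Qed.

Lemma sigma_conj d g a x : wspan (le d) a ->
  sigma d (gconj g a) x = sact g (sigma d a (g^-1 * x * g)%g).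
Proof.
move=> ha; rewrite /gconj sigma_grpR; last exact: grp_wspan.
by rewrite (sigma_grpL _ _ ha) invgK mulgA.
Qed.

Lemma pfil_conj d g a : pfil d a -> pfil d (gconj g a).
Proof. by move=> ha; apply/pfil_grpR/pfil_grpL. Qed.

Hypothesis gT_unit : #|gT|%:R != 0 :> k.

Definition gavg a : A := pzscal #|gT|%:R^-1 * \sum_g gconj g a.

Lemma gcomm_avg a : gcomm (gavg a).
Proof.
move=> h; rewrite /gavg mulrA -pzscalC -!mulrA; congr (_ * _).
rewrite mulr_sumr mulr_suml (reindex_inj (mulgI h^-1%g)) /=.
apply: eq_bigr => g _; rewrite /gconj invMg invgK 2!mulrA -grpM mulKVg.
by rewrite -!mulrA -grpM.
Qed.

Lemma avg_ind (P : A -> Prop) (w : A) : (forall a b, P a -> P b -> P (a + b)) ->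
  (forall r a, P a -> P (pzscal r * a)) -> (forall g, P (gconj g w)) -> P (gavg w).
Proof.
move=> PD PZ Pw; apply: (PZ); have P0 : P 0 by rewrite -(mul0r (gconj 1%g w)) -pzscal0; apply: PZ.
by apply: (big_ind P) => // g _; apply: Pw.
Qed.

Lemma avg_gcomm z : gcomm z -> gavg z = z.
Proof.
move=> hz; rewrite /gavg (eq_bigr (fun=> z)) => [|g _]; last exact: gcomm_conj.
rewrite sumr_const -[z *+ _]mulr_natl -pzscal_nat mulrA -pzscalM mulVf //.
by rewrite pzscal1 mul1r.
Qed.

Lemma avgB a b : gavg (a - b) = gavg a - gavg b.
Proof.
rewrite /gavg -mulrBr -sumrB; congr (_ * _); apply: eq_bigr => g _; exact: conjB.
Qed.

(* Averaging a correction w of a Gamma-commuting z preserves any property of  *)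
(* the commutators [z - w, v] that is linear and stable under conjugation.    *)
Lemma avg_lie (P : A -> Prop) z (w : A) : (forall a b, P a -> P b -> P (a + b)) ->
  (forall r a, P a -> P (pzscal r * a)) -> (forall g a, P a -> P (gconj g a)) ->
  gcomm z -> (forall v, P (lie (z - w) (vec v))) ->
  forall v, P (lie (z - gavg w) (vec v)).
Proof.
move=> PD PZ Pc hz h v; rewrite -(avg_gcomm hz) -avgB.
apply: (avg_ind (P := fun a => P (lie a (vec v)))) => [a b ha hb|r a ha|g].
- by rewrite lieDl; apply: PD.
- by rewrite lie_scall; apply: PZ.
by rewrite lie_conj; apply: Pc.
Qed.

Lemma pfil_avg d a : pfil d a -> pfil d (gavg a).
Proof.
move=> ha; apply: (avg_ind (P := pfil d)) => [x y|r x|g]; [exact: wspanD|exact: wspanZ|].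
exact: pfil_conj.
Qed.

Lemma sigma_gcomm d z x g : wspan (le d) z -> gcomm z ->
  sact g (sigma d z x) = sigma d z (g * x * g^-1)%g.
Proof.
move=> sz hz; rewrite -[in RHS](gcomm_conj g hz) sigma_conj //.
by rewrite !mulgA mulVg mul1g mulgKV.
Qed.

Lemma sinv_gcomm d z : wspan (le d) z -> gcomm z -> sinv rho (sigma d z 1%g).
Proof. by move=> sz hz g; rewrite sigma_gcomm // mulg1 mulgV. Qed.

(** * Removing the leading symbols of commutators *)

Lemma pihomogM_vec d f v :
  pihomog mdeg d.+1 (f * sym_vec v) = pihomog mdeg d f * sym_vec v.
Proof. by rewrite mulrC (pihomog_homogM _ _ (sym_vec_homog v)) subn1 mulrC. Qed.

Lemma pihomog0M_vec f v : pihomog mdeg 0 (f * sym_vec v) = 0.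
Proof. by rewrite mulrC (pihomog_homogM _ _ (sym_vec_homog v)). Qed.

Hypothesis no_refl : forall (g : gT) (a : V), g != 1%g ->
  exists v, v - rho g v \notin <[a]>%VS.

(** By [no_refl] there are v0, v1 with g v0 - v0 and g v1 - v1 independent. The relation for this
    pair shows that g v0 - v0 divides D v0, and the quotient serves for all v. *)
Lemma twisted_derivation (D : V -> S) (g : gT) : g != 1%g ->
  (forall u v, D u * sym_vec (rho g v - v) = D v * sym_vec (rho g u - u)) ->
  exists b : S, forall v, D v = b * sym_vec (rho g v - v).
Proof.
move=> g1 hD; have [v0 hv0] := no_refl 0 g1.
set a := rho g v0 - v0 in hD; have a0 : a != 0.
  by apply: contra hv0; rewrite -(opprB (rho g v0)) => /eqP; rewrite -/a => ->; rewrite oppr0 mem0v.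
have [v1 hv1] := no_refl a g1.
have b1 : rho g v1 - v1 \notin <[a]>%VS by rewrite -memvN opprB.
have [|q eq] := @linear_form_cross _ _ _ _ (D v1) (D v0) a0 b1.
  by rewrite mulrC -hD mulrC.
exists q => v; have sa0 : sym_vec a != 0 by rewrite sym_vec_eq0.
by apply: (mulIf sa0); rewrite -hD eq -mulrA mulrC.
Qed.

(** The clause for d = 0 makes up for the truncation of [d.-1]: there D vanishes by degree. *)
Lemma twisted_derivation_homog d (D : V -> S) (g : gT) : g != 1%g ->
  (forall v, D v \is d.-homog) ->
  (forall u v, D u * sym_vec (rho g v - v) = D v * sym_vec (rho g u - u)) ->
  exists b : S, [/\ b \is d.-1.-homog, d = 0%N -> b = 0 &
    forall v, D v = b * sym_vec (rho g v - v)].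
Proof.
move=> g1 hh /(twisted_derivation g1)[b hb]; case: d hh => [|d] hh.
  exists 0; split=> [|//|v]; first exact: rpred0.
  by rewrite mul0r -(pihomog_dE (hh v)) hb pihomog0M_vec.
exists (pihomog mdeg d b); split=> [|//|v]; first exact: pihomogP.
by rewrite -pihomogM_vec -hb pihomog_dE.
Qed.

Fact four_term (U : zmodType) (x y s t w r : U) :
  (x - y - (s - t)) - (w - s - (y - r)) = x - w - (r - t).
Proof.
have h (a b c d : U) : a - b - (c - d) = a + d - (b + c).
  by rewrite opprB addrACA -opprD.
by rewrite (h x) (h w) (h x) [y + s]addrC opprB addrA subrK.
Qed.

(** By the Jacobi identity, since [u, v] lies in k Gamma, with which z commutes. *)
Lemma lie_jacobi z u v : gcomm z ->
  lie (lie z (vec u)) (vec v) = lie (lie z (vec v)) (vec u).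
Proof.
move=> hz; have : lie z (lie (vec u) (vec v)) = 0.
  rewrite /lie commE mulr_sumr mulr_suml -sumrB big1 // => g _.
  by rewrite mulrA -pzscalC -!mulrA hz subrr.
move=> h0; apply/eqP; rewrite -subr_eq0 -[X in _ == X]h0; apply/eqP.
rewrite /lie !mulrBr !mulrBl !mulrA.
exact: four_term.
Qed.

(* By the Jacobi identity, the component at g <> 1 of the symbol of [z, v] is  *)
(* a derivation in v twisted by g; these are all inner since rk(1 - g) > 1.   *)
Lemma step_supp1 N z : gcomm z -> (forall v, pfil N.+1 (lie z (vec v))) ->
  exists y, [/\ pfil N y, gcomm y, forall v, sigma N (lie y (vec v)) 1%g = 0 &
    forall v, supp1 (sigma N (lie (z - y) (vec v)))].
Proof.
move=> hz hE.
have hb g : exists b : S, [/\ b \is N.-1.-homog, N = 0%N -> b = 0, g = 1%g -> b = 0 &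
    g != 1%g -> forall v, sigma N (lie z (vec v)) g = b * sym_vec (rho g v - v)].
  have [->|g1] := eqVneq g 1%g; first by exists 0; split=> //; apply: rpred0.
  have [||b [h1 h2 h3]] := @twisted_derivation_homog N (fun v => sigma N (lie z (vec v)) g) _ g1.
  - by move=> v; apply/sigma_homog/pfil_wspan.
  - move=> u v /=; have hl w : wspan (le N) (lie z (vec w)) by apply/pfil_wspan.
    by rewrite -!sigma_lie_vec // lie_jacobi.
  by exists b; split=> // g1'; rewrite g1' eqxx in g1.
have [b /all_and4[b1 b2 b3 b4]] := boolp.choice hb.
move=> {hb}; case: N => [|N] in hE b1 b2 b4 *.
  exists 0; split=> [||v|v]; first exact: wspan0.
  - by move=> g; rewrite mul0r mulr0.
  - by rewrite lie0l sigma0 ffun_zeroE.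
  by move=> x x1; rewrite subr0 b4 // b2 // mul0r.
pose X : M := finfun b; have hX g : X g \is N.-homog by rewrite ffunE; apply: b1.
have EX := pfil_lift hX; exists (gavg (symbol_lift N X)); split.
- exact: pfil_avg.
- exact: gcomm_avg.
- move=> v; rewrite sigma_lie_vec; last by apply/pfil_wspan/pfil_avg.
  by rewrite rep_one subrr raddf0 mulr0.
pose P a := wspan (le N.+1) a /\ supp1 (sigma N.+1 a).
suff H v : P (lie (z - gavg (symbol_lift N X)) (vec v)) by move=> v; case: (H v).
apply: (avg_lie (P := P)) => // [a a' [h1 h2] [h3 h4]|r a [h1 h2]|g a [h1 h2]|{}v].
- split; first exact: wspanD.
  by move=> x x1; rewrite sigmaD ffun_addE h2 // h4 // addr0.
- by split; [apply: wspanZ|move=> x x1; rewrite sigmaZ ffun_scaleE h2 // scaler0].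
- split; first by apply/wspan_grp/grp_wspan.
  move=> x x1; rewrite sigma_conj // h2 ?raddf0 //.
  by apply: contra x1 => /eqP h; rewrite -[x](mulKVg g) -[X in (g * X)%g](mulgK g) h mul1g mulgV.
have EXv : pfil N.+2 (lie (symbol_lift N X) (vec v)) by apply: pfil_lie_vec.
rewrite lieBl; split; first by apply: wspanB; apply: pfil_wspan.
move=> x x1; rewrite sigmaB ffun_subE b4 // sigma_lie_vec; last exact: pfil_wspan.
by rewrite sigma_lift // ffunE subrr.
Qed.

Variable dv : 'I_n -> V.
Hypothesis dv_dual : forall i j : 'I_n, kap e`_i (dv j) 1%g = (i == j)%:R.
Hypothesis dv_wspan : forall v, v = \sum_(i < n) kap e`_i v 1%g *: dv i.
Variables (p : nat) (char_k : p \in [pchar k]).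

Lemma pois_dv i f : pois (dv i) f = f^`M(i).
Proof.
rewrite /pois (bigD1 i) //= dv_dual eqxx scale1r big1 ?addr0 // => j /negPf ji.
by rewrite dv_dual ji scale0r.
Qed.

Lemma lie_dv z v : lie z (vec v) =
  \sum_(i < n) pzscal (kap e`_i v 1%g) * lie z (vec (dv i)).
Proof. by rewrite {1}(dv_wspan v) lie_vec_sum. Qed.

(* The symbols at 1 of the [z, dv i] form a closed 1-form; its Cartier class  *)
(* obstructs the improvement of z in [step].                                  *)
Definition obstr N z i := cartier char_k i (sigma N.-1 (lie z (vec (dv i))) 1%g).

Lemma obstrD N z z' i : obstr N (z + z') i = obstr N z i + obstr N z' i.
Proof. by rewrite /obstr lieDl sigmaD ffun_addE cartierD. Qed.

(** Three corrections: [step_supp1] clears the components off 1, a lift of a primitive h of the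
    closed form clears the component at 1, and [step_supp1] clears what the lift of h brought in off
    1 without touching the component at 1. Parity turns the vanishing of the symbol into a gain of
    2. *)
Lemma step N z : gcomm z -> (forall v, pfil N (lie z (vec v))) ->
  (forall i, obstr N z i = 0) ->
  exists y, [/\ pfil N.+1 y, gcomm y & forall v, pfil N.-2 (lie (z - y) (vec v))].
Proof.
case: N => [|N] hz hE hC.
  exists 0; split=> [||v]; first exact: wspan0.
    by move=> g; rewrite mul0r mulr0.
  by rewrite subr0.
have [y1 [Ey1 cy1 y11 sz1]] := step_supp1 hz hE.
pose z1 := z - y1; have cz1 : gcomm z1 by apply: gcommB.
have Ez1 v : pfil N.+1 (lie z1 (vec v)) by rewrite lieBl; apply: wspanB; [apply: hE|apply: pfil_lie_vec].
pose al i := sigma N (lie z1 (vec (dv i))) 1%g.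
have alE i : al i = sigma N (lie z (vec (dv i))) 1%g.
  by rewrite /al lieBl sigmaB ffun_subE y11 subr0.
have [|i j|i|h hh dh] := @closed_form_exact k p char_k n N al.
- by move=> i; apply/sigma_homog/pfil_wspan.
(* Closedness: the mixed derivatives are symbols of double commutators, which are symmetric by
   [lie_jacobi]. *)
- rewrite -!pois_dv -!sigma_lie_pred //; congr (sigma _ _ _).
  exact: lie_jacobi.
- by rewrite alE; apply: hC.
have hh' g : tens 1%g h g \is N.+1.-homog.
  by rewrite tensE; case: ifP => _ //; apply: rpred0.
pose w := symbol_lift N.+1 (tens 1%g h); have Ew : pfil N.+2 w by apply: pfil_lift.
have sw : sigma N.+1 w = tens 1%g h by apply: sigma_lift.
have sw1 : supp1 (sigma N.+1 w) by rewrite sw; apply: supp1_tens.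
have Ewv u : pfil N.+1 (lie w (vec u)) by apply: pfil_lie_vec1.
have w1 u : sigma N (lie (z1 - w) (vec u)) 1%g = 0.
  have H i : sigma N (lie (z1 - w) (vec (dv i))) 1%g = 0.
    rewrite lieBl sigmaB ffun_subE; have := sigma_lie_pred (dv i) Ew sw1; rewrite /= => ->.
    by rewrite pois_dv sw tensE eqxx dh subrr.
  rewrite lie_dv sigma_sum sum_ffunE big1 // => i _.
  by rewrite sigmaZ ffun_scaleE H scaler0.
pose z2 := z1 - gavg w; have cz2 : gcomm z2 by apply/gcommB/gcomm_avg.
have [Ez2 z21] : (forall v, pfil N.+1 (lie z2 (vec v))) /\
    (forall v, sigma N (lie z2 (vec v)) 1%g = 0).
  pose P a := pfil N.+1 a /\ sigma N a 1%g = 0.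
  suff H v : P (lie z2 (vec v)) by split=> v; case: (H v).
  apply: (avg_lie (P := P)) => // [a a' [h1 h2] [h3 h4]|r a [h1 h2]|g a [h1 h2]|{}v].
  - by split; [apply: wspanD|rewrite sigmaD ffun_addE h2 h4 addr0].
  - by split; [apply: wspanZ|rewrite sigmaZ ffun_scaleE h2 scaler0].
  - split; first exact: pfil_conj.
    by rewrite sigma_conj ?mulg1 ?mulVg ?h2 ?raddf0 //; apply: pfil_wspan.
  by split; [rewrite lieBl; apply: wspanB; [apply: Ez1|apply: Ewv]|apply: w1].
have [y3 [Ey3 cy3 y31 sz3]] := step_supp1 cz2 Ez2.
exists (y1 + gavg w + y3); split.
- have up y : pfil N y -> pfil N.+2 y by apply: pfil_le => /=; rewrite ?negbK // ltnW.
  by do 2?apply: wspanD; [apply: up|apply: pfil_avg|apply: up].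
- by do 2?apply: gcommD => //; apply: gcomm_avg.
move=> v; have -> : z - (y1 + gavg w + y3) = z2 - y3 by rewrite !opprD !addrA.
apply: sigma_eq0.
  by rewrite lieBl; apply: wspanB; [apply: Ez2|apply: pfil_lie_vec].
apply/ffunP=> x; rewrite ffun_zeroE; have [->|x1] := eqVneq x 1%g; last exact: sz3.
by rewrite lieBl sigmaB ffun_subE z21 y31 subrr.
Qed.

(** * Lifts of p-th powers and their obstructions *)

Hypothesis odd_p : odd p.

Lemma p_prime : prime p. Proof. exact: pcharf_prime char_k. Qed.

Lemma mulrn_p (a : A) : a *+ p = 0.
Proof. by rewrite -mulr_natl -pzscal_nat pcharf0 // pzscal0 mul0r. Qed.

(** The left and right multiplications L and R by a commute, so (L - R)^p = L^p - R^p in odd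
    characteristic p. *)
Lemma lie_exp_p a b : lie (a ^+ p) b = iter p (lie a) b.
Proof.
have Lz : zmod_morphism ( *%R a) by move=> x y; rewrite mulrBr.
have Rz : zmod_morphism ( *%R^~ a) by move=> x y; rewrite mulrBl.
pose L := Endo Lz; pose R := Endo Rz.
have LR : GRing.comm L R by apply: endoP => x; rewrite !endo_mulE /= mulrA.
have iterE (f : endo A) j (a' : A) : (f ^+ j) a' = iter j f a'.
  by elim: j => [|j IHj] //; rewrite exprS endo_mulE IHj.
have -> : iter p (lie a) b = ((L - R) ^+ p) b.
  by rewrite iterE; apply: eq_iter => x; rewrite endo_subE.
have Mn (f : endo A) : f *+ p = 0.
  apply: endoP => x; rewrite -[RHS](mulrn_p (f x)).
  by elim: p => // j IHj; rewrite !mulrS endo_addE IHj.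
have LE j a' : (L ^+ j) a' = a ^+ j * a'.
  by rewrite iterE; elim: j => [|j IHj] /=; rewrite ?mul1r // IHj exprS mulrA.
have RE j a' : (R ^+ j) a' = a' * a ^+ j.
  by rewrite iterE; elim: j => [|j IHj] /=; rewrite ?mulr1 // IHj exprSr mulrA.
have := p_prime; rewrite exprBn_comm // big_ord_recr /=.
case: p odd_p Mn => // q oq Mn pr; rewrite big_ord_recl /= big1 => [|i _].
  rewrite ?expr0 ?mul1r ?subn0 ?mulr1 ?bin0 subnn binn ?mulr1n addr0 -signr_odd oq.
  have -> : (-1) ^+ true * L ^+ 0 * R ^+ q.+1 = - (R ^+ q.+1).
    by rewrite expr1 expr0 mulr1 mulN1r.
  by rewrite -endo_addE endo_subE LE RE.
have /dvdnP[j ->] : (q.+1 %| 'C(q.+1, bump 0 i))%N.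
  by apply: prime_dvd_bin => //; rewrite /bump /= add1n ltnS.
by rewrite mulrnA Mn.
Qed.

Lemma sigma_mul1 d d' a b x : wspan (le d) a -> wspan (le d') b -> supp1 (sigma d a) ->
  sigma (d + d') (a * b) x = sigma d a 1%g * sigma d' b x.
Proof.
move=> ha hb sa; rewrite (sigma_mul _ ha hb) (bigD1 1%g) //= invg1 mul1g sact1.
by rewrite big1 ?addr0 // => h h1; rewrite sa ?mul0r.
Qed.

Lemma sigma_mul1r d d' a b x : wspan (le d) a -> wspan (le d') b -> supp1 (sigma d' b) ->
  sigma (d + d') (a * b) x = sigma d a x * sact x (sigma d' b 1%g).
Proof.
move=> ha hb sb; rewrite (sigma_mul _ ha hb) (bigD1 x) //= mulVg.
by rewrite big1 ?addr0 // => h hx; rewrite sb ?raddf0 ?mulr0 // eq_divLg mulg1 eq_sym.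
Qed.

(** An invariant symbol at 1 is central in S # Gamma, so the top symbols of a b and b a cancel; by
    parity the degree drops by 2. *)
Lemma pfil_ad d d' a b : pfil d.+1 a -> supp1 (sigma d a) -> sinv rho (sigma d a 1%g) ->
  pfil d'.+1 b -> pfil (d + d').-1 (lie a b).
Proof.
move=> ha sa ia hb; apply: sigma_eq0.
  by apply: wspanB; [|rewrite addnC]; apply: pfil_mul.
apply/ffunP=> x; rewrite sigmaB ffun_subE ffun_zeroE.
rewrite (sigma_mul1 _ (pfil_wspan ha) (pfil_wspan hb) sa) addnC.
by rewrite (sigma_mul1r _ (pfil_wspan hb) (pfil_wspan ha) sa) ia mulrC subrr.
Qed.

Lemma pfil_iter_ad d a v i : pfil d.+1 a -> supp1 (sigma d a) -> sinv rho (sigma d a 1%g) ->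
  pfil (2 + i * d - 2 * i)%N (iter i (lie a) (vec v)).
Proof.
move=> ha sa ia; elim: i => [|i IHi]; first exact: pfil_vec.
rewrite iterS; move: IHi; case J: (2 + i * d - 2 * i)%N => [|j].
  by move=> /pfil0_eq0->; rewrite /lie mulr0 mul0r subrr; apply: wspan0.
move=> /(pfil_ad ha sa ia); congr (pfil _ _); rewrite !mulSn mulnS; lia.
Qed.

Lemma pfil_exp d a j : pfil d.+1 a -> pfil (j * d).+1 (a ^+ j).
Proof.
move=> ha; elim: j => [|j IHj]; first by rewrite expr0 -grp1; apply: pfil_grp.
by rewrite exprS mulSn; apply: pfil_mul.
Qed.

Lemma sigma_exp d a j : pfil d.+1 a -> supp1 (sigma d a) ->
  sigma (j * d) (a ^+ j) = tens 1%g (sigma d a 1%g ^+ j).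
Proof.
move=> ha sa; elim: j => [|j IHj].
  have -> : a ^+ 0 = word [::] 1%g by rewrite /word big_nil grp1 mulr1 expr0.
  by rewrite sigma_word //= big_nil expr0.
apply/ffunP=> x; rewrite !exprS mulSn sigma_mul1 //; last 2 first.
- exact: pfil_wspan.
- by apply/pfil_wspan/pfil_exp.
by rewrite IHj !tensE; case: ifP; rewrite ?mulr0.
Qed.

(* z lifts f ^+ p and is central up to the terms of degree p d + 1 - 2 l.     *)
Definition is_lift (l : nat) d f z := [/\ pfil (p * d).+1 z, gcomm z,
  sigma (p * d) z = tens 1%g (f ^+ p) & forall v, pfil (p * d + 2 - 2 * l)%N (lie z (vec v))].

Definition liftable (l : nat) := forall d f, sinv rho f -> f \is d.-homog -> exists z, is_lift l d f z.

(** The p-th power of an averaged lift a of f will do: [a^p, -] = ad(a)^p, and each ad(a) raises the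
    degree by at most d - 2. *)
Lemma liftable_p : liftable p.
Proof.
move=> d f hf hd; have hd' g : tens 1%g f g \is d.-homog.
  by rewrite tensE; case: ifP => _ //; apply: rpred0.
pose a := gavg (symbol_lift d (tens 1%g f)).
have Ea : pfil d.+1 a by apply/pfil_avg/pfil_lift.
have sa : sigma d a = tens 1%g f.
  rewrite /a /gavg sigmaZ sigma_sum (eq_bigr (fun=> tens 1%g f)) => [|g _].
    by rewrite sumr_const -scaler_nat scalerA mulVf // scale1r.
  apply/ffunP=> x; rewrite sigma_conj; last by apply/pfil_wspan/pfil_lift.
  rewrite sigma_lift // !tensE -mulgA eq_divLg mulg1.
  rewrite -[X in _ = if X then _ else _](inj_eq (mulIg g)) mul1g.
  by case: ifP => _; rewrite ?hf ?raddf0.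
have s1 : supp1 (sigma d a) by rewrite sa; apply: supp1_tens.
have sa1 : sigma d a 1%g = f by rewrite sa tensE eqxx.
exists (a ^+ p); split.
- exact: pfil_exp.
- by elim: {1}p => [|j IHj]; [exact: gcomm1|rewrite exprS; apply: gcommM IHj; apply: gcomm_avg].
- by rewrite sigma_exp // sa1.
move=> v; rewrite lie_exp_p addnC; apply: pfil_iter_ad => //; rewrite sa1; exact: hf.
Qed.

Lemma obstr_lie0 N z i : lie z (vec (dv i)) = 0 -> obstr N z i = 0.
Proof. by move=> h; rewrite /obstr h sigma0 ffun_zeroE cartier0. Qed.

Lemma obstr_lt N N' z i : (N' < N)%N -> pfil N' (lie z (vec (dv i))) -> obstr N z i = 0.
Proof.
case: N => // N lt h; rewrite /obstr /= (@sigma_E N' N) //.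
by rewrite ffun_zeroE cartier0.
Qed.

Lemma supp1_E_lie N m (w : A) : (N <= m.+1)%N -> wspan (le m) w ->
  (forall v, pfil N (lie w (vec v))) -> supp1 (sigma m w).
Proof.
move=> le hw h x x1; have [v hv] := no_refl 0 x1.
have := sigma_lie_vec v x hw; rewrite (sigma_E le (h v)) ffun_zeroE.
move/esym/eqP; rewrite mulf_eq0 sym_vec_eq0 => /orP[/eqP//|/eqP h0].
by case/negP: hv; rewrite -opprB h0 oppr0 mem0v.
Qed.

(* The obstruction does not depend on the choice of the lift: a lower-order   *)
(* change w of it has a symbol which is exact or a p-th power, and in the     *)
(* latter case the symbol can be removed by a lift from the same level l.     *)
Lemma lift_wd (l : nat) d m (w : A) i (N := (p * d + 2 - 2 * l)%N) : liftable l -> (m < p * d)%N ->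
  pfil m.+1 w -> gcomm w -> (forall v, pfil N (lie w (vec v))) -> obstr N w i = 0.
Proof.
move=> PL; elim/ltn_ind: m w => m IH w mpd hw cw hN.
have hlie v : pfil m.+2 (lie w (vec v)) by apply: pfil_lie_vec.
have sw := pfil_wspan hw.
(* The [w, v] have the parity of m as well as that of N; if these differ, they vanish. *)
have [par|par] := boolP (odd m.+2 == odd N); last first.
  exact: (obstr_lie0 _ (pfil_parity par (hlie _) (hN _))).
have [N0|Ngt0] := posnP N.
  by apply: obstr_lie0; apply: pfil0_eq0; rewrite -N0.
have [leN|ltN] := leqP m.+2 N.
  have [e|ne] := eqVneq N m.+2; last by apply: obstr_lt (hlie _); rewrite ltn_neqAle eq_sym ne.
  by rewrite /obstr e /= sigma_lie_vec // rep_one subrr raddf0 mulr0 cartier0.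
have s1 := @supp1_E_lie N m w ltN sw hN.
pose f := sigma m w 1%g; have pf j : sigma m.-1 (lie w (vec (dv j))) 1%g = f^`M(j).
  by rewrite -pois_dv -sigma_lie_pred.
have [eNm|neNm] := eqVneq N m.
  by rewrite /obstr eNm pf cartier_deriv.
have ltNm : (N < m)%N.
  have : N != m.+1 by apply: contraTneq par => ->; rewrite /= negbK; case: odd.
  by move: ltN neNm; lia.
have df j : f^`M(j) = 0.
  by rewrite -pf (sigma_E _ (hN _)) ?ffun_zeroE //; move: ltNm; lia.
have hf : f \is m.-homog by apply: sigma_homog.
have sf : sinv rho f by apply: sinv_gcomm.
have s_eq : sigma m w = tens 1%g f.
  by apply/ffunP=> x; rewrite tensE; case: eqP => [->|/eqP/s1].
have [z [Ez cz sz Lz Oz]] : exists z, [/\ pfil m.+1 z, gcomm z, sigma m z = tens 1%g f,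
    forall v, pfil N (lie z (vec v)) & obstr N z i = 0].
  have [f0|f0] := eqVneq f 0.
    exists 0; split=> [|g||v|]; first exact: wspan0.
    - by rewrite mul0r mulr0.
    - by rewrite sigma0 f0 (linear0 (tens 1%g : {linear S -> M})).
    - by rewrite lie0l; apply: wspan0.
    by apply: obstr_lie0; rewrite lie0l.
  pose r := frob_root char_k f; have rp : r ^+ p = f by apply: frob_rootK.
  have hr : r \is (m %/ p).-homog by apply: frob_root_homog.
  have em : m = (p * (m %/ p))%N.
    have := dhomogMn p hr; rewrite rp => h1.
    have := mlead_supp f0; rewrite mcoeff_msupp => h2.
    by rewrite mulnC -(dhomog_coeff_neq0 h1 h2) (dhomog_coeff_neq0 hf h2).
  move: (m %/ p)%N hr em => e hr em.
  have ir : sinv rho r.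
    by move=> g; apply: (mpoly_Frobenius_inj char_k); rewrite -rmorphXn /= rp sf.
  have [z [Ez cz sz Lz]] := PL _ _ ir hr.
  (* From m = p e < p d: the lift of r has commutators in degrees below those of N, so it does not
     contribute to the obstruction. *)
  have lt' : (p * e + 2 - 2 * l < N)%N.
    by move: Ngt0 mpd; rewrite em /N; move: (p * d)%N (p * e)%N => x y; lia.
  exists z; rewrite em; split=> // [|v|]; first by rewrite sz rp.
    have [e0|ne0] := posnP (p * e + 2 - 2 * l)%N.
      by have := Lz v; rewrite e0 => /pfil0_eq0->; apply: wspan0.
    apply: pfil_le (Lz v); first exact: ltnW.
    have : odd m = odd N by move: par; rewrite /= negbK => /eqP.
    rewrite em => <-; rewrite oddB; last by rewrite ltnW // -subn_gt0.
    by rewrite oddD mul2n odd_double !addbF.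
  exact: obstr_lt lt' (Lz _).
have -> : obstr N w i = obstr N (w - z) i + obstr N z i by rewrite -obstrD subrK.
rewrite Oz addr0; have Ewz : pfil m.-1 (w - z).
  by apply: sigma_eq0; [apply: wspanB|rewrite sigmaB sz s_eq subrr].
case: m => [|[|m]] in IH mpd Ewz {par ltN hw hlie sw s1 f pf neNm ltNm df hf sf s_eq Ez sz} *.
- by rewrite (pfil0_eq0 Ewz) obstr_lie0 // lie0l.
- by rewrite (pfil0_eq0 Ewz) obstr_lie0 // lie0l.
apply: (IH m) => //; first by rewrite (leq_trans _ mpd) // ltnW.
  exact: gcommB.
by move=> v; rewrite lieBl; apply: wspanB; [apply: hN|apply: Lz].
Qed.
Lemma lift_uniq (l : nat) d f z z' i (N := (p * d + 2 - 2 * l)%N) : liftable l ->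
  is_lift l d f z -> is_lift l d f z' -> obstr N z i = obstr N z' i.
Proof.
move=> PL [Ez cz sz Lz] [Ez' cz' sz' Lz'].
have -> : obstr N z i = obstr N (z - z') i + obstr N z' i by rewrite -obstrD subrK.
have: pfil (p * d)%N.-1 (z - z').
  by apply: sigma_eq0; [apply: wspanB|rewrite sigmaB sz sz' subrr].
have [/(congr1 predn) e|] := posnP (p * d)%N.
  by rewrite e => /pfil0_eq0->; rewrite obstr_lie0 ?add0r // lie0l.
case e: (p * d)%N => [|[|m]] // _ /= Ed.
  by rewrite (pfil0_eq0 Ed) obstr_lie0 ?add0r // lie0l.
rewrite (lift_wd _ PL _ Ed) ?add0r //; [by rewrite e|exact: gcommB|].
by move=> v; rewrite lieBl; apply: wspanB; [apply: Lz|apply: Lz'].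
Qed.

Lemma is_liftD (l : nat) d f f' z z' : is_lift l d f z -> is_lift l d f' z' ->
  is_lift l d (f + f') (z + z').
Proof.
move=> [Ez cz sz Lz] [Ez' cz' sz' Lz']; split.
- exact: wspanD.
- exact: gcommD.
- by rewrite sigmaD sz sz' (mpoly_Frobenius_D char_k) (linearD (tens 1%g : {linear S -> M})).
by move=> v; rewrite lieDl; apply: wspanD; [apply: Lz|apply: Lz'].
Qed.

Lemma pfil_mul_lie (l : nat) d d' z b : pfil (p * d).+1 z -> pfil (p * d' + 2 - 2 * l)%N b ->
  pfil (p * (d + d') + 2 - 2 * l)%N (z * b) /\ pfil (p * (d + d') + 2 - 2 * l)%N (b * z).
Proof.
move=> Ez; case e: (p * d' + 2 - 2 * l)%N => [|j].
  by move=> /pfil0_eq0->; rewrite mulr0 mul0r; split; apply: wspan0.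
move=> Eb; have -> : (p * (d + d') + 2 - 2 * l)%N = (p * d + j).+1.
  by rewrite mulnDr; move: e; move: (p * d)%N (p * d')%N => x y; lia.
by split; [|rewrite addnC]; apply: pfil_mul.
Qed.

Lemma is_liftM (l : nat) d d' f f' z z' : is_lift l d f z -> is_lift l d' f' z' ->
  is_lift l (d + d') (f * f') (z * z').
Proof.
move=> [Ez cz sz Lz] [Ez' cz' sz' Lz']; split.
- by rewrite mulnDr; apply: pfil_mul.
- exact: gcommM.
- apply/ffunP=> x; rewrite mulnDr sigma_mul1 ?sz ?sz'; [|exact: pfil_wspan..|].
    by rewrite !tensE eqxx exprMn; case: ifP; rewrite ?mulr0.
  exact: supp1_tens.
move=> v; rewrite lieMl; apply: wspanD.
  by have [] := pfil_mul_lie Ez (Lz' v).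
by rewrite [(d + d')%N]addnC; have [] := pfil_mul_lie Ez' (Lz v).
Qed.

(** The symbol of [z z', v] at 1 is the sum of f^p times that of [z', v] and f'^p times that of
    [z, v]; [cartierMp] pulls the powers out as f and f'. *)
Lemma obstrM (l : nat) d d' f f' z z' i : is_lift l d f z -> is_lift l d' f' z' ->
  obstr (p * (d + d') + 2 - 2 * l)%N (z * z') i =
  f * obstr (p * d' + 2 - 2 * l)%N z' i + f' * obstr (p * d + 2 - 2 * l)%N z i.
Proof.
move=> [Ez cz sz Lz] [Ez' cz' sz' Lz']; rewrite {1}/obstr lieMl sigmaD ffun_addE cartierD.
have s1 : supp1 (sigma (p * d) z) by rewrite sz; apply: supp1_tens.
have s1' : supp1 (sigma (p * d') z') by rewrite sz'; apply: supp1_tens.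
congr (_ + _).
  have := Lz' (dv i); rewrite /obstr; case e: (p * d' + 2 - 2 * l)%N => [|j] h.
    by rewrite (pfil0_eq0 h) mulr0 !sigma0 !ffun_zeroE !cartier0 mulr0.
  have -> : (p * (d + d') + 2 - 2 * l)%N.-1 = (p * d + j)%N.
    by rewrite mulnDr; move: e; move: (p * d)%N (p * d')%N => x y; lia.
  rewrite sigma_mul1 //; [|exact: pfil_wspan..].
  by rewrite sz tensE eqxx cartierMp.
have := Lz (dv i); rewrite /obstr; case e: (p * d + 2 - 2 * l)%N => [|j] h.
  by rewrite (pfil0_eq0 h) mul0r !sigma0 !ffun_zeroE !cartier0 mulr0.
have -> : (p * (d + d') + 2 - 2 * l)%N.-1 = (j + p * d')%N.
  by rewrite mulnDr; move: e; move: (p * d)%N (p * d')%N => x y; lia.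
rewrite sigma_mul1r //; [|exact: pfil_wspan..].
by rewrite sz' tensE eqxx sact1 mulrC cartierMp.
Qed.

(** The symbols have degree p d + 1 - 2 l <= p (d - 2) + 1, and the Cartier operator divides degrees
    by p. *)
Lemma msize_obstr (l : nat) d f z i : (p <= l)%N -> is_lift l d f z ->
  (msize (obstr (p * d + 2 - 2 * l)%N z i) <= d.-1)%N.
Proof.
move=> pl [Ez cz sz Lz]; have := Lz (dv i); rewrite /obstr.
case e: (p * d + 2 - 2 * l)%N => [|j] h.
  by rewrite (pfil0_eq0 h) !sigma0 !ffun_zeroE !cartier0 msize0.
have := msize_cartier char_k i (sigma_homog 1%g (pfil_wspan h)).
move: (msize _) => m hm.
have p3 : (2 < p)%N.
  by have := prime_gt1 p_prime; rewrite leq_eqVlt => /predU1P[e2|//]; move: odd_p; rewrite -e2.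
have {}e : (p * d + 2 = j.+1 + 2 * l)%N by move: e; move: (p * d)%N => x; lia.
suff : (m.+1 <= d)%N by case: d {e h Ez sz Lz}.
rewrite leqNgt; apply/negP=> dm.
have : (p * d <= p * m)%N by rewrite leq_mul2l -ltnS dm orbT.
move: hm e; rewrite mulnC; move: (p * m)%N (p * d)%N => x y; lia.
Qed.
Lemma pihomog_sum_sinv f : sinv rho f -> exists r : seq (nat * S),
  (forall t, t \in r -> sinv rho t.2 /\ t.2 \is t.1.-homog) /\ f = \sum_(t <- r) t.2.
Proof.
move=> hf; exists [seq (d, pihomog mdeg d f) | d <- index_iota 0 (msize f)]; split.
  move=> t /mapP[d _ ->] /=; split; [exact: sinv_pihomog|exact: pihomogP].
by rewrite big_map big_mkord {1}(pihomog_partitionE (leqnn (msize f))).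
Qed.

(* The obstruction is a derivation of the invariant ring with values in S, of *)
(* negative degree, hence it vanishes.                                        *)
Lemma liftableS (l : nat) : (p <= l)%N -> liftable l -> liftable l.+1.
Proof.
move=> pl PL; pose N d := (p * d + 2 - 2 * l)%N.
have /boolp.choice[zc hzc] : forall t : nat * S, exists z, sinv rho t.2 ->
    t.2 \is t.1.-homog -> is_lift l t.1 t.2 z.
  move=> [d f]; have [[h1 h2]|h] := pselect (sinv rho f /\ f \is d.-homog).
    by have [z hz] := PL d f h1 h2; exists z.
  by exists 0 => h1 h2; case: h.
have C0 i d f z : sinv rho f -> f \is d.-homog -> is_lift l d f z -> obstr (N d) z i = 0.
  pose c d f := obstr (N d) (zc (d, f)) i => hf hd hz.
  have cE d' f' z' : sinv rho f' -> f' \is d'.-homog -> is_lift l d' f' z' ->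
      c d' f' = obstr (N d') z' i.
    by move=> h1 h2; apply: lift_uniq PL (hzc (d', f') h1 h2).
  have cD d' f1 f2 : sinv rho f1 -> sinv rho f2 -> f1 \is d'.-homog -> f2 \is d'.-homog ->
      c d' (f1 + f2) = c d' f1 + c d' f2.
    move=> i1 i2 h1 h2; rewrite (cE _ _ _ _ _ (is_liftD (hzc (d', f1) i1 h1) (hzc (d', f2) i2 h2))).
    - exact: obstrD.
    - exact: sinvD.
    - exact: rpredD.
  have cM d1 d2 f1 f2 : sinv rho f1 -> sinv rho f2 -> f1 \is d1.-homog -> f2 \is d2.-homog ->
      c (d1 + d2)%N (f1 * f2) = f1 * c d2 f2 + f2 * c d1 f1.
    move=> i1 i2 h1 h2; have l1 := hzc (d1, f1) i1 h1; have l2 := hzc (d2, f2) i2 h2.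
    rewrite (cE _ _ _ _ _ (is_liftM l1 l2)); [exact: obstrM l1 l2|exact: sinvM|exact: dhomogM].
  have c0 d' : c d' 0 = 0.
    have := @cD d' 0 0 (sinv0 rho) (sinv0 rho) (rpred0 _) (rpred0 _).
    by rewrite addr0 -[LHS]addr0 => /addrI <-.
  (* The obstruction is attached to homogeneous invariants; summing over the components makes it an
     additive map on all invariants. *)
  pose de f' := \sum_(d' < msize f') c d' (pihomog mdeg d' f').
  have deE f' D : (msize f' <= D)%N -> de f' = \sum_(d' < D) c d' (pihomog mdeg d' f').
    move=> fD; rewrite /de (big_ord_widen _ (fun d' => c d' (pihomog mdeg d' f')) fD) big_mkcond.
    apply: eq_bigr => d' _; case: ltnP => // md.
    by rewrite pihomog_msize ?c0.
  have deD f1 f2 : sinv rho f1 -> sinv rho f2 -> de (f1 + f2) = de f1 + de f2.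
    move=> i1 i2; pose D := maxn (msize f1) (msize f2).
    rewrite (deE (f1 + f2) D (msizeD_le _ _)) (deE f1 D (leq_maxl _ _)) (deE f2 D (leq_maxr _ _)).
    rewrite -big_split; apply: eq_bigr => d' _ /=; rewrite pihomogD.
    by apply: cD; [exact: sinv_pihomog..|exact: pihomogP|exact: pihomogP].
  have de_hom d' f' : sinv rho f' -> f' \is d'.-homog -> de f' = c d' f'.
    move=> i' h'; rewrite (deE _ d'.+1 (msize_homog h')) (bigD1 ord_max) //= pihomog_dE //.
    rewrite big1 ?addr0 // => j jd; rewrite (@pihomog_ne0 _ _ _ d') ?c0 //.
    by rewrite eq_sym; apply: contra jd => /eqP jd; apply/eqP/val_inj.
  have de0 : de 0 = 0 by rewrite /de msize0 big_ord0.
  have de_sum (I : eqType) (r : seq I) (F : I -> S) : (forall t, t \in r -> sinv rho (F t)) ->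
      de (\sum_(t <- r) F t) = \sum_(t <- r) de (F t).
    elim: r => [|t r IHr] hr; first by rewrite !big_nil.
    have hr' t' : t' \in r -> sinv rho (F t') by move=> tr; apply: hr; rewrite inE tr orbT.
    rewrite !big_cons deD ?IHr //; first by apply: hr; rewrite mem_head.
    by rewrite big_seq; apply: sinv_sum.
  have deM f1 f2 : sinv rho f1 -> sinv rho f2 -> de (f1 * f2) = f1 * de f2 + f2 * de f1.
    move=> /pihomog_sum_sinv[r [hr ->]] /pihomog_sum_sinv[s [hs ->]].
    rewrite [de (\sum_(t <- r) _)]de_sum; last by move=> t /hr[].
    rewrite [de (\sum_(t <- s) _)]de_sum; last by move=> t /hs[].
    rewrite mulr_suml de_sum => [|t /hr[ht _]]; last first.
      by apply: sinvM => //; rewrite big_seq; apply: sinv_sum => t' /hs[].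
    rewrite [X in _ = X + _]mulr_suml [X in _ = _ + X]mulr_sumr -big_split.
    apply: eq_big_seq => t /hr[it ht] /=; rewrite mulr_sumr de_sum => [|t' /hs[ht' _]]; last exact: sinvM.
    rewrite mulr_sumr mulr_suml -big_split; apply: eq_big_seq => t' /hs[it' ht'] /=.
    rewrite (de_hom _ _ it ht) (de_hom _ _ it' ht') (de_hom (t.1 + t'.1)%N) ?cM //.
      exact: sinvM.
    exact: dhomogM.
  rewrite -(cE d f z) // -(de_hom d f) //.
  apply: (invariant_derivation_eq0 no_refl deD deM) => // d' f' i' h'.
  by rewrite (de_hom d') //; apply: msize_obstr pl (hzc (d', f') i' h').
move=> d f hf hd; have [z hz] := PL d f hf hd; have [Ez cz sz Lz] := hz.
have [y [Ey cy Ly]] := step cz Lz (fun i => C0 i d f z hf hd hz).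
have lt0 : (2 <= l)%N by apply: leq_trans pl; apply: prime_gt1 p_prime.
have e2 : (p * d + 2 - 2 * l.+1 = N d - 2)%N by rewrite /N; move: (p * d)%N => x; lia.
(* If N d = 0, all [z, v] already vanish and z is kept. *)
have [N0|Ngt0] := posnP (N d).
  by exists z; split=> // v; rewrite e2 N0; rewrite -/(N d) N0 in Lz; apply: Lz.
have ltN : (N d < p * d)%N by move: Ngt0; rewrite /N; move: (p * d)%N => x; lia.
exists (z - y); split.
- apply: wspanB => //; apply: pfil_le Ey; first exact: ltnW.
  rewrite /= /N oddB; last by rewrite ltnW // -subn_gt0.
  by rewrite oddD mul2n odd_double !addbF.
- exact: gcommB.
- rewrite sigmaB sz sigma_lt ?subr0 //.
  by apply: wspan_sub (pfil_wspan Ey) => j jN; apply: leq_ltn_trans jN ltN.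
by move=> v; rewrite e2 subn2; apply: Ly.
Qed.

(** * Central elements and their symbols *)

Hypothesis wspan_all : forall a, exists d, wspan (le d) a.

Lemma central_gen z : gcomm z -> (forall v, lie z (vec v) = 0) -> forall a, z * a = a * z.
Proof.
move=> cz Lz a; have [d] := wspan_all a.
elim/wspan_ind => [|x y hx hy|r l g _]; first by rewrite mulr0 mul0r.
  by rewrite mulrDr hx hy mulrDl.
rewrite mulrA -pzscalC -!mulrA; congr (_ * _); rewrite /word mulrA.
suff -> : z * \prod_(i <- l) vec e`_i = \prod_(i <- l) vec e`_i * z.
  by rewrite -!mulrA cz.
elim: l => [|i l IHl]; first by rewrite big_nil mulr1 mul1r.
have zv v : z * vec v = vec v * z by apply/eqP; rewrite -subr_eq0 -[X in X == _]/(lie _ _) Lz.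
by rewrite big_cons mulrA zv -!mulrA IHl.
Qed.

(** At level p + (p d + 2) the truncated bound p d + 2 - 2 l is 0, so all [z, v] vanish; z commutes
    with Gamma as well. *)
Theorem central_lift d f : sinv rho f -> f \is d.-homog -> exists z,
  [/\ wspan (le (p * d)) z, forall a, z * a = a * z & sigma (p * d) z = tens 1%g (f ^+ p)].
Proof.
have PL j : liftable (p + j).
  by elim: j => [|j IHj]; rewrite ?addn0 ?addnS; [exact: liftable_p|apply: liftableS => //; apply: leq_addr].
move=> hf hd; have [z [Ez cz sz Lz]] := PL (p * d + 2)%N d f hf hd.
exists z; split=> //; first exact: pfil_wspan.
apply: central_gen => // v; apply: pfil0_eq0; have := Lz v; congr (pfil _ _).
by move: (p * d)%N => x; lia.
Qed.

(** With z = z1 + z2 split by the parity of word lengths, [z1, v] = - [z2, v] has both parities and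
    vanishes. So the symbol sits at 1 and its Poisson brackets with V are 0. *)
Theorem central_symbol d z : (forall a, z * a = a * z) -> wspan (le d) z ->
  exists q, [/\ sigma d z = tens 1%g (q ^+ p), sinv rho (q ^+ p) & q ^+ p \is d.-homog].
Proof.
move=> hz sz; have [z1 [z2 [E1 E2 ez]]] := wspan_split sz.
have L0 v : lie z (vec v) = 0 by rewrite /lie hz subrr.
have L1 v : lie z1 (vec v) = 0.
  apply: (@pfil_disjoint d.+1); first exact: pfil_lie_vec.
  have -> : lie z1 (vec v) = - lie z2 (vec v).
    by apply/eqP; rewrite -addr_eq0 -lieDl -ez L0.
  by apply/wspanN/pfil_lie_vec.
have se : sigma d z = sigma d z1 by rewrite ez sigmaD (sigma_E (leqnn d) E2) addr0.
have s1 : supp1 (sigma d z1).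
  by apply: (@supp1_E_lie 0); [|exact: pfil_wspan|move=> v; rewrite L1; apply: wspan0].
have [q eq] : exists q, q ^+ p = sigma d z1 1%g.
  exists (frob_root char_k (sigma d z1 1%g)); apply: frob_rootK => i.
  by rewrite -pois_dv -sigma_lie_pred // L1 sigma0 ffun_zeroE.
exists q; rewrite eq -se; split.
- by apply/ffunP=> x; rewrite tensE; case: eqP => [->|/eqP x1] //; rewrite se s1.
- by apply: sinv_gcomm => // g; rewrite hz.
- exact: sigma_homog.
Qed.

Theorem symbol_eq0 d a : wspan (le d) a -> sigma d a = 0 -> wspan (lt d) a.
Proof.
move=> /wspan_split[a1 [a2 [E1 E2 ->]]]; rewrite sigmaD (sigma_E (leqnn d) E2) addr0 => s0.
apply: wspanD (pfil_lt E2); have := sigma_eq0 E1 s0; apply: wspan_sub => j /andP[jd _].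
exact: leq_trans jd (leq_pred d).
Qed.

End FilteredDeformation.

(** * Symbols in the symplectic reflection algebra *)

Section SraSymbol.
Variables (k : closedFieldType) (V : vectType k) (gT : finGroupType).
Variables (rho : linRep gT V) (omega : V -> V -> k).
Hypothesis omegaP : forall a u u' v, omega (a *: u + u') v = a * omega u v + omega u' v.
Hypothesis omega_alt : forall v, omega v v = 0.
Hypothesis omega_skew : forall u v, omega u v = - omega v u.
Hypothesis omega_inv : forall g u v, omega (rho g u) (rho g v) = omega u v.
Hypothesis ord_neq0 : forall s : gT, #[s]%g%:R != 0 :> k.
Variables (t : k) (c : gT -> k).
Hypothesis c_inv : forall s g : gT, s \in symp_refl rho -> c (s ^ g)%g = c s.
Notation n := (\dim {:V}).
Notation e := (vbasis {:V}).
Notation S := (mpoly n k).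
Notation M := {ffun gT -> mpoly n k}.
Notation TG := (smash (tensor_action rho)).
Notation kap := (kappa rho omega t c).
Notation A := (sra rho omega t c).
Notation sact g := (sym_map (rho g)).
Notation vec := (sra_vec rho omega t c).
Notation grp := (sra_grp rho omega t c).
Notation word := (word vec grp).
Notation wspan := (wspan vec grp).
Implicit Types (a b z : A) (f : M) (p q : S) (u v w : V) (g h x : gT) (l : seq 'I_n).

Let actB := sra_act_zmod omegaP omega_alt omega_skew omega_inv ord_neq0 (t := t) c_inv.
Let actM := (sra_act_monoid omegaP omega_alt omega_skew omega_inv ord_neq0 t c_inv).2.
Let actV := sra_act_vec omegaP omega_alt omega_skew omega_inv ord_neq0 t c_inv.
Let actG := sra_act_grp omegaP omega_alt omega_skew omega_inv ord_neq0 t c_inv.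
Let actZ := sra_act_scal omegaP omega_alt omega_skew omega_inv ord_neq0 t c_inv.

(** The component h (x) q of a (1 (x) 1) is rewritten as (h q) # h, since S # Gamma has its group
    elements on the right. *)
Definition sra_symbol (d : nat) a : M :=
  [ffun h => sact h (pihomog mdeg d (sra_act a (tens 1%g 1) h))].

Lemma sra_symbolE d a h :
  sra_symbol d a h = sact h (pihomog mdeg d (sra_act a (tens 1%g 1) h)).
Proof. by rewrite ffunE. Qed.

Lemma sra_symbolB d : zmod_morphism (sra_symbol d).
Proof.
move=> a b; apply/ffunP=> h; rewrite ffun_subE !sra_symbolE actB endo_subE.
by rewrite ffun_subE pihomogB raddfB.
Qed.

Lemma sra_symbolZ d r a : sra_symbol d (pzscal r * a) = r *: sra_symbol d a.
Proof.
apply/ffunP=> h; rewrite ffun_scaleE !sra_symbolE actM actZ endo_mulE.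
by rewrite [scal_endo _ _ _ _]/= ffun_scaleE linearZ sym_mapZ.
Qed.

Definition prod_vec g l : S := \prod_(i <- l) sym_vec (rho g^-1%g e`_i).

Lemma prod_vec_homog g l : prod_vec g l \is (size l).-homog.
Proof. by rewrite -sum1_size; apply: dhomog_bigprod => i; apply: sym_vec_homog. Qed.

Lemma sra_act_word l g :
  Mdeg (size l) (sra_act (word l g) (tens 1%g 1) - tens g (prod_vec g l)).
Proof.
elim: l => [|i l IHl].
  rewrite word_nil actG [grp_endo _ _ _]/= Gop_tens mulg1 /prod_vec big_nil subrr.
  exact: Mdeg0.
rewrite word_cons actM actV endo_mulE [mul_endo _ _ _ _]/=.
move: (sra_act _ _) IHl => f IHl; set q := prod_vec g l in IHl.
rewrite -[f](subrK (tens g q)) linearD -addrA; apply: MdegD.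
  exact: pbw_mul_deg.
rewrite /prod_vec big_cons -/(prod_vec g l) -/q; apply: pbw_mul_lead_tens.
exact: (msize_homog (prod_vec_homog g l)).
Qed.

Lemma sra_symbol_word d l g : (size l <= d)%N -> sra_symbol d (word l g) =
  if size l == d then tens g (\prod_(i <- l) ('X_i : S)) else 0.
Proof.
move=> ld; apply/ffunP=> x; rewrite sra_symbolE.
have := sra_act_word l g; move: (sra_act _ _) => f hf.
rewrite -[f](subrK (tens g (prod_vec g l))) ffun_addE pihomogD pihomog_msize; last first.
  exact: leq_trans (hf x) ld.
rewrite add0r tensE; have [->|xg] := eqVneq x g; last first.
  by rewrite pihomog0 raddf0; case: ifP; rewrite ?ffun_zeroE // tensE (negPf xg).
have hl := prod_vec_homog g l; case: eqVneq => [eld|ned]; last first.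
  by rewrite (pihomog_ne0 ned hl) raddf0 ffun_zeroE.
rewrite -eld (pihomog_dE hl) tensE eqxx rmorph_prod; apply: eq_bigr => i _ /=.
by rewrite sym_map_vec -rep_mul mulgV rep_one sym_vec_basis.
Qed.

Notation F := (sra_filtration rho omega t c).

Lemma smash_elt_fil d (y : tensor V) g : tensor_fil d y ->
  smash_fil (@tensor_filtration k V) d (smash_elt (tensor_action rho) y g).
Proof. by move=> hy h; rewrite ffunE; case: eqP => // _; apply: tensor_fil_0. Qed.

Lemma fil_sra_vec v : F 1%N (vec v).
Proof.
exists (smash_vec rho v); last by rewrite sra_vecE sra_piE.
exact/smash_elt_fil/tensor_fil_vec.
Qed.

Lemma fil_sra_grp g : F 0%N (grp g).
Proof.
exists (smash_grp rho g); last by rewrite sra_grpE sra_piE.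
apply: smash_elt_fil; have := @tensor_fil_scal k V 1; rewrite (pzscal_monoid (s := tensor V)).1.
exact.
Qed.

Lemma fil_sra_word l g : F (size l) (word l g).
Proof.
elim: l => [|i l IHl].
  rewrite word_nil.
  exact: fil_sra_grp.
by rewrite word_cons /= -add1n; apply: fil_M IHl; apply: fil_sra_vec.
Qed.

Lemma sra_piD_elt (y y' : tensor V) g :
  sra_pi omega t c (smash_elt (tensor_action rho) (y + y') g) =
  sra_pi omega t c (smash_elt (tensor_action rho) y g) +
  sra_pi omega t c (smash_elt (tensor_action rho) y' g).
Proof. by rewrite smash_eltD sra_piD. Qed.

Lemma sra_pi_word l g : sra_pi omega t c
  (smash_elt (tensor_action rho) (\prod_(i <- l) (<< fmu i >> : tensor V)) g) = word l g.
Proof.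
elim: l => [|i l IHl]; first by rewrite word_nil big_nil sra_grpE.
rewrite word_cons -IHl sra_vecE -sra_piM; congr (sra_pi _ _ _ _).
rewrite big_cons -tensor_vec_basis /smash_vec; symmetry.
apply: (etrans (smash_eltM _ _ _ _ _)); by rewrite mul1g alg_act1.
Qed.

Lemma smash_elt_sum (y : TG) : y = \sum_g smash_elt (tensor_action rho) (y g) g.
Proof.
apply/ffunP=> x; rewrite sum_ffunE (bigD1 x) //= ffunE eqxx big1 ?addr0 // => g /negPf gx.
by rewrite ffunE eq_sym gx.
Qed.

Lemma wspan_sra_pi_elt d (y : tensor V) g : tensor_fil d y ->
  wspan (fun j => j <= d)%N (sra_pi omega t c (smash_elt (tensor_action rho) y g)).
Proof.
move=> hy; pose L (x : tensor V) := sra_pi omega t c (smash_elt (tensor_action rho) x g).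
have L0 : L 0 = 0.
  apply: etrans (sra_pi0 rho omega t c); congr (sra_pi _ _ _ _).
  by apply/ffunP=> h; rewrite !ffunE; case: eqP.
rewrite -/(L y) (tensor_word_sum y) big_seq (big_morph L (fun u u' : tensor V => sra_piD_elt u u' g) L0).
apply: wspan_sum => w wy; rewrite /L smash_elt_scalM sra_piM sra_pi_scal sra_pi_word.
by apply/wspanZ/wspan_word; apply: hy wy.
Qed.

Lemma fil_wspan d a : F d a <-> wspan (fun j => j <= d)%N a.
Proof.
split=> [[y hy ->]|].
  rewrite -sra_piE (smash_elt_sum y) (big_morph _ (@sra_piD _ _ _ rho omega t c) (@sra_pi0 _ _ _ rho omega t c)).
  by apply: wspan_sum => g _; apply: wspan_sra_pi_elt; apply: hy.
elim/wspan_ind => [|x y hx hy|r l g ld]; [exact: fil_0|exact: fil_D|].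
rewrite -[d]add0n; apply: fil_M; first exact: fil_scal.
exact: fil_le ld (fil_sra_word l g).
Qed.

Lemma wspan_sra a : exists d, wspan (fun j => j <= d)%N a.
Proof.
pose P (x : A) := exists d, wspan (fun j => j <= d)%N x.
have PD (x x' : A) : P x -> P x' -> P (x + x').
  move=> [d hd] [d' hd']; exists (maxn d d'); apply: wspanD.
    by apply: wspan_sub hd => j jd; rewrite leq_max jd.
  by apply: wspan_sub hd' => j jd; rewrite leq_max jd orbT.
have P0 : P 0 by exists 0%N; apply: wspan0.
have [y ->] := sra_pi_surj a; rewrite (smash_elt_sum y).
rewrite (big_morph _ (@sra_piD _ _ _ rho omega t c) (@sra_pi0 _ _ _ rho omega t c)).
apply: (big_ind P P0 PD) => g _; exists (\max_(w <- monalg.msupp (y g)) fdeg w).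
by apply: wspan_sra_pi_elt => w wy; apply: leq_bigmax_seq.
Qed.

End SraSymbol.

(** * The associated graded algebra of the center *)

Section GradedIso.
Variables (k : fieldType) (n : nat) (A : pzAlgType k) (F : filtration A).
Variables (s : nat -> A -> mpoly n k) (B : mpoly n k -> Prop).
Hypothesis sB : forall d, zmod_morphism (s d).
Hypothesis s_homog : forall d z, F d z -> s d z \is d.-homog.
Hypothesis s_eq0 : forall d z, F d z -> s d z = 0 <-> fil_lt F d z.
Hypothesis sM : forall d d' z z', F d z -> F d' z' ->
  s (d + d') (z * z') = s d z * s d' z'.
Hypothesis s_scal : forall r, s 0 (pzscal r) = r%:A.
Hypothesis s_img : forall d z, F d z -> B (s d z).
Hypothesis B_sum : forall (r : seq nat) (f : nat -> mpoly n k),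
  (forall i, B (f i)) -> B (\sum_(i <- r) f i).
Hypothesis B_pihomog : forall d f, B f -> B (pihomog mdeg d f).
Hypothesis B_lift : forall d q, B q -> q \is d.-homog -> exists2 z, F d z & s d z = q.

Let s0 d : s d 0 = 0. Proof. by rewrite -(subrr 0) sB subrr. Qed.
Let sD d x y : s d (x + y) = s d x + s d y.
Proof. by rewrite -[y in LHS]opprK sB -[- y]sub0r sB s0 sub0r opprK. Qed.

(** A sequence in the Rees algebra is sent to the sum of its symbols; its terms contribute in
    distinct degrees, so all claims are checked one degree at a time. *)
Theorem graded_iso_exists : exists phi : gr F -> mpoly n k, graded_alg_iso B phi.
Proof.
have /boolp.choice[N hN] : forall r : rees F, exists N, forall i, (N <= i)%N -> rees_val r i = 0.
  by case=> a ha; have /asboolP[[N hN] _] := ha; exists N.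
pose psi (r : rees F) := \sum_(i < N r) s i (rees_val r i).
have psi_pi r d : pihomog mdeg d (psi r) = s d (rees_val r d).
  have h (i : 'I_(N r)) : pihomog mdeg d (s i (rees_val r i)) =
      if (i == d :> nat) then s d (rees_val r d) else 0.
    have hi := s_homog (reesP r i); case: eqVneq => [<-|ne]; first exact: pihomog_dE.
    exact: pihomog_ne0 hi.
  rewrite linear_sum (eq_bigr _ (fun i _ => h i)) -big_mkcond /=.
  have [dN|Nd] := ltnP d (N r); first by rewrite (big_pred1 (Ordinal dN)).
  rewrite (hN r d Nd) s0 big_pred0 // => i.
  by apply/negbTE; rewrite neq_ltn (leq_trans (ltn_ord i) Nd).
have psiB : zmod_morphism psi.
  by move=> r r'; apply: pihomog_ext => d; rewrite pihomogB !psi_pi -sB.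
have psiM r r' : psi (r * r') = psi r * psi r'.
  apply: pihomog_ext => d; rewrite pihomogM psi_pi.
  have -> : rees_val (r * r') d = \sum_(j < d.+1) rees_val r j * rees_val r' (d - j)%N by [].
  rewrite (big_morph _ (sD d) (s0 d)); apply: eq_bigr => j _.
  rewrite !psi_pi -sM ?subnKC //; first by rewrite -ltnS.
  - exact: reesP.
  exact: reesP.
have psi_ker r : psi r = 0 <-> r \in (@gr_ideal k A F : {pred rees F}).
  split=> [h|/asboolP h].
    by apply/asboolP=> i; apply/s_eq0; [apply: reesP|rewrite -psi_pi h pihomog0].
  by apply: pihomog_ext => d; rewrite psi_pi pihomog0; apply/s_eq0; [apply: reesP|].
have psi_eq r r' : gr_pi r = gr_pi r' <-> psi r = psi r'.
  split=> [/quot_piP/psi_ker|h]; first by rewrite psiB => /eqP; rewrite subr_eq0 => /eqP.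
  by apply/quot_piP/psi_ker; rewrite psiB h subrr.
have gr_surj (u : gr F) : exists r, u = gr_pi r by apply: quot_pi_surj.
have /boolp.choice[rep hrep] := gr_surj.
pose phi u := psi (rep u).
have phiE r : phi (gr_pi r) = psi r by apply/psi_eq; rewrite -hrep.
have phi_scal a : phi (pzscal a) = a%:A.
  have -> : (pzscal a : gr F) = gr_pi (rees_scal F a) by [].
  rewrite phiE; apply: pihomog_ext => d; rewrite psi_pi.
  have ha : (a%:A : mpoly n k) \is 0.-homog by apply/rpredZ/dhomog1.
  case: d => [|d]; first by rewrite [rees_val _ _]/= s_scal pihomog_dE.
  by rewrite (pihomog_ne0 _ ha) //; apply: s0.
exists phi; split; [split|split].
- move=> u v; have [r ->] := gr_surj u; have [r' ->] := gr_surj v.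
  by rewrite /gr_pi -quot_pi_zmod -/(gr_pi _) !phiE psiB.
- split.
    by rewrite -(pzscal_monoid (s := gr F)).1 phi_scal scale1r.
  move=> u v; have [r ->] := gr_surj u; have [r' ->] := gr_surj v.
  by rewrite /gr_pi -quot_piM -/(gr_pi _) !phiE psiM.
- exact: phi_scal.
- move=> u v; have [r ->] := gr_surj u; have [r' ->] := gr_surj v.
  by rewrite !phiE => h; apply/psi_eq.
- move=> f; split=> [hf|[u <-]]; last first.
    have [r ->] := gr_surj u; rewrite phiE /psi.
    rewrite -(big_mkord xpredT (fun i => s i (rees_val r i))).
    by apply: B_sum => i; apply/s_img/reesP.
  (* The last clause gives the sequence of lifts finite support. *)
  have /boolp.choice[z hz] : forall d, exists z, [/\ F d z, s d z = pihomog mdeg d f &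
      (msize f <= d)%N -> z = 0].
    move=> d; have [md|dm] := leqP (msize f) d.
      exists 0; split=> //; first exact: fil_0.
      by rewrite s0 pihomog_msize.
    have [z Fz sz] := B_lift (B_pihomog d hf) (pihomogP _ d f).
    by exists z; split=> // md; move: (leq_trans dm md); rewrite ltnn.
  have hr : (z : pseries A) \in (@rees_pred k A F : {pred pseries A}).
    by apply/asboolP; split; [exists (msize f) => i; case: (hz i)|move=> i; case: (hz i)].
  exists (gr_pi (Rees hr)); rewrite phiE; apply: pihomog_ext => d; rewrite psi_pi /=.
  by case: (hz d).
move=> d u; split=> [[a [ha ->]]|].
  by rewrite phiE; apply: homog_pihomog => i /ha; rewrite psi_pi => ->; apply: s0.
have [r ->] := gr_surj u; rewrite phiE => hd.
pose z : pseries A := fun i => if i == d then rees_val r i else 0.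
have hz : z \in (@rees_pred k A F : {pred pseries A}).
  apply/asboolP; split=> [|i]; last by rewrite /z; case: eqP => _; [apply: reesP|apply: fil_0].
  by exists d.+1 => i di; rewrite /z gtn_eqF.
exists (Rees hz); split=> [i id|]; first by rewrite /= /z (negPf id).
apply/psi_eq/pihomog_ext => i; rewrite [RHS]psi_pi /= /z.
have [->|id] := eqVneq i d; first by rewrite psi_pi.
by rewrite s0 (pihomog_ne0 _ hd) // eq_sym.
Qed.

End GradedIso.

(** * Dual bases for the symplectic form *)

Section DualBasis.
Variables (k : fieldType) (V : vectType k) (omega : V -> V -> k).
Hypothesis omegaP : forall a u u' v, omega (a *: u + u') v = a * omega u v + omega u' v.
Hypothesis omega_skew : forall u v, omega u v = - omega v u.
Hypothesis omega_nondeg : forall u, (forall v, omega u v = 0) -> u = 0.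
Notation n := (\dim {:V}).
Notation e := (vbasis {:V}).

Let omega_suml (I : Type) (r : seq I) (F : I -> k) (G : I -> V) v :
  omega (\sum_(i <- r) F i *: G i) v = \sum_(i <- r) F i * omega (G i) v.
Proof.
have o0 : omega 0 v = 0 by have := omegaP (-1) 0 0 v; rewrite scaler0 addr0 mulN1r addNr.
by elim: r => [|i r IHr]; rewrite ?big_nil // !big_cons omegaP IHr.
Qed.

Let omega_sumr (I : Type) (r : seq I) (F : I -> k) (G : I -> V) v :
  omega v (\sum_(i <- r) F i *: G i) = \sum_(i <- r) F i * omega v (G i).
Proof.
rewrite omega_skew omega_suml -sumrN; apply: eq_bigr => i _.
by rewrite -mulrN -omega_skew.
Qed.

(** Nondegeneracy makes the Gram matrix invertible; its inverse has the coordinates of the dual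
    basis as columns. *)
Lemma dual_basis : exists dv : 'I_n -> V,
  (forall i j : 'I_n, omega e`_i (dv j) = (i == j)%:R) /\
  (forall v, v = \sum_(i < n) omega e`_i v *: dv i).
Proof.
pose G : 'M[k]_n := \matrix_(i, j) omega e`_i e`_j.
have uG : G \in unitmx.
  rewrite -row_free_unit; apply: inj_row_free => x xG.
  have x0 : \sum_(i < n) x 0 i *: e`_i = 0.
    apply: omega_nondeg => v; rewrite (vbasis_sum v) omega_sumr big1 // => j _.
    have := congr1 (fun B : 'rV_n => B 0 j) xG; rewrite !mxE => xGj.
    rewrite omega_suml (eq_bigr (fun i => x 0 i * G i j)) ?xGj ?mulr0 // => i _.
    by rewrite mxE.
  apply/rowP=> i; rewrite mxE.
  by have /freeP/(_ (x 0) x0 i) := basis_free (vbasisP {:V}).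
pose dv j := \sum_(l < n) invmx G l j *: e`_l.
have dd (i j : 'I_n) : omega e`_i (dv j) = (i == j)%:R.
  have := congr1 (fun B : 'M_n => B i j) (mulmxV uG); rewrite !mxE => <-.
  by rewrite omega_sumr; apply: eq_bigr => l _; rewrite mulrC mxE.
exists dv; split=> // v; apply/eqP; rewrite -subr_eq0; apply/eqP.
apply: omega_nondeg => u; rewrite omega_skew (vbasis_sum u) omega_suml big1 ?oppr0 // => i _.
have -> a b : omega a (v - b) = omega a v - omega a b.
  by rewrite omega_skew addrC -scaleN1r omegaP mulN1r opprD opprK -!omega_skew addrC.
rewrite omega_sumr (bigD1 i) //= dd eqxx mulr1 big1 ?addr0 ?subrr ?mulr0 // => j ji.
by rewrite dd eq_sym (negPf ji) mulr0.
Qed.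

End DualBasis.

(** * Invariant p-th powers *)

Section FrobeniusInvariants.
Variables (k : closedFieldType) (p : nat) (char_k : p \in [pchar k]).
Variables (V : vectType k) (gT : finGroupType) (rho : linRep gT V).
Notation S := (mpoly (\dim {:V}) k).
Notation B := (frobenius_invariants rho p).
Implicit Types f q : S.

Lemma mderiv_expp i q : (q ^+ p)^`M(i) = 0.
Proof.
have h j : (q ^+ j.+1)^`M(i) = (q^`M(i) * q ^+ j) *+ j.+1.
  elim: j => [|j IHj]; first by rewrite expr1 expr0 mulr1.
  by rewrite exprS mderivM IHj mulrnAr mulrCA -exprS -mulrS.
have ch : p \in [pchar S] by rewrite (pchar_lalg S).
by rewrite -(prednK (prime_gt0 (pcharf_prime char_k))) h prednK ?(mulrn_pchar ch) // prime_gt0 // (pcharf_prime char_k).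
Qed.

(** Roots of order p are unique in S, so the root of an invariant is invariant. *)
Lemma frobenius_invariants_root d f : B f -> f \is d.-homog -> f != 0 ->
  exists q, [/\ f = q ^+ p, sinv rho q, q \is (d %/ p).-homog & d = (p * (d %/ p))%N].
Proof.
move=> [[h fh] hf] fd f0; pose q := frob_root char_k f.
have qp : q ^+ p = f by apply: frob_rootK => i; rewrite fh mderiv_expp.
have hq : q \is (d %/ p).-homog by apply: frob_root_homog.
exists q; split=> // [g|].
  by apply: (mpoly_Frobenius_inj char_k); rewrite -rmorphXn /= qp hf.
have := dhomogMn p hq; rewrite qp => h1; have := mlead_supp f0; rewrite mcoeff_msupp => h2.
by rewrite mulnC -(dhomog_coeff_neq0 h1 h2) (dhomog_coeff_neq0 fd h2).
Qed.

(** Frobenius is additive, so the part of degree d of h^p is the p-th power of the part of h of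
    degree d / p, or 0. *)
Lemma frobenius_invariants_pihomog d f : B f -> B (pihomog mdeg d f).
Proof.
move=> [[h ->] hf]; split; last exact: sinv_pihomog.
exists (\sum_(j < msize h) if (j * p == d)%N then pihomog mdeg j h else 0).
rewrite {1}(pihomog_partitionE (leqnn (msize h))) !(mpoly_Frobenius_sum char_k) linear_sum.
apply: eq_bigr => j _ /=; have hj := dhomogMn p (pihomogP mdeg j h).
case: eqP => [<-|/eqP ne]; first exact: pihomog_dE.
by rewrite (pihomog_ne0 ne hj) expr0n gtn_eqF // prime_gt0 // (pcharf_prime char_k).
Qed.

Lemma frobenius_invariants_sum (r : seq nat) (f : nat -> S) :
  (forall i, B (f i)) -> B (\sum_(i <- r) f i).
Proof.
move=> hf; elim: r => [|i r [[h hr] ir]].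
  rewrite big_nil; split; last exact: sinv0.
  by exists 0; rewrite expr0n gtn_eqF // prime_gt0 // (pcharf_prime char_k).
rewrite big_cons; have [[q eq] iq] := hf i; split; last exact: sinvD.
by exists (q + h); rewrite hr eq (mpoly_Frobenius_D char_k).
Qed.

End FrobeniusInvariants.

Theorem theorem9p1p1 (k : closedFieldType) (p : nat)
  (char_k : p \in [pchar k]) (odd_p : odd p)
  (V : vectType k) (omega : {skew_symmetric V})
  (omega_symp : is_psymplectic omega)
  (gT : finGroupType) (rho : linRep gT V) (rho_inj : injective rho)
  (rho_Sp : forall (g : gT) (x y : V), omega (rho g x) (rho g y) = omega x y)
  (order_gT : coprime #|gT| p)
  (c : gT -> k)
  (c_inv : forall s g : gT, s \in symp_refl rho -> c (s ^ g)%g = c s) :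
  exists phi : gr (center_filtration (sra_filtration rho omega 1 c)) ->
               mpoly (\dim {:V}) k,
    graded_alg_iso (frobenius_invariants rho p) phi.
Proof.
have p_pr := pcharf_prime char_k; have p_gt1 := prime_gt1 p_pr.
have omP a u u' v : omega (a *: u + u') v = a * omega u v + omega u' v by rewrite linearPl.
have om_skew u v : omega u v = - omega v u by rewrite hermC expr1 mulN1r.
(* Skew-symmetry gives 2 omega v v = 0, and p is odd. *)
have om_alt v : omega v v = 0.
  have /eqP := om_skew v v; rewrite -addr_eq0 -mulr2n -mulr_natl mulf_eq0 => /orP[|/eqP//].
  by rewrite -(dvdn_pcharf char_k) gtnNdvd // ltn_neqAle p_gt1 andbT; apply: contraTneq odd_p => <-.
have om_nd u : (forall v, omega u v = 0) -> u = 0.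
  move=> h; apply/eqP; have [/eqP nd _ _] := omega_symp.
  by rewrite -memv0 -nd; apply/mem_orthovP => v _; apply: h.
have coprime_neq0 (m : nat) : (m %| #|gT|)%N -> m%:R != 0 :> k.
  move=> md; rewrite -(dvdn_pcharf char_k) -prime_coprime // coprime_sym.
  exact: coprime_dvdl md order_gT.
have ord_neq0 (s : gT) : #[s]%g%:R != 0 :> k.
  by apply: coprime_neq0; rewrite -cardsT; apply: cardSg (subsetT _).
have gT_unit : #|gT|%:R != 0 :> k by apply: coprime_neq0.
have no_refl := rank_1sub_ge2 omP om_alt om_skew rho_Sp ord_neq0 rho_inj om_nd.
have [dv [dv_dual dv_span]] := dual_basis omP om_skew om_nd.
(* As t = 1, the component of [kap] at 1 is omega itself, so the Poisson brackets with the dual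
   basis are the partial derivatives. *)
pose kap := kappa rho omega 1 c.
have kap1 u v : kap u v 1%g = omega u v by rewrite /kap kappa1 mul1r.
have dv_dual' (i j : 'I_(\dim {:V})) : kap (vbasis {:V})`_i (dv j) 1%g = (i == j)%:R :> k by rewrite kap1.
have dv_span' v : v = \sum_(i < \dim {:V}) kap (vbasis {:V})`_i v 1%g *: dv i.
  by rewrite {1}(dv_span v); apply: eq_bigr => i _; rewrite kap1.
pose sB := @sra_symbolB _ _ _ _ _ omP om_alt om_skew rho_Sp ord_neq0 1 c c_inv.
pose sZ := @sra_symbolZ _ _ _ _ _ omP om_alt om_skew rho_Sp ord_neq0 1 c c_inv.
pose sW := @sra_symbol_word _ _ _ _ _ omP om_alt om_skew rho_Sp ord_neq0 1 c c_inv.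
have vP := sra_vecP rho omega 1 c; have gM := sra_grpM rho omega 1 c.
have g1 := sra_grp1 rho omega 1 c; have gv := sra_grp_vec rho omega 1 c.
have cE := sra_commE rho omega 1 c.
pose F := sra_filtration rho omega 1 c.
(* Symbols of central elements are supported at 1, so the component there carries everything. *)
pose s d (z : center (sra rho omega 1 c)) := sra_symbol d (val z) 1%g.
have Fspan d a : F d a ->
    wspan (sra_vec rho omega 1 c) (sra_grp rho omega 1 c) (fun j => j <= d)%N a.
  by move=> Fa; apply/fil_wspan.
have zC (z : center (sra rho omega 1 c)) a : val z * a = a * val z.
  by move: a; apply/asboolP; apply: (valP z).
have zS d (z : center (sra rho omega 1 c)) : F d (val z) -> exists q,
    [/\ sra_symbol d (val z) = tens 1%g (q ^+ p), sinv rho (q ^+ p) & q ^+ p \is d.-homog].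
  move=> /Fspan; apply: (central_symbol vP g1 gM gv cE sB sZ sW no_refl dv_dual' char_k).
  exact: zC.
have tens1 q : tens 1%g q 1%g = q :> mpoly (\dim {:V}) k by rewrite tensE eqxx.
apply: (@graded_iso_exists _ _ _ _ s).
- by move=> d x y; rewrite /s raddfB sB ffun_subE.
- by move=> d z /zS[q [sz _ hq]]; rewrite /s sz tens1.
- move=> d z Fz; have [q [sz _ _]] := zS d z Fz; split=> [|h].
    rewrite /s sz tens1 => q0; have /(symbol_eq0 vP gM gv cE sB sZ sW (Fspan d _ Fz)) : sra_symbol d (val z) = 0.
      by rewrite sz q0 tens0.
    (* In degree 0, [fil_lt] asks for z = 0, which holds as there are no words of negative
       length. *)
    case: d {Fz sz} => [|d] h /=; last by apply/fil_wspan.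
    apply: val_inj; apply: (@pfil0_eq0 _ _ _ _ _ _ (val z)).
    by apply: wspan_sub h.
  rewrite /s (sigma_lt sB sZ sW) ?ffun_zeroE //.
  case: d h {Fz sz} => [|d] /= h; last by apply/fil_wspan.
  by rewrite h; apply: wspan0.
- move=> d d' z z' Fz Fz'; have [q [sz _ _]] := zS d z Fz.
  rewrite /s (sigma_mul1 vP gM gv sB sZ sW) //.
  + exact: Fspan.
  + exact: Fspan.
  by rewrite sz; apply: supp1_tens.
- move=> r; rewrite /s; have -> : val (pzscal r : center (sra rho omega 1 c)) =
      pzscal r * word (sra_vec rho omega 1 c) (sra_grp rho omega 1 c) [::] 1%g.
    by rewrite word_nil g1; symmetry; apply: mulr1.
  by rewrite sZ sW // big_nil ffun_scaleE tens1.
- move=> d z /zS[q [sz iq _]]; rewrite /s sz tens1; split; [by exists q|exact: iq].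
- exact: frobenius_invariants_sum.
- exact: frobenius_invariants_pihomog.
move=> d f Bf hf; have [->|f0] := eqVneq f 0.
  by exists 0; [apply: fil_0|rewrite /s raddf0 (sigma0 sB) ffun_zeroE].
have [q [fq iq hq ed]] := frobenius_invariants_root char_k Bf hf f0.
have [z [wz cz sz]] := central_lift vP g1 gM gv cE sB sZ sW gT_unit no_refl dv_dual' dv_span' char_k odd_p (@wspan_sra _ _ _ _ _ _ _) iq hq.
have hz : z \in (@central k (sra rho omega 1 c) : {pred _}) by apply/asboolP.
exists (Center hz); first by rewrite ed; apply/fil_wspan.
by rewrite /s ed /= sz tens1 fq.
Qed.
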